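(* Let $(p,q,r)\in P\cup P_1\cup P_2$ and $\widetilde\gamma\in(0,1)$. Assume that $$\widetilde I=\int_\Omega\frac{\widetilde w^{\widetilde q}(\omega)}{\widetilde w_0^{\widetilde q\widetilde\gamma}(\omega)\left(\sum_{k=1}^n\widetilde w_k^r(\omega)\right)^{\widetilde q(1-\widetilde\gamma)/r}}J(\omega)\,d\omega<\infty,\qquad \frac1{\widetilde q}=\frac1q-\frac{\widetilde\gamma}p-\frac{1-\widetilde\gamma}r,$$ and $\widetilde I'_1=\ldots=\widetilde I'_n$, where $$\widetilde I'_j=\int_\Omega\frac{\widetilde w^{\widetilde q}(\omega)\widetilde w_j^r(\omega)}{\widetilde w_0^{\widetilde q\widetilde\gamma}(\omega)\left(\sum_{k=1}^n\widetilde w_k^r(\omega)\right)^{\widetilde q(1-\widetilde\gamma)/r+1}}J(\omega)\,d\omega,\quad j=1,\ldots,n.$$ Then for all $x$ such that $w_0x\in L_p(T)$ and $w_jx\in L_r(T)$, $j=1,\ldots,n$, the inequality $$\|wx\|_{L_q(T)}\le\widetilde K\,\|w_0x\|_{L_p(T)}^{\widetilde\gamma}\left(\max_{1\le j\le n}\|w_jx\|_{L_r(T)}\right)^{1-\widetilde\gamma}$$ holds and is sharp (the constant cannot be replaced by a smaller one), where $$\widetilde K=\widetilde\gamma^{-\frac{\widetilde\gamma}p}\left(\frac{1-\widetilde\gamma}n\right)^{-\frac{1-\widetilde\gamma}r}\left(\frac{B\left(\widetilde q\widetilde\gamma/p,\ \widetilde q(1-\widetilde\gamma)/r\right)\widetilde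 I}{|\widetilde\theta_1-\widetilde\theta_0|(\widetilde\gamma r+(1-\widetilde\gamma)p)}\right)^{1/\widetilde q}$$ and $B$ is the Euler beta-function.
   Context: Parameter sets (all exponents finite): $P=\{(p,q,r):1\le q<p,r<\infty\}$, $P_1=\{(p,q,r):1\le q=r<p<\infty\}$, $P_2=\{(p,q,r):1\le q=p<r<\infty\}$. $T$ is a cone in $\mathbb R^d$ with Lebesgue measure. $w,w_0,w_1,\ldots,w_n$ are measurable functions on $T$ such that $|w|$, $|w_0|$ are homogeneous of degrees $\theta,\theta_0$ respectively (i.e. $|w(ct)|=c^\theta|w(t)|$, $c>0$, etc.), all $|w_j|$, $j=1,\ldots,n$, are homogeneous of degree $\theta_1$, and $w(t),w_0(t)\ne0$, $\sum_{j=1}^n|w_j(t)|\ne0$ for almost all $t\in T$. Put $$\widetilde\theta=\theta+d/q,\quad\widetilde\theta_0=\theta_0+d/p,\quad\widetilde\theta_1=\theta_1+d/r,\quad\widetilde\gamma=\frac{\widetilde\theta_1-\widetilde\theta}{\widetilde\theta_1-\widetilde\theta_0}.$$ Polar transformation: $t_1=\rho\cos\omega_1$, $t_2=\rho\sin\omega_1\cos\omega_2$, ..., $t_{d-1}=\rho\sin\omega_1\cdots\sin\omega_{d-2}\cos\omega_{d-1}$, $t_d=\rho\sin\omega_1\cdots\sin\omega_{d-2}\sin\omega_{d-1}$; $\omega=(\omega_1,\ldots,\omega_{d-1})$, $\Omega$ is the range of $\omega$ for $t\in T$, $J(\omega)=\sin^{d-2}\omega_1\sin^{d-3}\omega_2\cdots\sin\omega_{d-2}$,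 and for a function $f\in\{w,w_0,w_1,\ldots,w_n\}$, $\widetilde f(\omega)=|f(t)|$ at the point $t$ with $\rho=1$ and angles $\omega$. (For $d=1$, $\Omega$ is the set of those of the directions $\pm1$ lying in $T$, $J=1$, and integration over $\Omega$ is summation.) Functions are real- or complex-valued. *)

(* Defs.v *)
From HB Require Import structures.
From mathcomp Require Import all_boot all_order all_algebra.
From mathcomp Require Import complex.
From mathcomp Require Import all_classical all_reals all_analysis.

Set Implicit Arguments.
Unset Strict Implicit.
Unset Printing Implicit Defensive.

Import Order.TTheory GRing.Theory Num.Theory.
Import numFieldNormedType.Exports.

Local Open Scope classical_set_scope.
Local Open Scope ring_scope.

Section LebesgueMeasure.
Context (R : realType).

Local Notation cube n := (n.-tuple (measurableTypeR R)).

Definition tcons n (z : (measurableTypeR R * cube n)%type) : cube n.+1 :=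
  [tuple of z.1 :: z.2].

Lemma measurable_tcons n : measurable_fun setT (@tcons n).
Proof. exact: (measurable_cons measurable_fst measurable_snd). Qed.

Section tensor_lebesgue.
Context n (m : {sigma_finite_measure set (cube n) -> \bar R}).

(* Under the identification R^(n+1) = R * R^n, the product of the Borel-Lebesgue
   measure of R with m. *)
Definition tensor_lebesgue : set (cube n.+1) -> \bar R :=
  pushforward (lebesgue_measure \x m)%E (@tcons n).

Let tensor0 : tensor_lebesgue set0 = 0%E.
Proof. by apply: measure0; exact: measurable_tcons. Qed.

Let tensor_ge0 A : (0 <= tensor_lebesgue A)%E.
Proof. by apply: measure_ge0; exact: measurable_tcons. Qed.

Let tensor_sigma_additive : semi_sigma_additive tensor_lebesgue.
Proof. by apply: measure_semi_sigma_additive; exact: measurable_tcons. Qed.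

HB.instance Definition _ := isMeasure.Build _ _ _ tensor_lebesgue
  tensor0 tensor_ge0 tensor_sigma_additive.

Let tensor_sigma_finite : sigma_finite setT tensor_lebesgue.
Proof.
have /sigma_finiteP[F [TF ndF Foo]] := sigma_finiteT (@lebesgue_measure R).
have /sigma_finiteP[G [TG ndG Goo]] := sigma_finiteT m.
pose h (t : cube n.+1) : (measurableTypeR R * cube n)%type :=
  (thead t, [tuple of behead t]).
have mh : measurable_fun setT h.
  by apply: measurable_fun_pair;
    [exact: measurable_tnth | exact: measurable_behead].
have tconsK : h \o @tcons n = id.
  by apply/funext => -[a t]; congr pair; apply/val_inj.
exists (fun k => h @^-1` (F k `*` G k)).
  apply/esym/seteqP; split => // t _.
  have [i _ Fi] : (\bigcup_k F k) (h t).1 by rewrite -TF.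
  have [j _ Gj] : (\bigcup_k G k) (h t).2 by rewrite -TG.
  exists (maxn i j) => //; split.
  - by move: Fi; apply/subsetPset/ndF/leq_maxl.
  - by move: Gj; apply/subsetPset/ndG/leq_maxr.
move=> k; have [? ?] := Foo k; have [? ?] := Goo k.
have mFG : measurable (F k `*` G k) by exact: measurableX.
split; first by rewrite -[X in measurable X]setTI; exact: mh.
rewrite /tensor_lebesgue /pushforward -comp_preimage tconsK preimage_id.
by rewrite product_measure1E// lte_mul_pinfty// ge0_fin_numE.
Qed.

HB.instance Definition _ := Measure_isSigmaFinite.Build _ _ _ tensor_lebesgue
  tensor_sigma_finite.

End tensor_lebesgue.

Fixpoint borel_lebesgue d : {sigma_finite_measure set (cube d) -> \bar R} :=
  match d with
  | 0 => dirac ([tuple] : cube 0)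
  | d'.+1 => tensor_lebesgue (borel_lebesgue d')
  end.

(* R^d with the sigma-algebra of all Lebesgue measurable sets: the completion
   (Caratheodory extension) of the d-fold product of the Borel-Lebesgue measure
   of R; the elements are the d-tuples of reals. *)
Definition euclid d : measurableType _ :=
  caratheodory_type (mu_ext (borel_lebesgue d)).

Definition lebesgue d : {measure set (euclid d) -> \bar R} :=
  @completed_measure_extension _ _ _ (borel_lebesgue d).

End LebesgueMeasure.

Notation normc := ComplexField.Normc.normc.

Section ComplexFunctions.
Context (R : realType) (d : nat).
Implicit Types (T : set (euclid R d)) (f x : euclid R d -> R[i]) (p : R).

Definition cmeasurable T f :=
  measurable_fun T (fun t => complex.Re (f t) : measurableTypeR R) /\
  measurable_fun T (fun t => complex.Im (f t) : measurableTypeR R).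

Definition normL p T f : \bar R :=
  'N[lebesgue R d]_(p%:E)[(fun t => (normc (f t))%:E) \_ T].

Definition inL p T f := cmeasurable T f /\ (normL p T f < +oo)%E.

(* A real-valued function is encoded as a complex-valued one with zero imaginary
   part. *)
Variant scalars := RealScalars | ComplexScalars.

Definition valued_in (s : scalars) T x :=
  match s with
  | RealScalars => forall t, T t -> complex.Im (x t) = 0
  | ComplexScalars => True
  end.

Definition dilate (c : R) (t : euclid R d) : euclid R d :=
  [tuple c * tnth t i | i < d].

Definition cone T := forall c t, 0 < c -> T t -> T (dilate c t).

Definition abs_homogeneous (theta : R) T f := forall c t, 0 < c -> T t ->
  normc (f (dilate c t)) = c `^ theta * normc (f t).

End ComplexFunctions.

Section Polar.
Context (R : realType) (d : nat).

(* Indices start at 0: omega`_k is the angle omega_(k+1). *)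
Definition polar (rho : R) (omega : euclid R d.-1) : euclid R d :=
  [tuple rho * (\prod_(k < i) sin (omega`_k)) *
         (if (i < d.-1)%N then cos (omega`_i) else 1) | i < d].

Definition polar_jacobian (omega : euclid R d.-1) : R :=
  \prod_(k < d.-2) sin (omega`_k) ^+ (d.-2 - k).

Definition angles : set (euclid R d.-1) := [set omega | forall k : 'I_d.-1,
  if (k < d.-2)%N then 0 <= tnth omega k <= pi
  else 0 <= tnth omega k < 2 * pi].

Definition Omega (T : set (euclid R d)) : set (euclid R d.-1) :=
  [set omega | angles omega /\ exists2 rho, 0 < rho & T (polar rho omega)].

(* For d = 1 the directions are the points 1 and -1 of the line. *)
Definition angular_integral (T : set (euclid R d)) (g : euclid R d -> R)
    : \bar R :=
  if d == 1%N then
    (\sum_(s <- [:: 1; -1] | `[< T (nseq_tuple d s) >]) g (nseq_tuple d s))%:E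
  else
    (\int[lebesgue R d.-1]_(omega in Omega T)
       (g (polar 1 omega) * polar_jacobian omega)%:E)%E.

End Polar.

Definition beta (R : realType) (a b : R) : R :=
  \int[lebesgue_measure]_(t in `]0, 1[) (t `^ (a - 1) * (1 - t) `^ (b - 1)).

Definition param_P (R : realType) (p q r : R) := [/\ 1 <= q, q < p & q < r].
Definition param_P1 (R : realType) (p q r : R) := [/\ 1 <= q, q = r & r < p].
Definition param_P2 (R : realType) (p q r : R) := [/\ 1 <= q, q = p & p < r].

(* Main.v *)
Require Import Defs.
From HB Require Import structures.
From mathcomp Require Import all_boot all_order all_algebra.
From mathcomp Require Import complex ring lra.
From mathcomp Require Import all_classical all_reals all_analysis.
From mathcomp Require Import measurable_realfun measurable_fun_approximation
simple_functions.

Set Implicit Arguments.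
Unset Strict Implicit.
Unset Printing Implicit Defensive.

Import Order.TTheory GRing.Theory Num.Theory.
Import numFieldNormedType.Exports.

Local Open Scope classical_set_scope.
Local Open Scope ring_scope.

(* Replacing the n weights w_j by the single weight S = sum_j |w_j|^r costs at
   most n max_j ||w_j x||_r^r.  Pointwise there is u >= 0 with
     |w|^q u^q = Z,   |w0|^p u^p = s Z,   S u^r = (1 - s) Z,
   where s in [0, 1] solves (p-q) ln(1-s) - (r-q) ln s = y for
   y = (r-q) ln(|w|^q / |w0|^p) + (p-q) ln(S / |w|^q), and
   Z = s^la (1-s)^ka H with la = q~ g~/p, ka = q~ (1-g~)/r (g~ is gamma tilde)
   and H the integrand of I~, homogeneous of degree -d.
   Young's inequality against u bounds |w|^q |x|^q by
     (q/p) |w0|^p |x|^p + (q/r) S |x|^r + (combination of s Z and (1-s) Z);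
   rescaling w0 and S by constants and optimising over them gives the product
   form.  The integrals of s Z and (1-s) Z are explicit: along each ray y is
   affine in ln rho while H rho^d is constant, so polar coordinates split them
   into I~ times an integral over y in R, and the substitution y -> s makes the
   latter a beta integral.  The same function u turns every step into an
   equality when all I'_j agree, because then all ||w_j u||_r agree. *)

(** * Change of variables on the line *)

(** In logarithms the three equations read (p-q) ln u = ln s + ln(|w|^q / |w0|^p) and (r-q) ln u =
    ln(1-s) + ln(|w|^q / S); eliminating u gives the equation for s. Any la, ka with (p-q) la +
    (r-q) ka = q then express Z. The pair chosen gives H degree -d, so that H rho^(d-1) d rho is a
    constant times d(ln rho) and the radial variable separates. When p = q or r = q the equation for
    s is solvable only for y of one sign; elsewhere u = 0, and |w|^q <= |w0|^p, respectively |w|^q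
    <= S, holds outright. The beta recurrence makes the integrals of s Z and (1-s) Z equal to g~ M
    and (1-g~) M, where M is that of Z; hence the powers of g~ and 1-g~ in the constant. The
    obstacle is measurability: the weights are only Lebesgue measurable, the unit sphere is a null
    set, and the angular integrals sample the weights exactly there. Homogeneity moves the values to
    a sphere of almost any other radius, where Borel versions can be trusted. Polar coordinates
    themselves are built by induction on the dimension from substitutions in one variable. *)

Section WeightedPushforward.
Context d1 d2 (X : measurableType d1) (Y : measurableType d2) (R : realType).
Variables (mu : {measure set X -> \bar R}) (k : X -> R) (F : X -> Y).
Variables (mk : measurable_fun setT k) (k0 : forall x, 0 <= k x).
Variable mF : measurable_fun setT F.

(* The proof arguments are what lets unification find the measure instance. *)
Definition weighted_pushforward (_ : measurable_fun setT k) (_ : forall x, 0 <= k x)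
  (_ : measurable_fun setT F) (A : set Y) : \bar R :=
  (\int[mu]_(x in F @^-1` A) (k x)%:E)%E.

Local Notation nu := (weighted_pushforward mk k0 mF).

Let mpre A : measurable A -> measurable (F @^-1` A).
Proof. by move=> mA; rewrite -[X in measurable X]setTI; exact: mF. Qed.

Let nu0 : nu set0 = 0%E.
Proof. by rewrite /weighted_pushforward preimage_set0 integral_set0. Qed.

Let nu_ge0 A : (0 <= nu A)%E.
Proof. by apply: integral_ge0 => x _; rewrite lee_fin. Qed.

Let nu_sigma_additive : semi_sigma_additive nu.
Proof.
move=> A mA tA mUA; rewrite /weighted_pushforward; apply: cvg_toP.
  apply: ereal_nondecreasing_is_cvgn => m n mn.
  by apply: lee_sum_nneg_natr => // i _ _; exact: nu_ge0.
rewrite preimage_bigcup ge0_integral_bigcup//=.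
- by move=> i; exact: mpre.
- by apply/measurable_EFinP; exact: measurable_funTS.
- by move=> x _; rewrite lee_fin.
- apply/trivIsetP => i j _ _ ij; rewrite -preimage_setI.
  by move/trivIsetP : tA => /(_ i j I I ij) ->; rewrite preimage_set0.
Qed.

HB.instance Definition _ := isMeasure.Build _ _ _ nu
  nu0 nu_ge0 nu_sigma_additive.

End WeightedPushforward.

Section Density.
Context d1 d2 (X : measurableType d1) (Y : measurableType d2) (R : realType).
Variables (mu1 : {measure set X -> \bar R}) (mu2 : {measure set Y -> \bar R}).
Variables (k : X -> R) (F : X -> Y).
Hypotheses (mk : measurable_fun setT k) (k0 : forall x, 0 <= k x).
Hypothesis mF : measurable_fun setT F.
Hypothesis kF : forall A, measurable A ->
  (\int[mu1]_(x in F @^-1` A) (k x)%:E = mu2 A)%E.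
Local Open Scope ereal_scope.
Import HBNNSimple.

(** Simple functions below h increase to h, and on their level sets the claim is [kF]. With k = F'
    it is the substitution rule; with F = id and k an indicator it is restriction to a set. *)
Lemma ge0_integral_density (h : Y -> \bar R) :
  measurable_fun setT h -> (forall y, 0 <= h y) ->
  \int[mu1]_x ((k x)%:E * h (F x)) = \int[mu2]_y h y.
Proof.
move=> mh h0; pose g := nnsfun_approx measurableT mh.
have mkE : measurable_fun setT (EFin \o k) by exact/measurable_EFinP.
have mgF n : measurable_fun setT (fun x => (g n (F x))%:E).
  by apply/measurable_EFinP; apply: measurableT_comp.
have nd x m n : (m <= n)%N -> (g m x)%:E <= (g n x)%:E.
  by move=> mn; rewrite lee_fin; exact/lefP/nd_nnsfun_approx.
have gh x : (g n x)%:E @[n --> \oo] --> h x by apply: cvg_nnsfun_approx.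
transitivity (limn (fun n => \int[mu1]_x ((k x)%:E * (g n (F x))%:E))).
  rewrite -monotone_convergence//; first last.
  - by move=> x _ m n mn; rewrite lee_wpmul2l ?lee_fin// -?lee_fin nd.
  - by move=> n x _; rewrite mule_ge0// lee_fin.
  - by move=> n; apply: emeasurable_funM.
  by apply: eq_integral => x _; apply/esym/cvg_lim => //; exact: cvgeZl.
transitivity (limn (fun n => \int[mu2]_y (g n y)%:E)); last first.
  rewrite -monotone_convergence//; first last.
  - by move=> x _ m n mn; exact: nd.
  - by move=> n x _; rewrite lee_fin.
  - by move=> n; exact/measurable_EFinP.
  by apply: eq_integral => x _; apply/cvg_lim => //; exact: gh.
congr (limn _); apply/funext => n.
have mI (r : R) : measurable_fun setT (fun x : X => \1_(g n @^-1` [set r]) (F x) : R).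
  by apply: measurableT_comp => //.
under [RHS]eq_integral do rewrite fimfunE -fsumEFin//.
rewrite [RHS]ge0_integral_fsum//; last 2 first.
- by move=> y; exact/measurable_EFinP/measurable_funM.
- by move=> y x _; rewrite nnfun_muleindic_ge0.
transitivity (\int[mu1]_x \sum_(r \in range (g n))
    ((k x)%:E * (r * \1_(g n @^-1` [set r]) (F x))%:E)).
  apply: eq_integral => x _; rewrite fimfunE -fsumEFin// ge0_mule_fsumr//.
  by move=> r; rewrite nnfun_muleindic_ge0.
rewrite ge0_integral_fsum//; last 2 first.
- by move=> r; apply: emeasurable_funM => //; apply/measurable_EFinP/measurable_funM.
- by move=> r x _; rewrite mule_ge0 ?nnfun_muleindic_ge0// lee_fin.
apply: eq_fsbigr => r; rewrite inE => -[y _ ry].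
have r0 : (0 <= r)%R by rewrite -ry.
rewrite integralZl_indic_nnsfun// integral_indic// setIT -kF//.
have -> : \int[mu1]_(x in F @^-1` (g n @^-1` [set r])) (k x)%:E =
    \int[mu1]_x (k x * \1_(g n @^-1` [set r]) (F x))%:E.
  rewrite integral_mkcond; apply: eq_integral => x _.
  rewrite patchE indicE; have [xr|xr] := pselect ((F @^-1` (g n @^-1` [set r])) x).
    by rewrite !mem_set// mulr1.
  by rewrite !memNset// mulr0.
rewrite -ge0_integralZl_EFin//; last 2 first.
- by move=> x _; rewrite lee_fin mulr_ge0.
- by apply/measurable_EFinP; exact: measurable_funM.
by apply: eq_integral => x _; rewrite -!EFinM mulrCA.
Qed.

End Density.

Lemma ge0_integral_mrestr d (X : measurableType d) (R : realType)
    (mu : {measure set X -> \bar R}) (D : set X) (mD : measurable D)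
    (h : X -> \bar R) :
  measurable_fun setT h -> (forall x, 0 <= h x)%E ->
  (\int[mrestr mu mD]_x h x = \int[mu]_(x in D) h x)%E.
Proof.
move=> mh h0; rewrite -(@ge0_integral_density _ _ _ _ _ mu _ (\1_D) id)//.
  rewrite [RHS]integral_mkcond; apply: eq_integral => x _.
  by rewrite patchE indicE; case: ifPn; rewrite ?mul1e ?mul0e.
by move=> A mA; rewrite preimage_id integral_indic// setIC.
Qed.

Section Substitution.
Context (R : realType).
Notation mu := (@lebesgue_measure R).
Implicit Types (F f : R -> R) (a b : R).

(** Open rays generate the Borel sets and are stable under intersection. Finiteness on rays makes
    the rays ]-n, +oo[ an admissible exhaustion of the line, and the preimage of a ray under an
    increasing map is easy to compute. *)
Lemma measure_ray_unique (m1 m2 : {measure set (measurableTypeR R) -> \bar R}) :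
  (forall c, m1 `]c, +oo[%classic < +oo)%E ->
  (forall c, m1 `]c, +oo[%classic = m2 `]c, +oo[%classic) ->
  forall A, measurable A -> m1 A = m2 A.
Proof.
move=> m1oo m12 A mA.
apply: (@measure_unique _ R (measurableTypeR R) (@RGenOInfty.G R) (fun n => `](- n%:R)%R, +oo[%classic)) => //.
- exact: RGenOInfty.measurableE.
- move=> _ _ [x ->] [y ->]; exists (Num.max x y).
  by apply/seteqP; split => z /=; rewrite !in_itv/= !andbT gt_max; [move=> [-> ->]|move=> /andP].
- by move=> n; exists (- n%:R).
- apply/seteqP; split => // x _; exists (Num.truncn `|x|).+1 => //=.
  rewrite in_itv/= andbT ltrNl (le_lt_trans (ler_norm _))// normrN.
  exact: Num.Theory.truncnS_gt.
- by move=> _ [x ->].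
Qed.

Section compact.
Variables (F f : R -> R) (a b : R).
Hypothesis ab : a < b.
Hypothesis dF : forall x, x \in `[a, b] -> is_derive x 1 F (f x).
Hypothesis cf : forall x, x \in `[a, b] -> {for x, continuous f}.
Hypothesis f0 : forall x, x \in `[a, b] -> 0 < f x.

Let cF x : x \in `[a, b] -> {for x, continuous F}.
Proof.
by move=> /dF ?; apply/differentiable_continuous/derivable1_diffP.
Qed.

Let wcF : {within `[a, b], continuous F}.
Proof. by apply: continuous_in_subspaceT => x; rewrite inE => /cF. Qed.

Let wcf : {within `[a, b], continuous f}.
Proof. by apply: continuous_in_subspaceT => x; rewrite inE => /cf. Qed.

Let F_lt : {in `[a, b] &, {homo F : x y / x < y}}.
Proof.
apply: gtr0_derive1_lt_cc => // x /subset_itv_oo_cc xab.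
  by have := dF xab.
by have := dF xab => dFx; rewrite derive1E derive_val f0.
Qed.

Let FTC c : c \in `[a, b[ -> (\int[mu]_(x in `]c, b]) (f x)%:E = (F b - F c)%:E)%E.
Proof.
rewrite in_itv/= => /andP[ac cb].
have sub x : x \in `[c, b] -> x \in `[a, b].
  by rewrite !in_itv/= => /andP[cx ->]; rewrite (le_trans ac).
have cfc : {within `[c, b], continuous f}.
  by apply: continuous_in_subspaceT => x; rewrite inE => /sub/cf.
rewrite integral_itv_obnd_cbnd; last first.
  apply/measurable_EFinP; apply: measurable_funS (subspace_continuous_measurable_fun _ cfc) => //.
  exact: subset_itv_oc_cc.
rewrite (continuous_FTC2 cb cfc (F := F))//.
- split=> [x /subset_itv_oo_cc/sub/dF//||].
  + by apply: cvg_at_right_filter; apply: cF; rewrite in_itv/= ac ltW.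
  + by apply: cvg_at_left_filter; apply: cF; rewrite in_itv/= lexx andbT ltW.
- by move=> x /subset_itv_oo_cc/sub/dF dFx; rewrite derive1E derive_val.
Qed.

Let mFr : measurable_fun setT (F \_ `[a, b] : R -> R).
Proof.
apply: (measurable_restrictT F (measurable_itv _)).1.
exact: subspace_continuous_measurable_fun.
Qed.

Let mfr : measurable_fun setT (f \_ `[a, b] : R -> R).
Proof.
apply: (measurable_restrictT f (measurable_itv _)).1.
exact: subspace_continuous_measurable_fun.
Qed.

Let fr0 x : 0 <= (f \_ `[a, b]) x.
Proof. by rewrite patchE; case: ifPn => //; rewrite inE => /f0/ltW. Qed.

Local Notation wp := (@weighted_pushforward _ _ _ (measurableTypeR R) R mu _ _ mfr fr0 mFr).

(** It suffices to compare the image of the measure f dx with Lebesgue measure on rays. By the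
    intermediate value theorem c = F c', the preimage of ]c, +oo[ is ]c', b], and the fundamental
    theorem of calculus gives F b - c. *)
Lemma substitution_cc (h : R -> \bar R) :
  measurable_fun setT h -> (forall x, 0 <= h x)%E ->
  (\int[mu]_(x in `[F a, F b]) h x = \int[mu]_(x in `[a, b]) ((f x)%:E * h (F x)))%E.
Proof.
move=> mh h0; rewrite -(@ge0_integral_mrestr _ _ _ mu _ (measurable_itv `[F a, F b]))//.
(* Both functions are cut off to 0 outside [a, b] to be measurable everywhere. The spurious value 0
   of F may lie in [F a, F b], but the density vanishes there. *)
rewrite -(@ge0_integral_density _ _ _ _ _ mu (mrestr mu (measurable_itv `[F a, F b]))
  (f \_ `[a, b]) (F \_ `[a, b]))//.
  rewrite [RHS]integral_mkcond; apply: eq_integral => x _; rewrite !patchE.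
  by case: ifPn; rewrite ?mul0e.
move=> A mA; rewrite -[LHS]/(wp A).
have aD : a \in `[a, b] by rewrite in_itv/= lexx ltW.
have bD : b \in `[a, b] by rewrite in_itv/= lexx ltW.
have wE c : wp `]c, +oo[ =
    (\int[mu]_(x in `[a, b] `&` F @^-1` `]c, +oo[) (f x)%:E)%E.
  rewrite /weighted_pushforward [LHS]integral_mkcond [RHS]integral_mkcond.
  apply: eq_integral => x _; rewrite !patchE in_setI.
  have [xab|xab] := boolP (x \in [set` `[a, b]]); last by rewrite if_same.
  rewrite andTb; congr (if _ then _ else _).
  by apply/idP/idP; rewrite !inE /preimage/= patchE xab.
have mE c : mrestr mu (measurable_itv `[F a, F b]) `]c, +oo[ =
    mu (`]c, +oo[ `&` `[F a, F b]) by [].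
suff E c : (mrestr mu (measurable_itv `[F a, F b]) `]c, +oo[ < +oo)%E /\
    wp `]c, +oo[ = mrestr mu (measurable_itv `[F a, F b]) `]c, +oo[.
  refine (@measure_ray_unique wp (mrestr mu (measurable_itv `[F a, F b])) _ _ A mA) => c.
    by apply: le_lt_trans (E c).1; rewrite le_eqVlt; apply/predU1P; left; exact: (E c).2.
  exact: (E c).2.
have Fle x : x \in `[a, b] -> F a <= F x.
  move=> xab; have := xab; rewrite in_itv/= le_eqVlt => /andP[/predU1P[<-//|ax] xb].
  exact/ltW/F_lt.
have leF x : x \in `[a, b] -> F x <= F b.
  move=> xab; have := xab; rewrite in_itv/= => /andP[ax].
  rewrite le_eqVlt => /predU1P[->//|xb].
  exact/ltW/F_lt.
rewrite wE mE; have [cFa|Fac] := ltP c (F a).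
  have -> : `[a, b] `&` F @^-1` `]c, +oo[ = `[a, b]%classic :> set R.
    apply/seteqP; split => x /=; first by case.
    move=> xab; split=> //; rewrite in_itv/= andbT.
    by rewrite (lt_le_trans cFa)// Fle.
  have -> : `]c, +oo[ `&` `[F a, F b] = `[F a, F b]%classic :> set R.
    apply/seteqP; split => x /=; first by case.
    move=> xab; split=> //; move: xab; rewrite !in_itv/= andbT.
    by move=> /andP[/(lt_le_trans cFa)].
  rewrite lebesgue_measure_itv/= lte_fin F_lt//; split; first by rewrite ltry.
  rewrite -integral_itv_obnd_cbnd; first by rewrite FTC// in_itv/= lexx.
  apply/measurable_EFinP; apply: measurable_funS (subspace_continuous_measurable_fun _ wcf) => //.
  exact: subset_itv_oc_cc.
have [Fbc|cFb] := leP (F b) c.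
  have -> : `[a, b] `&` F @^-1` `]c, +oo[ = set0.
    apply/seteqP; split => x //= [/leF Fx]; rewrite in_itv/= andbT.
    by rewrite ltNge (le_trans Fx).
  have -> : `]c, +oo[ `&` `[F a, F b] = set0 :> set R.
    apply/seteqP; split => x //= []; rewrite !in_itv/= andbT.
    by move=> cx /andP[_ xb]; move: cx; rewrite ltNge (le_trans xb).
  by rewrite integral_set0 measure0.
have [c' c'ab Fc'] : exists2 x, x \in `[a, b] & F x = c.
  apply: IVT => //; first exact: ltW.
  by rewrite ge_min Fac/= le_max (ltW cFb) orbT.
have c'b : c' < b.
  rewrite lt_neqAle; move: c'ab; rewrite in_itv/= => /andP[_ ->]; rewrite andbT.
  by apply: contraTneq cFb => c'b; rewrite -Fc' c'b ltxx.
have ac' : a <= c' by move: c'ab; rewrite in_itv/= => /andP[].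
have -> : `[a, b] `&` F @^-1` `]c, +oo[ = `]c', b]%classic :> set R.
  apply/seteqP; split => x /=.
    rewrite !in_itv/= andbT => -[/andP[ax ->]]; rewrite andbT => cFx.
    rewrite ltNge; apply/negP; rewrite le_eqVlt => /predU1P[xc'|xc'].
      by move: cFx; rewrite xc' Fc' ltxx.
    move: cFx; rewrite ltNge -Fc' ltW//; apply: F_lt => //.
    by rewrite in_itv/= ax/= (le_trans (ltW xc'))// ltW.
  rewrite !in_itv/= andbT => /andP[c'x xb].
  have xab : x \in `[a, b] by rewrite in_itv/= xb (le_trans _ (ltW c'x)).
  split; first by rewrite xb (le_trans _ (ltW c'x)).
  by rewrite -Fc'; exact: F_lt.
have -> : `]c, +oo[ `&` `[F a, F b] = `]c, F b]%classic :> set R.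
  apply/seteqP; split => x /=; rewrite !in_itv/= andbT.
    by move=> [-> /andP[]].
  by move=> /andP[cx ->]; rewrite cx (le_trans Fac)// ltW.
rewrite lebesgue_measure_itv/= lte_fin cFb; split; first by rewrite ltry.
by rewrite FTC ?Fc'// in_itv/= ac'.
Qed.

End compact.

Section open.
Variables (F f : R -> R) (D : set R) (u v : nat -> R).
Hypotheses (uv : forall n, u n < v n) (Duv : D = \bigcup_n `[u n, v n]%classic).
Hypothesis nd_uv : nondecreasing_seq (fun n => `[u n, v n]%classic).
Hypothesis dF : forall x, D x -> is_derive x 1 F (f x).
Hypothesis cf : forall x, D x -> {for x, continuous f}.
Hypothesis f0 : forall x, D x -> 0 < f x.

Let Dn n x : x \in `[u n, v n] -> D x.
Proof. by move=> xuv; rewrite Duv; exists n. Qed.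

Let un n : u n \in `[u n, v n]. Proof. by rewrite in_itv/= lexx ltW. Qed.
Let vn n : v n \in `[u n, v n]. Proof. by rewrite in_itv/= lexx ltW. Qed.

Let cF n : {within `[u n, v n], continuous F}.
Proof.
apply: continuous_in_subspaceT => x; rewrite inE => /Dn/dF ?.
exact/differentiable_continuous/derivable1_diffP.
Qed.

Let cwf n : {within `[u n, v n], continuous f}.
Proof. by apply: continuous_in_subspaceT => x; rewrite inE => /Dn/cf. Qed.

Let F_le n x y : x \in `[u n, v n] -> y \in `[u n, v n] -> x <= y -> F x <= F y.
Proof.
move=> xn yn; rewrite le_eqVlt => /predU1P[->//|xy]; apply: ltW.
move: x y xn yn xy; apply: gtr0_derive1_lt_cc => // x /subset_itv_oo_cc /Dn xD.
  by have := dF xD.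
by have := dF xD => dFx; rewrite derive1E derive_val f0.
Qed.

Let FD : F @` D = \bigcup_n `[F (u n), F (v n)]%classic.
Proof.
apply/seteqP; split=> [y [x]|y [n _]].
  rewrite Duv => -[n _ xn] <-; exists n => //=; rewrite in_itv/=.
  have := xn; rewrite /= in_itv/= => /andP[ux xv].
  by rewrite !(@F_le n)// ltW.
rewrite /= in_itv/= => /andP[Fuy yFv].
have [x xn <-] : exists2 x, x \in `[u n, v n] & F x = y.
  apply: IVT => //; first exact: ltW.
  by rewrite ge_min Fuy/= le_max yFv orbT.
by exists x => //; exact: (@Dn n).
Qed.

Lemma measurable_image_exhausted : measurable (F @` D).
Proof. by rewrite FD; exact: bigcup_measurable. Qed.

Lemma ge0_substitution_increasing (h : R -> \bar R) :
  measurable_fun setT h -> (forall x, 0 <= h x)%E ->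
  (\int[mu]_(y in F @` D) h y = \int[mu]_(x in D) ((f x)%:E * h (F x)))%E.
Proof.
move=> mh h0; rewrite FD Duv.
have f0n n x : x \in `[u n, v n] -> (0 <= (f x)%:E * h (F x))%E.
  by move=> /Dn/f0/ltW ?; rewrite mule_ge0// lee_fin.
have mfh n : measurable_fun `[u n, v n] (fun x => (f x)%:E * h (F x))%E.
  apply: emeasurable_funM.
    by apply/measurable_EFinP; apply: subspace_continuous_measurable_fun.
  by apply: measurableT_comp => //; apply: subspace_continuous_measurable_fun.
have ndF : nondecreasing_seq (fun n => `[F (u n), F (v n)]%classic).
  move=> m n mn; have := nd_uv mn; rewrite !subsetEset => sub x /=.
  have := sub _ (un m); have := sub _ (vn m); rewrite /= => vmn umn.
  rewrite !in_itv/= => /andP[Fux xFv].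
  have := umn; have := vmn; rewrite !in_itv/= => /andP[_ ?] /andP[? _].
  by rewrite (le_trans _ Fux) ?(le_trans xFv) ?(@F_le n).
have := @ge0_nondecreasing_set_cvg_integral _ (measurableTypeR R) _ (fun n => `[u n, v n]%classic)
  (fun x => (f x)%:E * h (F x))%E mu nd_uv (fun=> measurable_itv _) mfh f0n.
have := @ge0_nondecreasing_set_cvg_integral _ (measurableTypeR R) _ (fun n => `[F (u n), F (v n)]%classic)
  h mu ndF (fun=> measurable_itv _) (fun=> measurable_funTS mh) (fun _ _ _ => h0 _).
set I1 := (X in X @ _ --> _ -> _); set I2 := (X in _ -> X @ _ --> _ -> _).
have -> : I1 = I2.
  apply/funext => n; apply: substitution_cc => //.
  - by move=> x /Dn/dF.
  - by move=> x /Dn/cf.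
  - by move=> x /Dn/f0.
by move=> /cvg_unique H /H; exact.
Qed.

End open.

Lemma ge0_integralN (D : set R) (h : R -> \bar R) : measurable D ->
  measurable_fun setT h -> (forall x, 0 <= h x)%E ->
  (\int[mu]_(y in D) h y = \int[mu]_(y in (-%R : R -> R) @` D) h (- y)%R)%E.
Proof.
move=> mD mh h0.
have -> : (-%R : R -> R) @` D = (-%R : _ -> measurableTypeR R) @^-1` D.
  apply/seteqP; split => [_ [x Dx <-]|x Dx] /=; first by rewrite /preimage/= opprK.
  by exists (- x) => //; rewrite opprK.
rewrite -[RHS](@ge0_integral_pushforward _ _ (measurableTypeR R) (measurableTypeR R) R (-%R : R -> measurableTypeR R) _ mu D h)//.
- by apply: eq_measure_integral => A mA AS; apply/esym/lebesgue_measureN.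
- exact: measurable_funTS.
Qed.

(** The increasing case applies to -F, and reflection preserves Lebesgue measure. *)
Lemma ge0_substitution_decreasing (F f : R -> R) (D : set R) (u v : nat -> R)
    (h : R -> \bar R) :
  (forall n, u n < v n) -> D = \bigcup_n `[u n, v n]%classic ->
  nondecreasing_seq (fun n => `[u n, v n]%classic) ->
  (forall x, D x -> is_derive x 1 F (- f x)) ->
  (forall x, D x -> {for x, continuous f}) ->
  (forall x, D x -> 0 < f x) ->
  measurable_fun setT h -> (forall x, 0 <= h x)%E ->
  (\int[mu]_(y in F @` D) h y = \int[mu]_(x in D) ((f x)%:E * h (F x)))%E.
Proof.
move=> uv Duv nd dF cf f0 mh h0.
have dNF x : D x -> is_derive x 1 (- F) (f x).
  by move=> /dF dFx; rewrite -[f x]opprK; exact: is_deriveN.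
have NFD : (-%R : R -> R) @` ((- F) @` D) = F @` D.
  apply/seteqP; split => [_ [_ [x Dx <-] <-]|_ [x Dx <-]].
    by exists x => //; rewrite fctE opprK.
  by exists (- F x); [exists x|rewrite opprK].
rewrite -NFD -[RHS](_ : \int[mu]_(x in D) ((f x)%:E * h (- (- F x))%R) = _)%E; last first.
  by apply: eq_integral => x _; rewrite opprK.
have mNh : measurable_fun setT (fun x : R => h (- x)) by apply: measurableT_comp.
rewrite -(@ge0_substitution_increasing (- F) f D u v uv Duv nd dNF cf f0 (fun x => h (- x)))//.
rewrite [RHS](@ge0_integralN ((- F) @` D))//.
  by apply: eq_integral => x _; rewrite opprK.
exact: (@measurable_image_exhausted (- F) f D u v).
Qed.

(* Stands for open intervals: the substitution rule on compact intervals passes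
   to the limit along such a sequence. *)
Definition exhausted (D : set R) := exists u v : nat -> R,
  [/\ forall n, u n < v n, D = \bigcup_n `[u n, v n]%classic &
      nondecreasing_seq (fun n => `[u n, v n]%classic)].

Lemma exhausted_oo a b : a < b -> exhausted `]a, b[%classic.
Proof.
(* The margin is at most a third of the length, so the two ends do not cross even for n = 0. *)
move=> ab; exists (fun n => a + (b - a) / n.+3%:R), (fun n => b - (b - a) / n.+3%:R).
have ba : 0 < b - a by rewrite subr_gt0.
have n3 n : 0 < (b - a) / n.+3%:R by rewrite divr_gt0.
split.
- move=> n; rewrite -subr_gt0.
  have : 2 / n.+3%:R < 1 :> R by rewrite ltr_pdivrMr// mul1r ltr_nat.
  rewrite -(ltr_pM2l ba) mulr1 mulrCA => h.
  by move: h; set c := (b - a) / _; lra.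
- apply/seteqP; split => x /=; last first.
    move=> [n _]; rewrite /= !in_itv/= => /andP[ax xb].
    by move: ax xb (n3 n); set c := (b - a) / _ => *; apply/andP; split; lra.
  rewrite in_itv/= => /andP[ax xb].
  pose m := Num.min (x - a) (b - x).
  have m0 : 0 < m by rewrite lt_min !subr_gt0 ax.
  exists (Num.truncn ((b - a) / m)).+1 => //=.
  have : (b - a) / (Num.truncn ((b - a) / m)).+1.+3%:R <= m.
    rewrite ler_pdivrMr// mulrC -ler_pdivrMr//.
    rewrite (le_trans (ltW (Num.Theory.truncnS_gt _)))// ler_nat.
    by do 2 apply: leqW; exact: leqnSn.
  rewrite le_min in_itv/=; set c := (b - a) / _ => /andP[? ?].
  by apply/andP; split; lra.
- move=> m n mn; rewrite subsetEset => x /=; rewrite !in_itv/= => /andP[ax xb].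
  have : (b - a) / n.+3%:R <= (b - a) / m.+3%:R.
    by rewrite ler_pM2l// lef_pV2 ?posrE// ler_nat.
  by move: ax xb; set c := _ / m.+3%:R; set c' := _ / n.+3%:R => *; apply/andP; split; lra.
Qed.

Lemma exhausted_oy : exhausted `]0, +oo[%classic.
Proof.
exists (fun n => n.+2%:R^-1), (fun n => n.+2%:R); split.
- by move=> n; rewrite invf_plt ?posrE// (@lt_trans _ _ 1)// ?invf_lt1// ltr1n.
- apply/seteqP; split => x /=; last first.
    by move=> [n _]; rewrite /= !in_itv/= andbT => /andP[x0 _]; apply: lt_le_trans x0.
  rewrite in_itv/= andbT => x0.
  exists (Num.truncn (Num.max x x^-1)) => //=; rewrite in_itv/=.
  have : Num.max x x^-1 <= (Num.truncn (Num.max x x^-1)).+2%:R.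
    by rewrite (le_trans (ltW (Num.Theory.truncnS_gt _)))// ler_nat.
  by rewrite ge_max => /andP[-> ?]; rewrite andbT invf_ple ?posrE.
- move=> m n mn; rewrite subsetEset => x /=; rewrite !in_itv/= => /andP[ax xb].
  apply/andP; split; last by rewrite (le_trans xb)// ler_nat.
  by rewrite (le_trans _ ax)// lef_pV2 ?posrE// ler_nat.
Qed.

Lemma exhausted_T : exhausted setT.
Proof.
exists (fun n => - n.+1%:R), (fun n => n.+1%:R); split.
- by move=> n; rewrite gt0_cp.
- apply/seteqP; split => x //= _.
  exists (Num.truncn `|x|) => //=; rewrite in_itv/= -ler_norml.
  exact/ltW/Num.Theory.truncnS_gt.
- move=> m n mn; rewrite subsetEset => x /=; rewrite !in_itv/= -!ler_norml.
  by move=> /le_trans; apply; rewrite ler_nat.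
Qed.

End Substitution.

Section SubstitutionCorollaries.
Context (R : realType).
Notation mu := (@lebesgue_measure R).
Implicit Types (F f : R -> R) (D : set R) (h : R -> \bar R).

Lemma ge0_substitution_gt0 F f D h : exhausted D ->
  (forall x, D x -> is_derive x 1 F (f x)) ->
  (forall x, D x -> {for x, continuous f}) ->
  (forall x, D x -> 0 < f x) ->
  measurable_fun setT h -> (forall x, 0 <= h x)%E ->
  (\int[mu]_(y in F @` D) h y = \int[mu]_(x in D) ((f x)%:E * h (F x)))%E.
Proof.
by move=> [u [v [uv Duv nd]]] dF cf f0 mh h0; exact: (ge0_substitution_increasing uv).
Qed.

Lemma ge0_substitution_lt0 F f D h : exhausted D ->
  (forall x, D x -> is_derive x 1 F (- f x)) ->
  (forall x, D x -> {for x, continuous f}) ->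
  (forall x, D x -> 0 < f x) ->
  measurable_fun setT h -> (forall x, 0 <= h x)%E ->
  (\int[mu]_(y in F @` D) h y = \int[mu]_(x in D) ((f x)%:E * h (F x)))%E.
Proof.
by move=> [u [v [uv Duv nd]]] dF cf f0 mh h0; exact: (ge0_substitution_decreasing uv).
Qed.

Lemma is_derive_mull (c x : R) : is_derive x 1 (fun x : R => c * x) c.
Proof.
have := is_deriveZ c (is_derive_id x (1 : R)).
by rewrite /GRing.scale/= mulr1.
Qed.

Lemma ge0_integral_scale_oy (c : R) h : 0 < c ->
  measurable_fun setT h -> (forall x, 0 <= h x)%E ->
  (\int[mu]_(x in `]0%R, +oo[) h x =
   \int[mu]_(x in `]0%R, +oo[) (c%:E * h (c * x)%R))%E.
Proof.
move=> c0 mh h0; have cV0 : 0 < c^-1 by rewrite invr_gt0.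
have FD : (fun x : R => c * x) @` `]0, +oo[ = `]0, +oo[%classic.
  apply/seteqP; split => [_ [x /= x0 <-]|x] /=; rewrite in_itv/= andbT.
    by apply: mulr_gt0 => //; move: x0; rewrite in_itv/= andbT.
  move=> x0.
  by exists (c^-1 * x); [rewrite in_itv/= andbT; exact: mulr_gt0|rewrite mulVKf// gt_eqF].
rewrite -[in LHS]FD; apply: (@ge0_substitution_gt0 (fun x : R => c * x) (cst c)) => //.
- exact: exhausted_oy.
- by move=> x _; exact: is_derive_mull.
- by move=> x _; exact: cst_continuous.
Qed.

Lemma ge0_integral_scale (c : R) h : 0 < c ->
  measurable_fun setT h -> (forall x, 0 <= h x)%E ->
  (\int[mu]_x h x = \int[mu]_x (c%:E * h (c * x)%R))%E.
Proof.
move=> c0 mh h0.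
have FD : (fun x : R => c * x) @` setT = setT.
  apply/seteqP; split => // x _.
  by exists (c^-1 * x) => //; rewrite mulVKf// gt_eqF.
rewrite -[in LHS]FD; apply: (@ge0_substitution_gt0 (fun x : R => c * x) (cst c)) => //.
- exact: exhausted_T.
- by move=> x _; exact: is_derive_mull.
- by move=> x _; exact: cst_continuous.
Qed.

(** This is the radial substitution: along a ray [logratio] is y0 + e ln rho, and the radial measure
    that remains is d rho / rho. The sign of e decides between the increasing and the decreasing
    rule. *)
Lemma ge0_integral_log (e y0 : R) h : e != 0 ->
  measurable_fun setT h -> (forall x, 0 <= h x)%E ->
  (\int[mu]_x h x =
   \int[mu]_(x in `]0%R, +oo[) ((`|e| / x)%:E * h (y0 + e * ln x)%R))%E.
Proof.
move=> e0 mh h0; pose F (x : R) := y0 + e * ln x.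
have dF (x : R) : `]0, +oo[%classic x -> is_derive x 1 F (e / x).
  rewrite /= in_itv/= andbT => x0.
  have := is_deriveD (is_derive_cst y0 x 1) (is_deriveZ e (is_derive1_ln x0)).
  by rewrite add0r.
have cf (x : R) : `]0, +oo[%classic x -> {for x, continuous (fun x : R => `|e| / x)}.
  rewrite /= in_itv/= andbT => x0; apply: cvgM; first exact: cvg_cst.
  by apply: cvgV => //; rewrite gt_eqF.
have f0 (x : R) : `]0, +oo[%classic x -> 0 < `|e| / x.
  by rewrite /= in_itv/= andbT => x0; rewrite divr_gt0// normr_gt0.
have FT : F @` `]0, +oo[ = setT.
  apply/seteqP; split => // y _; exists (expR ((y - y0) / e)) => /=.
    by rewrite in_itv/= expR_gt0.
  by rewrite /F expRK mulrCA divff// mulr1 addrC subrK.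
rewrite -[in LHS]FT; have := e0; rewrite neq_lt => /orP[|] es.
- apply: ge0_substitution_lt0 => //; first exact: exhausted_oy.
  by move=> x /dF; rewrite ltr0_norm// mulNr opprK.
- apply: ge0_substitution_gt0 => //; first exact: exhausted_oy.
  by move=> x /dF; rewrite gtr0_norm.
Qed.

(** In the upper half-plane, the horizontal coordinate at height y is y times the cotangent of the
    polar angle. *)
Lemma ge0_integral_cot h :
  measurable_fun setT h -> (forall x, 0 <= h x)%E ->
  (\int[mu]_x h x =
   \int[mu]_(x in `]0%R, pi[) ((sin x ^- 2)%:E * h (cos x / sin x)%R))%E.
Proof.
move=> mh h0; pose F (x : R) := cos x / sin x.
have s0 (x : R) : `]0, pi[%classic x -> 0 < sin x by rewrite /= in_itv; exact: sin_gt0_pi.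
have FT : F @` `]0, pi[ = setT.
  apply/seteqP; split => // y _; exists (pi / 2 - atan y) => /=.
    rewrite in_itv/= subr_gt0 atan_ltpi2/=.
    by have := atan_gtNpi2 y; lra.
  rewrite /F cosB sinB cos_pihalf sin_pihalf !mul0r !mul1r add0r subr0.
  by rewrite -[RHS]atanK /tan.
rewrite -[in LHS]FT; apply: ge0_substitution_lt0 => //.
- by apply: exhausted_oo; exact: pi_gt0.
- move=> x x0; have sx := s0 _ x0; have sN : sin x != 0 by rewrite gt_eqF.
  apply: (is_derive_eq (is_deriveM (is_derive_cos x) (is_deriveV sN (is_derive_sin x)))).
  rewrite /GRing.scale/=.
  have -> : cos x * (- sin x ^- 2 * cos x) + (sin x)^-1 * - sin x =
     - (cos x ^+ 2 + sin x ^+ 2) * sin x ^- 2 by field.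
  by rewrite cos2Dsin2 mulN1r.
- move=> x /s0 sx; apply: cvgV; first by rewrite expf_neq0// gt_eqF.
  by rewrite expr2; apply: cvgM; exact: continuous_sin.
- by move=> x /s0 sx; rewrite invr_gt0 exprn_gt0.
Qed.

Lemma ge0_integral_reflect_pi h :
  measurable_fun setT h -> (forall x, 0 <= h x)%E ->
  (\int[mu]_(x in `]pi, (2 * pi)%R[) h x =
   \int[mu]_(x in `]0%R, pi[) h (2 * pi - x)%R)%E.
Proof.
move=> mh h0; pose F (x : R) := 2 * pi - x.
have FD : F @` `]0, pi[ = `]pi, (2 * pi)[%classic.
  apply/seteqP; split => [_ [x /= x0 <-]|x] /=; rewrite in_itv/=.
    by move: x0; rewrite in_itv/= /F => /andP[x0 xpi]; apply/andP; split; lra.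
  move=> /andP[x0 xpi].
  exists (2 * pi - x); rewrite ?in_itv/=; first by apply/andP; split; lra.
  by rewrite /F; lra.
transitivity (\int[mu]_(x in `]0%R, pi[) (1%:E * h (F x)))%E; last first.
  by apply: eq_integral => x _; rewrite mul1e.
rewrite -FD; apply: (@ge0_substitution_lt0 F (cst 1)) => //.
- by apply: exhausted_oo; exact: pi_gt0.
- move=> x _; have := is_deriveD (is_derive_cst (2 * pi) x 1) (is_deriveN (is_derive_id x (1:R))).
  by rewrite add0r.
- by move=> x _; exact: cst_continuous.
Qed.

End SubstitutionCorollaries.

(** * Polar coordinates *)

Section TonelliOn.
Context d1 d2 (X : measurableType d1) (Y : measurableType d2) (R : realType).
Variables (m1 : {sigma_finite_measure set X -> \bar R}).
Variables (m2 : {sigma_finite_measure set Y -> \bar R}).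
Variables (D1 : set X) (D2 : set Y) (f : X * Y -> \bar R).
Hypotheses (mD1 : measurable D1) (mD2 : measurable D2).
Hypothesis mf : measurable_fun setT f.
Local Open Scope ereal_scope.

Let mfr D : measurable D -> measurable_fun setT (f \_ D).
Proof. by move=> mD; apply: (measurable_restrictT f mD).1; exact: measurable_funTS. Qed.

Lemma measurable_fun_integral_on : (forall x y, D2 y -> 0 <= f (x, y)) ->
  measurable_fun setT (fun x => \int[m2]_(y in D2) f (x, y)).
Proof.
move=> f0.
have fr z : 0 <= (f \_ (setT `*` D2)) z.
  by rewrite patchE; case: ifPn => //; rewrite inE; case: z => x y [_] /f0.
have mE : measurable (setT `*` D2 : set (X * Y)) by exact: measurableX.
have := measurable_fun_fubini_tonelli_F (m2 := m2) _ (mfr mE) fr.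
congr (measurable_fun _ _); apply/funext => x.
rewrite /fubini_F [RHS]integral_mkcond; apply: eq_integral => y _.
by rewrite !patchE in_setX in_setT.
Qed.

(** Nonnegativity is asked on the rectangle because the integrands below carry factors such as rho,
    which are negative outside it. *)
Lemma fubini_tonelli_on : (forall x y, D1 x -> D2 y -> 0 <= f (x, y)) ->
  \int[m1]_(x in D1) \int[m2]_(y in D2) f (x, y) =
  \int[m2]_(y in D2) \int[m1]_(x in D1) f (x, y).
Proof.
move=> f0.
have fr z : 0 <= (f \_ (D1 `*` D2)) z.
  by rewrite patchE; case: ifPn => //; rewrite inE; case: z => x y [Dx Dy]; exact: f0.
have mE : measurable (D1 `*` D2 : set (X * Y)) by exact: measurableX.
apply: (etrans _ (etrans (fubini_tonelli (m1 := m1) (m2 := m2) _ (mfr mE) fr) _)).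
- apply: esym; rewrite [RHS]integral_mkcond; apply: eq_integral => x _.
  rewrite patchE; case: ifPn => xD; last first.
    by rewrite integral0_eq// => y _; rewrite patchE in_setX (negbTE xD).
  rewrite [RHS]integral_mkcond; apply: eq_integral => y _.
  by rewrite !patchE in_setX xD.
- rewrite [RHS]integral_mkcond; apply: eq_integral => y _.
  rewrite patchE; case: ifPn => yD; last first.
    by rewrite integral0_eq// => x _; rewrite patchE in_setX (negbTE yD) andbF.
  rewrite [RHS]integral_mkcond; apply: eq_integral => x _.
  by rewrite !patchE in_setX yD andbT.
Qed.

End TonelliOn.

Lemma measurable_inv (R : realType) : measurable_fun [set: R] (@GRing.inv R).
Proof.
have -> : @GRing.inv R = fun x => x * (x ^+ 2) `^ (-1).
  apply/funext => x; rewrite powR_inv1 ?sqr_ge0//.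
  have [->|x0] := eqVneq x 0; first by rewrite mul0r invr0.
  by rewrite expr2 invfM mulrA divff// mul1r.
apply: measurable_funM; first exact: measurable_id.
apply: (@measurableT_comp _ _ _ _ _ _ (fun y : R => y `^ (-1))).
  exact: measurable_powR.
exact: exprn_measurable.
Qed.

Lemma measurable_funV d (X : measurableType d) (R : realType) (D : set X) (f : X -> R) :
  measurable_fun D f -> measurable_fun D (fun x => (f x)^-1).
Proof. exact: (measurableT_comp (@measurable_inv R)). Qed.

Lemma measurable_sin (R : realType) : measurable_fun [set: R] sin.
Proof. by apply: continuous_measurable_fun; apply: continuous_sin. Qed.

Lemma measurable_cos (R : realType) : measurable_fun [set: R] cos.
Proof. by apply: continuous_measurable_fun; apply: continuous_cos. Qed.

Section HalfPlane.
Context (R : realType).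
Notation mu := (@lebesgue_measure R).
Local Notation RR := (measurableTypeR R).
Variable f : RR * RR -> \bar R.
Hypotheses (mf : measurable_fun setT f) (f0 : forall z, (0 <= f z)%E).
Local Open Scope ereal_scope.

Let m1 : measurable_fun [set: RR * RR] (fun z => z.1 : R).
Proof. exact: measurable_fst. Qed.
Let m2 : measurable_fun [set: RR * RR] (fun z => z.2 : R).
Proof. exact: measurable_snd. Qed.
Let ms : measurable_fun [set: RR * RR] (fun z => sin z.2 : R).
Proof. exact: (measurableT_comp (@measurable_sin R)). Qed.
Let mc : measurable_fun [set: RR * RR] (fun z => cos z.2 : R).
Proof. exact: (measurableT_comp (@measurable_cos R)). Qed.

(** Two substitutions in one variable replace the Jacobian determinant: x = y cot phi at fixed y,
    then, after an exchange of integrals, y = rho sin phi at fixed phi. The factors y / sin^2 phi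
    and sin phi multiply to rho. *)
Lemma half_plane_polar :
  \int[mu]_x \int[mu]_(y in `]0%R, +oo[) f (x, y) =
  \int[mu]_(rho in `]0%R, +oo[) \int[mu]_(phi in `]0%R, pi[)
    (rho%:E * f (rho * cos phi, rho * sin phi)%R).
Proof.
have E0 := @fubini_tonelli_on _ _ RR RR R mu mu [set: RR] (`]0%R, +oo[%classic : set RR) f measurableT (measurable_itv _) mf (fun x y _ _ => f0 (x, y)).
apply: (etrans E0); clear E0.
transitivity (\int[mu]_(y in `]0%R, +oo[) \int[mu]_(phi in `]0%R, pi[)
    ((sin phi ^- 2)%:E * (y%:E * f (y * (cos phi / sin phi), y)%R))).
  apply: eq_integral => y; rewrite inE/= in_itv/= andbT => y0.
  have mfy : measurable_fun setT (fun x : RR => f (x, y)).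
    by apply: measurableT_comp => //; exact: measurable_pair2.
  rewrite (ge0_integral_scale y0)//.
  rewrite (@ge0_integral_cot _ (fun z => y%:E * f (y * z, y)%R))//.
    apply: emeasurable_funM => //.
    by apply: (measurableT_comp mfy); exact: measurable_funM.
  by move=> z; rewrite mule_ge0// lee_fin ltW.
pose F1 (z : RR * RR) := (sin z.2 ^- 2)%:E * (z.1%:E * f (z.1 * (cos z.2 / sin z.2), z.1)%R).
have mF1 : measurable_fun setT F1.
  apply: emeasurable_funM.
    by apply/measurable_EFinP; apply: measurable_funV; exact: measurable_funX.
  apply: emeasurable_funM; first exact/measurable_EFinP.
  apply: measurableT_comp => //; apply/measurable_fun_pair => //.
  by apply: measurable_funM => //; apply: measurable_funM => //; exact: measurable_funV.
have F10 (y phi : RR) : (`]0%R, +oo[%classic : set RR) y ->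
    (`]0%R, pi[%classic : set RR) phi -> 0 <= F1 (y, phi).
  rewrite /= !in_itv/= andbT => y0 _.
  apply: mule_ge0; first by rewrite lee_fin invr_ge0 sqr_ge0.
  by apply: mule_ge0 => //; rewrite lee_fin ltW.
have E1 := @fubini_tonelli_on _ _ RR RR R mu mu _ _ F1 (measurable_itv _) (measurable_itv _)
  mF1 F10.
apply: (etrans E1); clear E1.
pose F2 (z : RR * RR) := z.1%:E * f (z.1 * cos z.2, z.1 * sin z.2)%R.
have mF2 : measurable_fun setT F2.
  apply: emeasurable_funM; first exact/measurable_EFinP.
  apply: measurableT_comp => //; apply/measurable_fun_pair => //; exact: measurable_funM.
have F20 (y phi : RR) : (`]0%R, +oo[%classic : set RR) y ->
    (`]0%R, pi[%classic : set RR) phi -> 0 <= F2 (y, phi).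
  rewrite /= !in_itv/= andbT => y0 _.
  by rewrite mule_ge0// lee_fin ?ltW.
have E2 := @fubini_tonelli_on _ _ RR RR R mu mu _ _ F2 (measurable_itv _) (measurable_itv _)
  mF2 F20.
apply: (etrans _ (esym E2)); clear E2; rewrite /F1 /F2 /=.
apply: eq_integral => phi; rewrite inE/= in_itv/= => /sin_gt0_pi s0.
(* The absolute value makes the integrand nonnegative on the whole line, as the scaling rule
   requires. *)
transitivity (\int[mu]_(y in `]0%R, +oo[)
    ((sin phi ^- 2)%:E * (`|y|%:E * f (y * (cos phi / sin phi), y)%R))).
  by apply: eq_integral => y; rewrite inE/= in_itv/= andbT => y0; rewrite gtr0_norm.
rewrite (ge0_integral_scale_oy s0); last 2 first.
- apply: emeasurable_funM; first exact: measurable_cst. apply: emeasurable_funM.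
    by apply/measurable_EFinP; exact: normr_measurable.
  apply: measurableT_comp => //; apply/measurable_fun_pair => //.
  exact: measurable_funM.
- move=> y; apply: mule_ge0; first by rewrite lee_fin invr_ge0 sqr_ge0.
  by apply: mule_ge0 => //; rewrite lee_fin.
apply: eq_integral => rho; rewrite inE/= in_itv/= andbT => rho0.
have sN0 : sin phi != 0%R by rewrite gt_eqF.
rewrite gtr0_norm; last exact: mulr_gt0.
rewrite !muleA -!EFinM; congr (_%:E * f _); first by field.
by congr pair; [field|rewrite mulrC].
Qed.

End HalfPlane.

(** * Spherical coordinates by induction on the dimension *)

Section Cubes.
Context (R : realType).
Notation mu := (@lebesgue_measure R).
Local Notation RR := (measurableTypeR R).
Local Notation cube n := (n.-tuple (measurableTypeR R)).
Local Open Scope ereal_scope.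

Lemma integral_cube0 (F : cube 0 -> \bar R) :
  measurable_fun setT F -> \int[borel_lebesgue R 0]_t F t = F [tuple].
Proof.
by move=> mF; rewrite integral_dirac//= diracE in_setT mul1e.
Qed.

Lemma ge0_integral_cubeS n (F : cube n.+1 -> \bar R) :
  measurable_fun setT F -> (forall t, 0 <= F t) ->
  \int[borel_lebesgue R n.+1]_t F t =
  \int[mu]_x \int[borel_lebesgue R n]_z F (tcons (x, z)).
Proof.
move=> mF F0.
transitivity (\int[(mu \x borel_lebesgue R n)]_z F (tcons z)).
  rewrite -[RHS](@ge0_integral_pushforward _ _ _ _ _ _ (@measurable_tcons R n)
    (mu \x borel_lebesgue R n)%E setT F)//.
rewrite (fubini_tonelli1 (fun z => F (tcons z)))//.
by apply: measurableT_comp => //; exact: measurable_tcons.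
Qed.

Lemma measurable_dilate d (X : measurableType d) n (f : X -> R) (g : X -> cube n) :
  measurable_fun setT f -> measurable_fun setT g ->
  measurable_fun setT (fun x => dilate (f x) (g x) : cube n).
Proof.
move=> mf mg; apply/measurable_fun_tnthP => i.
rewrite [X in measurable_fun _ X](_ : _ = fun x => f x * tnth (g x) i)%R; last first.
  by apply/funext => x; rewrite /= tnth_mktuple.
have /measurable_fun_tnthP/(_ i) mgi := mg.
exact: measurable_funM.
Qed.

Lemma dilateM n a b (t : cube n) : dilate a (dilate b t) = dilate (a * b) t.
Proof. by apply: eq_from_tnth => i; rewrite !tnth_mktuple mulrA. Qed.

Lemma dilate1 n (t : cube n) : dilate 1 t = t.
Proof. by apply: eq_from_tnth => i; rewrite !tnth_mktuple mul1r. Qed.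

Lemma dilate_tcons n a (z : RR * cube n) :
  dilate a (tcons z) = tcons ((a * z.1)%R, dilate a z.2 : cube n).
Proof.
apply: eq_from_tnth => i; rewrite !tnth_mktuple.
by case: (unliftP ord0 i) => [j ->|->]; rewrite ?tnth0// !tnthS tnth_mktuple.
Qed.

(* For n = 1 the directions 1 and -1 are encoded by one parameter ranging over
   [0, 2[, so that k need not be n - 1. *)
Definition polar_rep n k (e : cube k -> cube n) (j : cube k -> R) :=
  [/\ measurable_fun setT e, measurable_fun setT j, forall a, (0 <= j a)%R &
   forall F : cube n -> \bar R, measurable_fun setT F -> (forall t, 0 <= F t) ->
   \int[borel_lebesgue R n]_t F t =
   \int[mu]_(rho in `]0%R, +oo[) \int[borel_lebesgue R k]_a
     ((rho ^+ n.-1 * j a)%:E * F (dilate rho (e a)))].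

(* Adding a coordinate: t = rho (cos b_0, sin b_0 e(b_1, ...)), which is how the
   angles of [polar] are nested. *)
Definition sph_ext n k (e : cube k -> cube n) (b : cube k.+1) : cube n.+1 :=
  tcons (cos (thead b) : RR, dilate (sin (thead b)) (e [tuple of behead b]) : cube n).

(** The polar formula in R^n, used at radius rho sin b_0, contributes (rho sin b_0)^(n-1); the
    half-plane adds one more factor rho. The indicator lets the parameters range over all of
    R^(k+1). *)
Definition sph_jac n k (j : cube k -> R) (b : cube k.+1) : R :=
  (\1_`]0, pi[%classic (thead b) * sin (thead b) ^+ n.-1 * j [tuple of behead b])%R.

(** Polar coordinates on the last n coordinates leave the first coordinate x and a radius y > 0. The
    point (x, y) of the upper half-plane is then written rho (cos phi, sin phi); the rest is
    exchanging integrals. *)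
Lemma polar_repS n k (e : cube k -> cube n) (j : cube k -> R) : (0 < n)%N ->
  polar_rep e j -> polar_rep (sph_ext e) (sph_jac n j).
Proof.
move=> n0 [me mj j0 polar].
have mth : measurable_fun setT (fun b : cube k.+1 => thead b : RR).
  exact: measurable_tnth.
have mbh : measurable_fun setT (fun b : cube k.+1 => [tuple of behead b] : cube k).
  exact: measurable_behead.
have mse : measurable_fun setT (sph_ext e).
  apply: (measurableT_comp (@measurable_tcons R n)); apply/measurable_fun_pair => /=.
    by apply: measurableT_comp mth; exact: measurable_cos.
  apply: measurable_dilate; last exact: measurableT_comp.
  by apply: measurableT_comp mth; exact: measurable_sin.
have msj : measurable_fun setT (sph_jac n j).
  apply: measurable_funM; last exact: measurableT_comp.
  apply: measurable_funM; first by apply: measurableT_comp.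
  by apply: measurable_funX; apply: measurableT_comp mth; exact: measurable_sin.
have sj0 b : (0 <= sph_jac n j b)%R.
  rewrite /sph_jac mulr_ge0// indicE.
  case: (boolP (thead b \in _)) => [|_]; last by rewrite mul0r.
  rewrite inE/= in_itv/= => /sin_gt0_pi/ltW ?.
  by rewrite mul1r exprn_ge0.
split=> // F mF F0.
(* Here z.1 is the parameter of the direction, z.2.1 the first coordinate and z.2.2 the radius of
   the others; the absolute value makes f nonnegative for every z. *)
pose f (z : cube k * (RR * RR)) : \bar R :=
  (`|z.2.2| ^+ n.-1 * j z.1)%:E * F (tcons (z.2.1, dilate z.2.2 (e z.1) : cube n)).
have f0 z : 0 <= f z by rewrite /f mule_ge0// lee_fin mulr_ge0// exprn_ge0.
have m1 : measurable_fun [set: cube k * (RR * RR)] (fun z => z.1 : cube k).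
  exact: measurable_fst.
have m21 : measurable_fun [set: cube k * (RR * RR)] (fun z => z.2.1 : RR).
  by apply: (measurableT_comp measurable_fst); exact: measurable_snd.
have m22 : measurable_fun [set: cube k * (RR * RR)] (fun z => z.2.2 : RR).
  by apply: (measurableT_comp measurable_snd); exact: measurable_snd.
have mf : measurable_fun setT f.
  apply: emeasurable_funM.
    apply/measurable_EFinP; apply: measurable_funM; last exact: measurableT_comp.
    by apply: measurable_funX; apply: measurableT_comp => //; exact: normr_measurable.
  apply: measurableT_comp => //; apply: (measurableT_comp (@measurable_tcons R n)).
  apply/measurable_fun_pair => //=.
  by apply: measurable_dilate => //; exact: measurableT_comp.
have mfa a : measurable_fun setT (fun z => f (a, z)).
  by apply: measurableT_comp => //; exact: measurable_pair1.
transitivity (\int[mu]_x \int[borel_lebesgue R k]_a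
    \int[mu]_(y in `]0%R, +oo[) f (a, (x, y))).
  rewrite ge0_integral_cubeS//; apply: eq_integral => x _.
  have mFx : measurable_fun setT (fun t : cube n => F (tcons (x, t))).
    apply: measurableT_comp => //; apply: (measurableT_comp (@measurable_tcons R n)).
    exact: measurable_pair1.
  rewrite (polar _ mFx); last by move=> t; exact: F0.
  transitivity (\int[mu]_(y in `]0%R, +oo[) \int[borel_lebesgue R k]_a f (a, (x, y))).
    apply: eq_integral => y; rewrite inE/= in_itv/= andbT => y0.
    by apply: eq_integral => a _; rewrite /f/= gtr0_norm.
  apply/esym; apply: (@fubini_tonelli_on _ _ (cube k) RR R (borel_lebesgue R k) mu setT _
    (fun z => f (z.1, (x, z.2)))).
  - exact: measurableT.
  - exact: measurable_itv.
  - apply: (measurableT_comp mf (g := fun z : cube k * RR => (z.1, (x, z.2)))).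
    by apply/measurable_fun_pair => //=; apply/measurable_fun_pair.
  - by move=> *; exact: f0.
rewrite (@fubini_tonelli_on _ _ RR (cube k) R mu (borel_lebesgue R k) setT setT
    (fun z => \int[mu]_(y in `]0%R, +oo[) f (z.2, (z.1, y))))//; last 2 first.
- apply: (@measurable_fun_integral_on _ _ (RR * cube k)%type RR R mu _
    (fun z => f (z.1.2, (z.1.1, z.2)))) => //.
  apply: measurableT_comp => //; apply/measurable_fun_pair => /=.
    by apply: (measurableT_comp measurable_snd); exact: measurable_fst.
  apply/measurable_fun_pair => //=.
  by apply: (measurableT_comp measurable_fst); exact: measurable_fst.
- by move=> *; exact: integral_ge0.
transitivity (\int[borel_lebesgue R k]_a \int[mu]_(rho in `]0%R, +oo[)
    \int[mu]_(phi in `]0%R, pi[) (`|rho|%:E * f (a, (rho * cos phi, rho * sin phi)%R))).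
  apply: eq_integral => a _.
  apply: (etrans (half_plane_polar (mfa a) (fun z => f0 (a, z)))).
  apply: eq_integral => rho; rewrite inE/= in_itv/= andbT => rho0.
  by apply: eq_integral => phi _; rewrite gtr0_norm.
have mg : measurable_fun [set: (RR * cube k) * RR] (fun z =>
    `|z.1.1|%:E * f (z.1.2, (z.1.1 * cos z.2, z.1.1 * sin z.2)%R)).
  have n11 : measurable_fun [set: (RR * cube k) * RR] (fun z => z.1.1 : RR).
    by apply: (measurableT_comp measurable_fst); exact: measurable_fst.
  apply: emeasurable_funM.
    by apply/measurable_EFinP; apply: measurableT_comp => //; exact: normr_measurable.
  apply: measurableT_comp => //; apply/measurable_fun_pair => /=.
    by apply: (measurableT_comp measurable_snd); exact: measurable_fst.
  apply/measurable_fun_pair => /=; apply: measurable_funM => //.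
    by apply: (measurableT_comp (@measurable_cos R)).
  by apply: (measurableT_comp (@measurable_sin R)).
have g0 (z : (RR * cube k) * RR) :
    0 <= `|z.1.1|%:E * f (z.1.2, (z.1.1 * cos z.2, z.1.1 * sin z.2)%R).
  by rewrite mule_ge0// lee_fin.
apply: (etrans (@fubini_tonelli_on _ _ (cube k) RR R (borel_lebesgue R k) mu setT _
    (fun z => \int[mu]_(phi in `]0%R, pi[) (`|z.2|%:E * f (z.1, (z.2 * cos phi, z.2 * sin phi)%R)))
    measurableT (measurable_itv _) _ _)).
- apply: (@measurable_fun_integral_on _ _ (cube k * RR)%type RR R mu _ (fun z =>
    `|z.1.2|%:E * f (z.1.1, (z.1.2 * cos z.2, z.1.2 * sin z.2)%R))) => //.
    apply: (measurableT_comp mg (g := fun z : (cube k * RR) * RR => ((z.1.2, z.1.1), z.2))).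
    apply/measurable_fun_pair => //=; apply/measurable_fun_pair.
      by apply: (measurableT_comp measurable_snd); exact: measurable_fst.
    by apply: (measurableT_comp measurable_fst); exact: measurable_fst.
  by move=> [a rho] phi _; exact: (g0 ((rho, a), phi)).
- by move=> a rho _ _; apply: integral_ge0 => phi _; exact: (g0 ((rho, a), phi)).
apply: eq_integral => rho; rewrite inE/= in_itv/= andbT => rho0.
apply: (etrans (@fubini_tonelli_on _ _ (cube k) RR R (borel_lebesgue R k) mu setT _
    (fun z => `|rho|%:E * f (z.1, (rho * cos z.2, rho * sin z.2)%R))
    measurableT (measurable_itv _) _ _)).
- apply: (measurableT_comp mg (g := fun z : cube k * RR => ((rho, z.1), z.2))).
  apply/measurable_fun_pair => //=.
  by apply/measurable_fun_pair.
- by move=> a phi _ _; exact: (g0 ((rho, a), phi)).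
apply/esym; apply: (etrans (ge0_integral_cubeS _ _)).
- apply: emeasurable_funM; first by apply/measurable_EFinP; exact: measurable_funM.
  apply: (measurableT_comp mF).
  exact: (@measurable_dilate _ (cube k.+1) n.+1 (fun=> rho) (sph_ext e)).
- by move=> t; rewrite mule_ge0// lee_fin mulr_ge0// exprn_ge0// ltW.
rewrite [RHS]integral_mkcond; apply: eq_integral => phi _; rewrite patchE.
have thE (a : cube k) : thead (tcons (phi, a)) = phi by [].
have bhE (a : cube k) : [tuple of behead (tcons (phi, a))] = a by exact: val_inj.
case: ifPn => [phipi|phiN]; last first.
  rewrite integral0_eq// => a _.
  by rewrite /sph_jac thE indicE (negbTE phiN) mul0r mul0r mulr0 mul0e.
apply: eq_integral => a _.
have s0 : (0 < sin phi)%R by apply: sin_gt0_pi; move: phipi; rewrite inE/= in_itv.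
rewrite /f /sph_jac /sph_ext thE bhE indicE phipi mul1r/=.
rewrite !gtr0_norm//; last exact: mulr_gt0.
rewrite dilate_tcons/= dilateM muleA -EFinM; congr (_%:E * _).
have -> : (rho ^+ n = rho * rho ^+ n.-1)%R by rewrite -exprS prednK.
by rewrite exprMn; ring.
Qed.

End Cubes.

Section PolarReps.
Context (R : realType).
Notation mu := (@lebesgue_measure R).
Local Notation RR := (measurableTypeR R).
Local Notation cube n := (n.-tuple (measurableTypeR R)).
Local Open Scope ereal_scope.

(** Each direction owns a parameter interval of length 1, so integrating over the parameter is
    summing over the two directions. *)
Definition sign_pt (a : cube 1) : cube 1 :=
  [tuple if (thead a < 1)%R then 1%R else (-1)%R].

Definition sign_wt (a : cube 1) : R := \1_`[0%R, 2%R[%classic (thead a).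

Lemma ge0_integral_fold (f : RR -> \bar R) :
  measurable_fun setT f -> (forall x, 0 <= f x) ->
  \int[mu]_x f x = \int[mu]_(x in `]0%R, +oo[) (f x + f (- x)%R).
Proof.
move=> mf f0.
have mfN : measurable_fun setT (fun x : RR => f (- x)%R).
  by apply: (measurableT_comp mf).
have -> : [set: RR] = `]-oo, 0%R[%classic `|` `[0%R, +oo[%classic.
  by apply/seteqP; split => // x _; rewrite /= !in_itv/= andbT; case: ltP; [left|right].
rewrite ge0_integral_setU//=; last 2 first.
- exact: measurable_funTS.
- apply/disj_set2P/seteqP; split => x //= [].
  by rewrite !in_itv/= andbT leNgt => ->.
rewrite addeC ge0_integralD//; last 2 first.
- exact: measurable_funTS.
- exact: measurable_funTS.
congr (_ + _).
  by rewrite integral_itv_obnd_cbnd//; exact: measurable_funTS.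
have ND : (-%R : R -> R) @` `]-oo, 0%R[%classic = `]0%R, +oo[%classic.
  apply/seteqP; split => [_ [x /= x0 <-]|x] /=; rewrite in_itv/=.
    by move: x0; rewrite in_itv/= andbT oppr_gt0.
  by rewrite andbT => x0; exists (- x)%R; rewrite ?opprK// in_itv/= oppr_lt0.
by rewrite (ge0_integralN _ mf)// ND.
Qed.

Lemma ge0_integral_cube1 (F : cube 1 -> \bar R) :
  measurable_fun setT F -> (forall t, 0 <= F t) ->
  \int[borel_lebesgue R 1]_t F t = \int[mu]_x F [tuple x].
Proof.
move=> mF F0; rewrite ge0_integral_cubeS//; apply: eq_integral => x _.
rewrite integral_cube0; first by congr (F _); exact: val_inj.
apply: measurableT_comp => //; apply: (measurableT_comp (@measurable_tcons R 0)).
exact: measurable_pair1.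
Qed.

Lemma measurable_sign_pt : measurable_fun setT sign_pt.
Proof.
apply/measurable_fun_tnthP => i; rewrite (ord1 i).
have mth : measurable_fun setT (fun b : cube 1 => thead b : RR).
  exact: measurable_tnth.
rewrite [X in measurable_fun _ X](_ : _ = fun a : cube 1 =>
    if (thead a < 1)%R then 1%R else (-1)%R); last by apply/funext.
apply: measurable_fun_if => //=.
exact: measurable_fun_ltr.
Qed.

Lemma measurable_sign_wt : measurable_fun setT sign_wt.
Proof.
have mth : measurable_fun setT (fun b : cube 1 => thead b : RR).
  exact: measurable_tnth.
by apply: measurableT_comp.
Qed.

Lemma integral_sign (G : cube 1 -> \bar R) : (forall t, 0 <= G t) ->
  measurable_fun setT G ->
  \int[borel_lebesgue R 1]_a ((sign_wt a)%:E * G (sign_pt a)) =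
  G [tuple 1%R] + G [tuple (-1)%R].
Proof.
move=> G0 mG.
have mth : measurable_fun setT (fun b : cube 1 => thead b : RR).
  exact: measurable_tnth.
rewrite ge0_integral_cube1//; last 2 first.
- apply: emeasurable_funM; first by apply/measurable_EFinP; exact: measurable_sign_wt.
  exact: (measurableT_comp mG measurable_sign_pt).
- by move=> t; rewrite mule_ge0// lee_fin.
transitivity (\int[mu]_(x in `[0%R, 1%R[) G [tuple 1%R] +
              \int[mu]_(x in `[1%R, 2%R[) G [tuple (-1)%R]).
  have -> : \int[mu]_(x in `[0%R, 1%R[) G [tuple 1%R] =
     \int[mu]_(x in `[0%R, 1%R[) ((sign_wt [tuple x])%:E * G (sign_pt [tuple x])).
    apply: eq_integral => x; rewrite inE/= in_itv/= => /andP[x0 x1].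
    rewrite /sign_wt /sign_pt [thead _]/= x1 indicE mem_set ?mul1e//=.
    by rewrite in_itv/= x0 (lt_trans x1)// ltr1n.
  have -> : \int[mu]_(x in `[1%R, 2%R[) G [tuple (-1)%R] =
     \int[mu]_(x in `[1%R, 2%R[) ((sign_wt [tuple x])%:E * G (sign_pt [tuple x])).
    apply: eq_integral => x; rewrite inE/= in_itv/= => /andP[x0 x1].
    rewrite /sign_wt /sign_pt [thead _]/= ltNge x0 indicE mem_set ?mul1e//=.
    by rewrite in_itv/= x1 andbT (le_trans ler01 x0).
  have mH (D : set RR) : measurable D ->
      measurable_fun D (fun x : RR => (sign_wt [tuple x])%:E * G (sign_pt [tuple x])).
    move=> mD; apply: measurable_funTS.
    have mt : measurable_fun setT (fun x : RR => [tuple x] : cube 1).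
      by apply/measurable_fun_tnthP => i; rewrite (ord1 i); exact: measurable_id.
    apply: emeasurable_funM.
      by apply/measurable_EFinP; exact: (measurableT_comp measurable_sign_wt mt).
    apply: (measurableT_comp mG).
    exact: (measurableT_comp measurable_sign_pt mt).
  have H0 x : 0 <= (sign_wt [tuple x])%:E * G (sign_pt [tuple x]).
    by rewrite mule_ge0// lee_fin.
  rewrite -ge0_integral_setU//=.
  - rewrite [RHS]integral_mkcond; apply: eq_integral => x _.
    rewrite patchE; case: ifPn => // /negP xN.
    rewrite /sign_wt indicE memNset ?mul0e// => /=; rewrite in_itv/= => /andP[x0 x2].
    apply: xN; rewrite inE/= !in_itv/= x0 x2 andbT /=.
    by case: ltP; [left|right].
  - by apply: mH; exact: measurableU.
  - apply/disj_set2P/seteqP; split => x //= [].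
    by rewrite !in_itv/= => /andP[_ x1] /andP[]; rewrite leNgt x1.
rewrite !integral_cst//= !lebesgue_measure_itv/= !lte_fin ltr01 ltr1n -!EFinB.
by rewrite subr0 (_ : 2 - 1 = 1)%R ?mule1//; ring.
Qed.

Lemma polar_rep_sign : polar_rep sign_pt sign_wt.
Proof.
split=> [||//|F mF F0]; [exact: measurable_sign_pt|exact: measurable_sign_wt|].
have mt : measurable_fun setT (fun x : RR => [tuple x] : cube 1).
  by apply/measurable_fun_tnthP => i; rewrite (ord1 i); exact: measurable_id.
have mFt : measurable_fun setT (fun x : RR => F [tuple x]) by exact: measurableT_comp.
have mFNt : measurable_fun setT (fun x : RR => F [tuple (- x)%R]).
  by apply: (measurableT_comp mFt).
rewrite ge0_integral_cube1// (ge0_integral_fold mFt)//.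
apply: eq_integral => rho _.
transitivity (\int[borel_lebesgue R 1]_a ((sign_wt a)%:E * F (dilate rho (sign_pt a)))).
  rewrite (@integral_sign (fun t => F (dilate rho t)))//.
    by congr (F _ + F _); apply: eq_from_tnth => i; rewrite !tnth_mktuple (ord1 i)
       ?(tnth0, mulr1, mulrN1).
  apply: (measurableT_comp mF); apply: (@measurable_dilate _ _ _ _ (fun=> rho) id) => //.
by apply: eq_integral => a _; rewrite expr0 mul1r.
Qed.

(** Only the measure induced on the directions matters, so parametrisations with the same integrals
    are interchangeable. This turns an upper half-circle together with a sign into the full
    circle. *)
Lemma polar_rep_eq n k k' (e : cube k -> cube n) (j : cube k -> R)
    (e' : cube k' -> cube n) (j' : cube k' -> R) :
  measurable_fun setT e' -> measurable_fun setT j' -> (forall a, (0 <= j' a)%R) ->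
  (forall G : cube n -> \bar R, measurable_fun setT G -> (forall t, 0 <= G t) ->
    \int[borel_lebesgue R k]_a ((j a)%:E * G (e a)) =
    \int[borel_lebesgue R k']_a ((j' a)%:E * G (e' a))) ->
  polar_rep e j -> polar_rep e' j'.
Proof.
move=> me' mj' j'0 jj' [me mj j0 polar]; split=> // F mF F0.
rewrite polar//; apply: eq_integral => rho; rewrite inE/= in_itv/= andbT => rho0.
have mG : measurable_fun setT (fun t : cube n => (rho ^+ n.-1)%:E * F (dilate rho t)).
  apply: emeasurable_funM => //; apply: (measurableT_comp mF).
  exact: (@measurable_dilate _ _ _ _ (fun=> rho) id).
have G0 t : 0 <= (rho ^+ n.-1)%:E * F (dilate rho t).
  by rewrite mule_ge0// lee_fin exprn_ge0// ltW.
have := jj' _ mG G0; congr (_ = _).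
  by apply: eq_integral => a _; rewrite EFinM muleA (muleC (j a)%:E).
by apply: eq_integral => a _; rewrite EFinM muleA (muleC (j' a)%:E).
Qed.

End PolarReps.

Section PolarAngles.
Context (R : realType).
Notation mu := (@lebesgue_measure R).
Local Notation RR := (measurableTypeR R).
Local Notation cube n := (n.-tuple (measurableTypeR R)).
Local Open Scope ereal_scope.

Definition polar1 d (w : cube d.-1) : cube d := @polar R d 1 w.

Definition angle_wt d (w : cube d.-1) : R :=
  (\1_(@angles R d) w * @polar_jacobian R d w)%R.

Lemma polar1_2 (w : cube 1) :
  @polar1 2 w = [tuple cos (thead w); sin (thead w)].
Proof.
apply: eq_from_tnth => i; rewrite tnth_mktuple mul1r.
have wE : w`_0 = thead w by rewrite [w]tuple_eta.
case: (unliftP ord0 i) => [j ->|->].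
  by rewrite (ord1 j) /= big_ord_recl big_ord0 /= wE !mulr1.
by rewrite big_ord0 /= wE mul1r.
Qed.

Lemma angle_wt_2 (w : cube 1) :
  @angle_wt 2 w = \1_`[0%R, (2 * pi)%R[%classic (thead w).
Proof.
rewrite /angle_wt /polar_jacobian big_ord0 mulr1 !indicE; congr (_%:R).
congr nat_of_bool; apply/idP/idP; rewrite !inE /angles/= in_itv/=.
  by move=> /(_ ord0).
by move=> h k; rewrite (ord1 k).
Qed.

Lemma sph_ext_polar1 m : @sph_ext R m.+2 m.+1 (@polar1 m.+2) = @polar1 m.+3.
Proof.
apply/funext => w; apply: eq_from_tnth => i; rewrite [RHS]tnth_mktuple mul1r.
case: (unliftP ord0 i) => [j ->|->].
  rewrite tnthS tnth_mktuple tnth_mktuple mul1r/= big_ord_recl mulrA.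
  congr (_ * _ * _)%R; first by rewrite [in RHS](tuple_eta w).
    apply: eq_bigr => k _; rewrite nth_behead; congr (sin _).
  by rewrite nth_behead.
by rewrite big_ord0 mul1r/= [in RHS](tuple_eta w).
Qed.

(** The left side restricts the first angle to the open interval, the right side to the closed one.
    The weights still agree everywhere, because the power of the sine is positive and vanishes at 0
    and pi. *)
Lemma sph_jac_angle_wt m : sph_jac m.+2 (@angle_wt m.+2) = @angle_wt m.+3.
Proof.
apply/funext => w; rewrite /sph_jac /angle_wt [in RHS]/polar_jacobian/=.
rewrite big_ord_recl/= subn0.
have w0 : w`_0 = thead w by rewrite [w in LHS]tuple_eta.
rewrite w0 (eq_bigr (fun k : 'I_m => sin ([tuple of behead w]`_k) ^+ (m - k))%R); last first.
  by move=> k _; rewrite nth_behead.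
set J := (\prod_(_ < m) _)%R; rewrite -/J.
have tl k : tnth w (lift ord0 k) = tnth [tuple of behead w] k.
  by rewrite [w in LHS]tuple_eta tnthS.
have angE : (w \in (@angles R m.+3 : set (cube m.+2))) = (0 <= thead w <= pi)%R &&
    ([tuple of behead w] \in (@angles R m.+2 : set (cube m.+1))).
  apply/idP/andP; rewrite !inE.
    move=> h; split; first exact: (h ord0).
    by move=> k; have := h (lift ord0 k); rewrite tl.
  move=> [h0 h] k; case: (unliftP ord0 k) => [j ->|->] //.
  by rewrite tl; exact: h.
rewrite !indicE angE.
have [s0|s0] := eqVneq (sin (thead w)) 0%R.
  by rewrite s0 expr0n/= !(mul0r, mulr0).
have -> : (thead w \in `]0%R, pi[%classic) = (0 <= thead w <= pi)%R.
  apply/idP/idP; rewrite !inE/= in_itv/=.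
    by move=> /andP[/ltW -> /ltW ->].
  move=> /andP[h0 h1]; rewrite !lt_neqAle h0 h1 !andbT.
  apply/andP; split; first by apply: contra_neq s0 => <-; rewrite sin0.
  by apply: contra_neq s0 => ->; rewrite sinpi.
case: (0 <= thead w <= pi)%R; rewrite ?mul0r// !mul1r andTb.
by rewrite mulrCA; congr (_ * _)%R; rewrite /polar_jacobian.
Qed.

(** The inductive step from dimension 1 yields an angle in ]0, pi[ and a sign for the second
    coordinate. The negative sign is moved to ]pi, 2 pi[ by phi -> 2 pi - phi, and the angles 0 and
    pi are negligible. The plane is the base of the induction because the last angle alone runs over
    a full turn. *)
Lemma polar_rep_2 : @polar_rep R 2 1 (@polar1 2) (@angle_wt 2).
Proof.
have sgn := polar_repS (n := 1) isT (@polar_rep_sign R).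
have [mse msj sj0 _] := sgn.
have mth : measurable_fun setT (fun b : cube 1 => thead b : RR).
  exact: measurable_tnth.
have mpt (f g : RR -> RR) : measurable_fun setT f -> measurable_fun setT g ->
    measurable_fun setT (fun x : RR => [tuple f x; g x] : cube 2).
  move=> mf mg; apply/measurable_fun_tnthP => i.
  by case: (unliftP ord0 i) => [j ->|->] //; rewrite (ord1 j).
have mp1 : measurable_fun setT (@polar1 2 : cube 1 -> cube 2).
  rewrite (_ : @polar1 2 = fun w : cube 1 => [tuple cos (thead w); sin (thead w)]); last first.
    by apply/funext => w; exact: polar1_2.
  apply: (measurableT_comp (mpt _ _ _ _) mth); first exact: measurable_cos.
  exact: measurable_sin.
have maw : measurable_fun setT (@angle_wt 2 : cube 1 -> R).
  rewrite (_ : @angle_wt 2 = fun w : cube 1 => \1_`[0%R, (2 * pi)%R[%classic (thead w)); last first.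
    by apply/funext => w; exact: angle_wt_2.
  exact: measurableT_comp.
apply: polar_rep_eq sgn => //.
  by move=> a; rewrite angle_wt_2.
move=> G mG G0.
pose g (x y : R) : \bar R := G [tuple x; y].
have mcs : measurable_fun setT (fun phi : RR => g (cos phi) (sin phi)).
  apply: (measurableT_comp mG); apply: mpt; first exact: measurable_cos.
  exact: measurable_sin.
have mcNs : measurable_fun setT (fun phi : RR => g (cos phi) (- sin phi)%R).
  apply: (measurableT_comp mG); apply: (mpt cos (fun x => - sin x)%R); first exact: measurable_cos.
  by apply: measurableT_comp => //; exact: measurable_sin.
transitivity (\int[mu]_(phi in `]0%R, pi[) (g (cos phi) (sin phi) + g (cos phi) (- sin phi)%R)).
  rewrite ge0_integral_cubeS; last 2 first.
  - apply: emeasurable_funM; first by apply/measurable_EFinP.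
    exact: (measurableT_comp mG mse).
  - by move=> b; rewrite mule_ge0// lee_fin.
  rewrite [RHS]integral_mkcond; apply: eq_integral => phi _; rewrite patchE.
  have thE (a : cube 1) : thead (tcons (phi, a)) = phi by [].
  have bhE (a : cube 1) : [tuple of behead (tcons (phi, a))] = a by exact: val_inj.
  case: ifPn => [phipi|phiN]; last first.
    rewrite integral0_eq// => a _.
    by rewrite /sph_jac thE indicE (negbTE phiN) !mul0r mul0e.
  transitivity (\int[borel_lebesgue R 1]_a ((sign_wt a)%:E *
      G (tcons (cos phi : RR, dilate (sin phi) (sign_pt a) : cube 1)))).
    apply: eq_integral => a _.
    by rewrite /sph_jac /sph_ext thE bhE indicE phipi expr0 !mul1r.
  rewrite (@integral_sign R (fun t => G (tcons (cos phi : RR, dilate (sin phi) t : cube 1))))//.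
    congr (G _ + G _); apply: eq_from_tnth => i; case: (unliftP ord0 i) => [j ->|->] //.
      by rewrite tnthS tnth_mktuple (ord1 j) tnth0 mulr1.
    by rewrite tnthS tnth_mktuple (ord1 j) tnth0 mulrN1.
  apply: (measurableT_comp mG); apply: (measurableT_comp (@measurable_tcons R 1)).
  apply/measurable_fun_pair => //=.
  exact: (@measurable_dilate _ _ _ _ (fun=> sin phi) id).
rewrite ge0_integral_cube1; last 2 first.
- apply: emeasurable_funM; first by apply/measurable_EFinP.
  exact: (measurableT_comp mG mp1).
- by move=> t; rewrite mule_ge0// lee_fin angle_wt_2.
transitivity (\int[mu]_(phi in `[0%R, (2 * pi)%R[) g (cos phi) (sin phi)); last first.
  rewrite integral_mkcond; apply: eq_integral => phi _.
  rewrite patchE angle_wt_2 polar1_2 indicE.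
  by case: ifPn => phiN; rewrite ?mul1e ?mul0e.
have pi0 := pi_gt0 R.
rewrite ge0_integralD//; last 4 first.
- by move=> x _; exact: G0.
- exact: measurable_funTS.
- by move=> x _; exact: G0.
- exact: measurable_funTS.
have -> : \int[mu]_(phi in `]0%R, pi[) g (cos phi) (- sin phi)%R =
    \int[mu]_(phi in `]pi, (2 * pi)%R[) g (cos phi) (sin phi).
  rewrite (ge0_integral_reflect_pi mcs); last by move=> x; exact: G0.
  apply: eq_integral => phi _.
  by rewrite mulr_natl cosB sinB cos2pi sin2pi !mul0r !mul1r addr0 sub0r.
rewrite (@integral_itv_obnd_cbnd R 0 (BLeft pi) (fun phi => g (cos phi) (sin phi)) (measurable_funTS mcs)).
rewrite (@integral_itv_obnd_cbnd R pi (BLeft (2 * pi)%R) (fun phi => g (cos phi) (sin phi)) (measurable_funTS mcs)).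
rewrite -ge0_integral_setU//=.
- congr (integral _ _ _); apply/seteqP; split => phi /=; rewrite !in_itv/=.
    by move=> [/andP[-> h]|/andP[h ->]]; rewrite ?andbT ?andTb; lra.
  by move=> /andP[h0 h1]; case: (ltP phi pi) => h; [left|right]; rewrite ?h0 ?h1.
- by apply: measurable_funTS.
- by move=> x _; exact: G0.
- apply/disj_set2P/seteqP; split => phi //= [].
  by rewrite !in_itv/= => /andP[_ h] /andP[]; rewrite leNgt h.
Qed.

Theorem polar_rep_polar1 m : polar_rep (@polar1 m.+2) (@angle_wt m.+2).
Proof.
elim: m => [|m IH]; first exact: polar_rep_2.
by rewrite -sph_ext_polar1 -sph_jac_angle_wt; exact: polar_repS.
Qed.

End PolarAngles.

(** * Lebesgue measurable functions and their Borel versions *)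

Lemma ge0_integral_measure_preserving d1 d2 (X : measurableType d1) (Y : measurableType d2)
    (R : realType) (m1 : {measure set X -> \bar R}) (m2 : {measure set Y -> \bar R})
    (phi : X -> Y) : measurable_fun setT phi ->
  (forall A, measurable A -> m1 (phi @^-1` A) = m2 A) ->
  forall F : Y -> \bar R, measurable_fun setT F -> (forall y, 0 <= F y)%E ->
  (\int[m1]_x F (phi x) = \int[m2]_y F y)%E.
Proof.
move=> mphi m12 F mF F0; transitivity (\int[pushforward m1 phi]_y F y)%E.
  by rewrite (ge0_integral_pushforward mphi).
by apply: eq_measure_integral => // A mA _; exact: m12.
Qed.

Section Completion.
Context (R : realType) (d : nat).
Local Notation cube := (d.-tuple (measurableTypeR R)).
Local Notation bl := (borel_lebesgue R d).
Local Notation leb := (lebesgue R d).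
Local Open Scope ereal_scope.

Lemma euclid_measurable (A : set cube) : measurable A ->
  measurable (A : set (euclid R d)).
Proof. exact: caratheodory_measurable_mu_ext. Qed.

Lemma lebesgueE (A : set cube) : measurable A -> leb A = bl A.
Proof. by move=> mA; exact: measurable_mu_extE. Qed.

Lemma measurable_euclid_id : measurable_fun setT (id : euclid R d -> cube).
Proof. by move=> _ A mA; rewrite setTI preimage_id; exact: euclid_measurable. Qed.

Lemma lebesgue_complete : measure_is_complete leb.
Proof. exact: (@measure_is_complete_caratheodory R cube (mu_ext bl)). Qed.

Lemma ge0_integral_lebesgue (F : cube -> \bar R) :
  measurable_fun setT F -> (forall t, 0 <= F t) ->
  \int[leb]_t F t = \int[bl]_t F t.
Proof.
exact: (@ge0_integral_measure_preserving _ _ (euclid R d) cube R leb bl id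
  measurable_euclid_id lebesgueE F).
Qed.

(** On an arbitrary set [leb] is the outer measure; the hull is the intersection of countable
    measurable covers with excess below 1/(n+1). *)
Lemma borel_hull (A : set cube) : leb A < +oo ->
  exists F : set cube, [/\ measurable F, A `<=` F & bl F = leb A].
Proof.
move=> Aoo.
have fA : leb A \is a fin_num by rewrite ge0_fin_numE.
have /choice[C mC] : forall n : nat, exists C : (set cube)^nat,
    measurable_cover A C /\ \sum_(0 <= k <oo) bl (C k) < leb A + n.+1%:R^-1%:E.
  move=> n; have e0 : (0 < n.+1%:R^-1 :> R)%R by rewrite invr_gt0.
  by have [_/= [C AC <-] ?] := lb_ereal_inf_adherent e0 fA; exists C.
pose F_ n := \bigcup_m (C n m).
have mF_ n : measurable (F_ n) by apply: bigcupT_measurable => k; have [[/(_ k)]] := mC n.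
exists (\bigcap_n F_ n); split.
- exact: bigcapT_measurable.
- by apply: sub_bigcap => n _; have [[]] := mC n.
have mF : measurable (\bigcap_n F_ n) by exact: bigcapT_measurable.
apply/eqP; rewrite eq_le; apply/andP; split; last first.
  rewrite -lebesgueE//; apply: le_outer_measure.
  by apply: sub_bigcap => n _; have [[]] := mC n.
apply/lee_addgt0Pr => _/posnumP[e]; near \oo => n.
apply: (@le_trans _ _ (bl (F_ n))).
  by apply: le_measure; rewrite ?inE//; exact: bigcap_inf.
apply: (@le_trans _ _ (\sum_(0 <= k <oo) bl (C n k))).
  by apply: measure_sigma_subadditive => // k; have [[/(_ k)]] := mC n.
rewrite (le_trans (ltW (mC n).2))// leeD// lee_fin ltW//.
by near: n; apply: near_infty_natSinv_lt.
Unshelve. all: by end_near. Qed.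

(** For finite measure, B is a Borel hull of A and N a Borel hull of the null set B minus A. The
    general case is cut into countably many pieces of finite measure. *)
Lemma borel_modification (A : set (euclid R d)) : measurable A ->
  exists B N : set cube, [/\ measurable B, measurable N, bl N = 0 &
    forall t, ~ N t -> (A t <-> B t)].
Proof.
move=> mA.
have fin (E : set (euclid R d)) : measurable E -> leb E < +oo ->
    exists B N : set cube, [/\ measurable B, measurable N, bl N = 0 &
      forall t, ~ N t -> (E t <-> B t)].
  move=> mE Eoo; have [F [mF EF blF]] := borel_hull Eoo.
  have mFE : measurable (F `\` E : set (euclid R d)).
    by apply: measurableD => //; exact: euclid_measurable.
  have FE0 : leb (F `\` E) = 0.
    rewrite measureD//=; last 2 first.
    - exact: euclid_measurable.
    - by rewrite lebesgueE// blF.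
    by rewrite setIidr// lebesgueE// blF subee// ge0_fin_numE.
  have [|N [mN FEN blN]] := @borel_hull (F `\` E); first by rewrite FE0.
  exists F, N; split=> //; first by rewrite blN.
  move=> t Nt; split=> [/EF//|Ft]; apply: contrapT => Et.
  by apply: Nt; apply: FEN.
have /sigma_finiteP[S [TS _ Soo]] := sigma_finiteT bl.
have mAS n : measurable (A `&` S n : set (euclid R d)).
  by apply: measurableI => //; apply: euclid_measurable; exact: (Soo n).1.
have ASoo n : leb (A `&` S n) < +oo.
  apply: (@le_lt_trans _ _ (leb (S n))); first by apply: le_outer_measure; exact: subIsetr.
  by rewrite lebesgueE; [exact: (Soo n).2|exact: (Soo n).1].
have /choice[B /choice[N BN]] := fun n => fin _ (mAS n) (ASoo n).
exists (\bigcup_n (B n)), (\bigcup_n N n); split.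
- by apply: bigcupT_measurable => n; have [] := BN n.
- by apply: bigcupT_measurable => n; have [] := BN n.
- have : bl.-negligible (\bigcup_n N n).
    apply: negligible_bigcup => k; have [_ mN N0 _] := BN k.
    by exists (N k); split.
  move=> [M [mM M0 NM]]; apply: (subset_measure0 _ mM NM M0).
  by apply: bigcupT_measurable => n; have [] := BN n.
- move=> t Nt; split=> [At|[n _ Bt]].
    have [n _ St] : (\bigcup_n S n) t by rewrite -TS.
    exists n => //; have [_ _ _ h] := BN n.
    apply: (h t _).1; last by split.
    by apply: contra_not Nt => ?; exists n.
  have [_ _ _ h] := BN n.
  have [] // : (A `&` S n) t.
  by apply: (h t _).2 => //; apply: contra_not Nt => ?; exists n.
Qed.

(** The superlevel sets at rational heights determine f. Their Borel modifications have countably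
    many exceptional sets, and on the union of these g is set to 0. *)
Lemma borel_version (f : euclid R d -> R) : measurable_fun setT f ->
  exists (g : cube -> R) (N : set cube), [/\ measurable_fun setT g, measurable N,
    bl N = 0 & forall t, ~ N t -> f t = g t].
Proof.
move=> mf.
have mq (q : rat) : measurable [set t | (ratr q < f t)%R].
  have := mf measurableT `](ratr q), +oo[%classic (measurable_itv _).
  rewrite setTI; congr measurable; apply/seteqP.
  by split => t /=; rewrite in_itv/= andbT.
have /choice[B /choice[N BN]] : forall q : rat, exists B N : set cube,
    [/\ measurable B, measurable N, bl N = 0 &
    forall t, ~ N t -> ((ratr q < f t)%R <-> B t)].
  by move=> q; have [B [N BN]] := borel_modification (mq q); exists B, N.
pose M := \bigcup_n (if unpickle n is Some q then N q else set0).
have mM : measurable M.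
  apply: bigcupT_measurable => n; case: unpickle => [q|//]; by have [] := BN q.
have M0 : bl M = 0.
  have : bl.-negligible M.
    apply: negligible_bigcup => k; case: unpickle => [q|]; last exact: negligible_set0.
    by have [_ mN N0 _] := BN q; exists (N q); split.
  by move=> [M' [mM' M'0 MM']]; exact: (subset_measure0 mM mM' MM' M'0).
have NM q : N q `<=` M.
  by move=> t Nt; exists (pickle q); [exact: I|rewrite pickleK; exact: Nt].
exists (fun t => if t \in M then 0%R else f t), M.
split; [|exact: mM|exact: M0|by move=> t Mt; rewrite memNset].
apply: (measurability (@RGenOInfty.G R)) => [|_ [_ [x ->] <-]].
  exact: RGenOInfty.measurableE.
have -> : setT `&` (fun t : cube => if t \in M then 0%R else f t) @^-1` `]x, +oo[ =
    (if (x < 0)%R then M else set0) `|`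
    (\bigcup_(q in [set q : rat | (x < ratr q)%R]) (B q `\` M)).
  rewrite setTI; apply/seteqP; split => t /=.
    rewrite /preimage/= in_itv/= andbT; case: ifPn; rewrite (inE, notin_setE) => Mt.
      by move=> ->; left.
    move=> xf; have [q] := rat_in_itvoo xf; rewrite in_itv/= => /andP[xq qf].
    right; exists q => //; split => //.
    have [_ _ _ h] := BN q; exact: (h t (contra_not (@NM q t) Mt)).1.
  rewrite /preimage/= in_itv/= andbT => -[|[q/= xq [Bt Mt]]].
    by case: ifPn => // x0 Mt; rewrite mem_set.
  rewrite memNset//; apply: (lt_trans xq).
  have [_ _ _ h] := BN q; exact: (h t (contra_not (@NM q t) Mt)).2.
apply: measurableU; first by case: ifPn.
rewrite bigcup_mkcond; apply: bigcupT_measurable_rat => q.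
by case: ifPn => // _; apply: measurableD => //; have [] := BN q.
Qed.

(** Completeness makes f measurable as soon as it agrees with a Borel function off a null set. *)
Lemma ge0_integral_lebesgue_ae (f : euclid R d -> \bar R) (g : cube -> \bar R)
    (N : set cube) :
  (forall t, 0 <= f t) -> measurable_fun setT g -> (forall t, 0 <= g t) ->
  measurable N -> bl N = 0 -> (forall t, ~ N t -> f t = g t) ->
  \int[leb]_t f t = \int[bl]_t g t.
Proof.
move=> f0 mg g0 mN N0 fg; rewrite -ge0_integral_lebesgue//.
have mg' : measurable_fun setT (g : euclid R d -> \bar R).
  exact: (measurableT_comp mg measurable_euclid_id).
have ae : ae_eq leb setT (g : euclid R d -> \bar R) f.
  exists N; split; [exact: euclid_measurable|by rewrite lebesgueE|].
  by move=> t /= h; apply: contrapT => Nt; apply: h => _; rewrite fg.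
have mf := ae_measurable_fun lebesgue_complete ae mg'.
by apply/esym/ge0_ae_eq_integral.
Qed.

End Completion.

(** * Integrals of homogeneous functions over cones *)

Section Homogeneous.
Context (R : realType) (d k : nat).
Notation mu := (@lebesgue_measure R).
Local Notation RR := (measurableTypeR R).
Local Notation cube n := (n.-tuple (measurableTypeR R)).
Variables (e : cube k -> cube d) (j : cube k -> R).
Hypotheses (d0 : (0 < d)%N) (polar : polar_rep e j).

Let me_ : measurable_fun setT e. Proof. by case: polar. Qed.
Let mj : measurable_fun setT j. Proof. by case: polar. Qed.
Let j0 a : 0 <= j a. Proof. by case: polar. Qed.

Let mre : measurable_fun [set: RR * cube k] (fun z => dilate z.1 (e z.2) : cube d).
Proof.
apply: measurable_dilate; first exact: measurable_fst.
exact: (measurableT_comp me_ measurable_snd).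
Qed.

Let mdil rho : measurable_fun [set: cube k] (fun a => dilate rho (e a) : cube d).
Proof. by apply: (@measurable_dilate _ _ _ _ (fun=> rho) e). Qed.

(** On the sphere of radius rho, almost every direction of nonzero weight avoids N. The unit sphere
    may fail this even when N is null. *)
Let good (N : set (cube d)) (rho : R) := exists2 M : set (cube k),
  measurable M /\ borel_lebesgue R k M = 0%E &
  forall a, ~ M a -> j a = 0 \/ ~ N (dilate rho (e a)).

(** The polar formula for the indicator of N expresses 0 as an integral over rho of nonnegative
    angular integrals, so almost all of these vanish. *)
Lemma null_rays (N : set (cube d)) : measurable N -> borel_lebesgue R d N = 0%E ->
  exists2 M : set RR, measurable M /\ mu M = 0%E &
    forall rho, 0 < rho -> ~ M rho -> good N rho.
Proof.
move=> mN N0; have [_ _ _ pol] := polar.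
pose f (z : RR * cube k) : \bar R :=
  (`|z.1| ^+ d.-1 * j z.2 * \1_N (dilate z.1 (e z.2) : cube d))%:E.
have mf : measurable_fun setT f.
  apply/measurable_EFinP; apply: measurable_funM.
    apply: measurable_funM; last exact: (measurableT_comp mj measurable_snd).
    by apply: measurable_funX; apply: measurableT_comp => //; exact: normr_measurable.
  apply: (@measurableT_comp _ _ _ _ _ _ (\1_N : cube d -> R)) => //.
have f0 z : (0 <= f z)%E by rewrite lee_fin !mulr_ge0// exprn_ge0.
have mI : measurable_fun setT (fun rho : RR => \int[borel_lebesgue R k]_a f (rho, a))%E.
  apply: (@measurable_fun_integral_on _ _ RR (cube k) R (borel_lebesgue R k) setT f) => //.
have I0 : (\int[mu]_(rho in `]0%R, +oo[) `|\int[borel_lebesgue R k]_a f (rho, a)| = 0)%E.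
  have <- : (\int[borel_lebesgue R d]_t (\1_N t)%:E = 0)%E by rewrite integral_indic// setIT.
  rewrite pol//; last by apply/measurable_EFinP.
  apply: eq_integral => rho; rewrite inE/= in_itv/= andbT => rho0.
  rewrite gee0_abs; last by apply: integral_ge0.
  by apply: eq_integral => a _; rewrite /f/= gtr0_norm.
have [M [mM M0 MD]] := (@ae_eq_integral_abs _ RR R mu `]0, +oo[%classic (measurable_itv _) _ (measurable_funTS mI)).1 I0.
exists M => // rho rho0 Mrho.
have If : (\int[borel_lebesgue R k]_a `|f (rho, a)| = 0)%E.
  rewrite -[RHS](_ : \int[borel_lebesgue R k]_a f (rho, a) = 0)%E; last first.
    apply: contrapT => h; apply: Mrho; apply: MD => /= /(_ _); apply/not_implyP; split=> //.
    by rewrite in_itv/= rho0.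
  by apply: eq_integral => a _; rewrite gee0_abs.
have mfr : measurable_fun setT (fun a => f (rho, a)).
  exact: (measurableT_comp mf (measurable_pair1 _)).
have [Q [mQ Q0 QD]] := (ae_eq_integral_abs _ measurableT mfr).1 If.
exists Q => // a Qa.
have fa : f (rho, a) = 0%E.
  by apply: contrapT => h; apply: Qa; apply: QD => /= /(_ I).
move: fa; rewrite /f/= => -[] /eqP; rewrite !mulf_eq0 => /orP[/orP[]|].
- by rewrite expf_eq0 normr_eq0 gt_eqF// andbF.
- by move=> /eqP; left.
- by rewrite indicE; case: (boolP (_ \in N)) => [_|]; rewrite ?oner_eq0// notin_setE; right.
Qed.

Lemma good_ray (M : set RR) : measurable M -> mu M = 0%E ->
  exists2 rho, 0 < rho & ~ M rho.
Proof.
move=> mM M0; apply: contrapT => h.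
have sub : `]0, 1[%classic `<=` M.
  move=> x; rewrite /= in_itv/= => /andP[x0 _]; apply: contrapT => Mx.
  by apply: h; exists x.
have : (mu `]0%R, 1%R[%classic <= mu M)%E by apply: le_measure; rewrite ?inE.
by rewrite M0 lebesgue_measure_itv/= lte_fin ltr01 sube0 lee_fin ler10.
Qed.

Variables (T : set (euclid R d)) (G y : euclid R d -> R) (E : R) (h : R -> R).
Hypotheses (mT : measurable T) (coneT : cone T).
Hypotheses (mG : measurable_fun T G) (my : measurable_fun T y).
Hypotheses (G0 : forall t, T t -> 0 <= G t).
Hypothesis homG : forall (c : R) t, 0 < c -> T t -> G (dilate c t) = c ^- d * G t.
Hypothesis homy : forall (c : R) t, 0 < c -> T t -> G t != 0 ->
  y (dilate c t) = y t + E * ln c.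
Hypotheses (E0 : E != 0) (mh : measurable_fun setT h) (h0 : forall x, 0 <= h x).
Local Open Scope ereal_scope.

Let dilateK (c : R) t : (0 < c)%R -> T (dilate c t) -> T t.
Proof.
move=> c0 /(coneT (c := c^-1%R)); rewrite invr_gt0 c0 => /(_ isT).
by rewrite dilateM mulVf ?gt_eqF// dilate1.
Qed.

(** On the ray through e(a), G rho^(d-1) is G(e a) / rho and y is y(e a) + E ln rho, so the radial
    integral is that of h divided by |E|, whatever the ray. Borel versions of G and y are needed for
    the polar formula and for exchanging integrals. *)
Lemma homogeneous_integral :
  \int[lebesgue R d]_(t in T) (G t * h (y t))%:E =
  (`|E|^-1)%:E * (\int[mu]_x (h x)%:E) *
  \int[lebesgue R k]_a (j a * (G \_ T) (e a))%:E.
Proof.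
have [_ _ _ pol] := polar.
have mGT : measurable_fun setT (G \_ T) by apply: (measurable_restrictT G mT).1.
have myT : measurable_fun setT (y \_ T) by apply: (measurable_restrictT y mT).1.
have GT0 t : (0 <= (G \_ T) t)%R.
  by rewrite patchE; case: ifPn => //; rewrite inE => /G0.
have [g [N1 [mg mN1 N10 gE]]] := borel_version mGT.
have [z [N2 [mz mN2 N20 zE]]] := borel_version myT.
pose N := N1 `|` N2.
have mN : measurable N by exact: measurableU.
have N0 : borel_lebesgue R d N = 0.
  apply/eqP; rewrite eq_le measure_ge0 andbT.
  by rewrite (le_trans (measureU2 _ _ _))//= N10 N20 adde0.
have gN t : ~ N t -> `|g t|%R = (G \_ T) t.
  move=> Nt; rewrite -gE ?ger0_norm//.
  by apply: contra_not Nt; left.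
have zN t : ~ N t -> z t = (y \_ T) t.
  by move=> Nt; rewrite -zE//; apply: contra_not Nt; right.
have mng : measurable_fun setT (fun t => `|g t|%R).
  by apply: measurableT_comp => //; exact: normr_measurable.
have mhz : measurable_fun setT (fun t => h (z t)) by exact: measurableT_comp.
transitivity (\int[borel_lebesgue R d]_t (`|g t| * h (z t))%:E).
  rewrite integral_mkcond.
  apply: (@ge0_integral_lebesgue_ae _ _ _ _ N) => //.
  - by move=> t; rewrite patchE; case: ifPn => //; rewrite inE lee_fin => /G0 ?; rewrite mulr_ge0.
  - by apply/measurable_EFinP; exact: measurable_funM.
  - by move=> t; rewrite lee_fin mulr_ge0.
  - move=> t Nt; rewrite gN// zN// !patchE; case: ifPn => // _.
    by rewrite mul0r.
rewrite pol; last 2 first.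
- by apply/measurable_EFinP; exact: measurable_funM.
- by move=> t; rewrite lee_fin mulr_ge0.
have [M [mM M0] MN] := null_rays mN N0.
have [rho0 rho00 Mrho0] := good_ray mM M0.
have [Q0 [mQ0 Q00] good0] := MN _ rho00 Mrho0.
(* The Borel versions may be wrong on the unit sphere, so the values of G and y at e(a) are
   recovered, by homogeneity, from the good radius [rho0]. *)
pose G1 a : R := (j a * (rho0 ^+ d * `|g (dilate rho0 (e a))|))%R.
pose Y1 a : R := (z (dilate rho0 (e a)) - E * ln rho0)%R.
have mG1 : measurable_fun setT G1.
  apply: measurable_funM => //; apply: measurable_funM => //.
  exact: (measurableT_comp mng).
have mY1 : measurable_fun setT Y1.
  by apply: measurable_funB => //; exact: (measurableT_comp mz).
have G10 a : (0 <= G1 a)%R by rewrite !mulr_ge0// exprn_ge0// ltW.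
have G1E a : ~ Q0 a -> G1 a = (j a * (G \_ T) (e a))%R.
  move=> /good0[|Na]; first by rewrite /G1 => ->; rewrite !mul0r.
  rewrite /G1 gN//; congr (_ * _)%R; rewrite !patchE.
  have [Te|Te] := pselect (T (e a)).
    rewrite !mem_set//; last exact: coneT.
    by rewrite homG// mulrA divff ?mul1r// expf_neq0// gt_eqF.
  by rewrite !memNset ?mulr0//; apply: contra_not Te; exact: dilateK.
pose f1 (x : RR * cube k) : R :=
  (`|x.1| ^+ d.-1 * j x.2 * (`|g (dilate x.1 (e x.2))| * h (z (dilate x.1 (e x.2)))))%R.
pose f2 (x : RR * cube k) : R := (`|x.1|^-1 * (G1 x.2 * h (Y1 x.2 + E * ln x.1)))%R.
have mn1 : measurable_fun [set: RR * cube k] (fun x => `|x.1|%R).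
  by apply: measurableT_comp => //; exact: normr_measurable.
have mf1 : measurable_fun setT f1.
  apply: measurable_funM.
    apply: measurable_funM; last exact: (measurableT_comp mj measurable_snd).
    by apply: measurable_funX; exact: mn1.
  apply: measurable_funM; first exact: (measurableT_comp mng mre).
  exact: (measurableT_comp mhz mre).
have f10 x : (0 <= f1 x)%R by rewrite !mulr_ge0// exprn_ge0.
have mf2 : measurable_fun setT f2.
  apply: measurable_funM; first by apply: measurable_funV; exact: mn1.
  apply: measurable_funM; first exact: (measurableT_comp mG1 measurable_snd).
  apply: (measurableT_comp mh); apply: measurable_funD.
    exact: (measurableT_comp mY1 measurable_snd).
  apply: measurable_funM => //.
  exact: (measurableT_comp (@measurable_ln R) measurable_fst).
have f20 x : (0 <= f2 x)%R.
  by apply: mulr_ge0; [rewrite invr_ge0|apply: mulr_ge0].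
(* For almost every radius the Borel versions are right in almost every direction, and there the
   integrand takes its homogeneous form [f2]. *)
have f12 rho : (0 < rho)%R -> ~ M rho ->
    \int[borel_lebesgue R k]_a (f1 (rho, a))%:E = \int[borel_lebesgue R k]_a (f2 (rho, a))%:E.
  move=> rho_gt0 Mrho; have [Q [mQ Q_0] goodQ] := MN _ rho_gt0 Mrho.
  apply: ge0_ae_eq_integral => //.
  - by apply/measurable_EFinP; exact: (measurableT_comp mf1 (measurable_pair1 _)).
  - by apply/measurable_EFinP; exact: (measurableT_comp mf2 (measurable_pair1 _)).
  - by move=> a _; rewrite lee_fin.
  - by move=> a _; rewrite lee_fin.
  exists (Q `|` Q0); split.
  - exact: measurableU.
  - apply/eqP; rewrite eq_le measure_ge0 andbT.
    by rewrite (le_trans (measureU2 _ _ _))//= Q_0 Q00 adde0.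
  move=> a /= f12a; apply: contrapT => Qa; apply: f12a => _.
  have /goodQ[|Na] : ~ Q a by apply: contra_not Qa; left.
    by rewrite /f1 /f2 /G1/= => ->; rewrite !(mul0r, mulr0).
  have /good0[|N0a] : ~ Q0 a by apply: contra_not Qa; right.
    by rewrite /f1 /f2 /G1/= => ->; rewrite !(mul0r, mulr0).
  have Q0a : ~ Q0 a by apply: contra_not Qa; right.
  rewrite /f1 /f2/= gtr0_norm// G1E// gN// zN//; congr EFin.
  have [Te|Te] := pselect (T (e a)); last first.
    rewrite !patchE !memNset//; last by apply: contra_not Te; exact: dilateK.
    by rewrite !(mul0r, mulr0).
  have TeC (c : R) : (0 < c)%R -> T (dilate c (e a)) by move=> c0; exact: coneT.
  rewrite /Y1 zN// !patchE !mem_set//; try exact: TeC.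
  rewrite homG//; have [Ge0|Ge0] := eqVneq (G (e a)) 0%R.
    by rewrite Ge0 !(mul0r, mulr0).
  rewrite !homy// addrK.
  have -> : (rho ^- d = rho^-1 * rho ^- d.-1)%R by rewrite -{1}(prednK d0) exprS invfM.
  by field; rewrite ?expf_neq0 gt_eqF.
transitivity (\int[mu]_(rho in `]0%R, +oo[) \int[borel_lebesgue R k]_a (f2 (rho, a))%:E).
  transitivity (\int[mu]_(rho in `]0%R, +oo[) \int[borel_lebesgue R k]_a (f1 (rho, a))%:E).
    apply: eq_integral => rho; rewrite inE/= in_itv/= andbT => rho_gt0.
    by apply: eq_integral => a _; rewrite -EFinM /f1/= (gtr0_norm rho_gt0).
  apply: ge0_ae_eq_integral.
  - exact: measurable_itv.
  - apply: measurable_funTS.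
    apply: (@measurable_fun_integral_on _ _ RR (cube k) R (borel_lebesgue R k) setT (EFin \o f1)) => // [|x a _].
      by apply/measurable_EFinP.
    by rewrite lee_fin.
  - apply: measurable_funTS.
    apply: (@measurable_fun_integral_on _ _ RR (cube k) R (borel_lebesgue R k) setT (EFin \o f2)) => // [|x a _].
      by apply/measurable_EFinP.
    by rewrite lee_fin.
  - by move=> rho _; apply: integral_ge0 => a _; rewrite lee_fin.
  - by move=> rho _; apply: integral_ge0 => a _; rewrite lee_fin.
  exists M; split => // rho /= f12rho; apply: contrapT => Mrho; apply: f12rho.
  by rewrite in_itv/= andbT => rho_gt0; exact: f12.
rewrite (@fubini_tonelli_on _ _ RR (cube k) R mu (borel_lebesgue R k) _ setT (EFin \o f2))//; last 2 first.
- by apply/measurable_EFinP.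
- by move=> *; rewrite lee_fin.
have mhE : measurable_fun setT (fun x : R => (h x)%:E) by apply/measurable_EFinP.
transitivity (\int[borel_lebesgue R k]_a
    ((`|E|^-1)%:E * (\int[mu]_x (h x)%:E) * (G1 a)%:E)).
  apply: eq_integral => a _.
  rewrite (@ge0_integral_log R E (Y1 a) (fun x => (h x)%:E))//.
  have mlog : measurable_fun (`]0%R, +oo[%classic : set RR) (fun x : RR => (`|E| / x)%:E * (h (Y1 a + E * ln x)%R)%:E).
    apply: measurable_funTS; apply: emeasurable_funM; apply/measurable_EFinP.
      by apply: measurable_funM => //; exact: measurable_inv.
    apply: (measurableT_comp mh); apply: measurable_funD => //.
    by apply: measurable_funM => //; exact: measurable_ln.
  have E_gt0 : (0 < `|E|)%R by rewrite normr_gt0.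
  have lg0 (x : RR) : `]0%R, +oo[%classic x ->
      0 <= (`|E| / x)%:E * (h (Y1 a + E * ln x)%R)%:E.
    rewrite /= in_itv/= andbT => x0.
    by rewrite mule_ge0// lee_fin// divr_ge0// ltW.
  rewrite -ge0_integralZl_EFin//.
  rewrite -ge0_integralZr//; last 3 first.
  - by apply: emeasurable_funM.
  - by move=> x x0; rewrite mule_ge0 ?lg0// lee_fin invr_ge0.
  - by rewrite lee_fin.
  apply: eq_integral => x; rewrite inE/= in_itv/= andbT => x0.
  rewrite /f2/= gtr0_norm// -!EFinM; congr EFin.
  by field; rewrite !gt_eqF.
rewrite ge0_integralZl//; last 3 first.
- by apply/measurable_EFinP.
- by move=> a _; rewrite lee_fin.
- by rewrite mule_ge0 ?lee_fin ?invr_ge0//; apply: integral_ge0 => x _; rewrite lee_fin.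
congr (_ * _); apply/esym.
apply: (@ge0_integral_lebesgue_ae _ _ _ (EFin \o G1) Q0) => //.
- by move=> a; rewrite lee_fin mulr_ge0.
- by apply/measurable_EFinP.
- by move=> a Q0a; rewrite /= G1E.
Qed.

End Homogeneous.

Section AngularIntegral.
Context (R : realType).
Notation mu := (@lebesgue_measure R).
Local Notation RR := (measurableTypeR R).
Local Notation cube n := (n.-tuple (measurableTypeR R)).
Local Open Scope ereal_scope.

Lemma polarE d rho (w : cube d.-1) : @polar R d rho w = dilate rho (@polar1 R d w).
Proof. by apply: eq_from_tnth => i; rewrite !tnth_mktuple mul1r mulrA. Qed.

Lemma angular_integral1 (T : set (euclid R 1)) (G : euclid R 1 -> R) :
  (forall t, T t -> 0 <= G t)%R ->
  angular_integral T G =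
  \int[lebesgue R 1]_a (sign_wt a * (G \_ T) (sign_pt a))%:E.
Proof.
move=> G0.
have GT0 t : (0 <= (G \_ T) t)%R.
  by rewrite patchE; case: ifPn => //; rewrite inE => /G0.
(* Only two values of G matter; a step function taking them is Borel and can stand in for G. *)
pose c1 := (G \_ T) [tuple 1%R]; pose c2 := (G \_ T) [tuple (-1)%R].
pose g (t : cube 1) : \bar R := (if (0 < thead t)%R then c1 else c2)%:E.
have mth : measurable_fun setT (fun b : cube 1 => thead b : RR).
  exact: measurable_tnth.
have g0 t : 0 <= g t by rewrite /g lee_fin; case: ifPn => _; exact: GT0.
have mg : measurable_fun setT g.
  apply/measurable_EFinP; apply: measurable_fun_if => //.
  exact: measurable_fun_ltr.
have n1 s : nseq_tuple 1 s = [tuple s] :> cube 1 by exact: val_inj.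
transitivity (g [tuple 1%R] + g [tuple (-1)%R]).
  rewrite /angular_integral/= /g /thead /= ltr01 ltr0N1 -EFinD.
  congr EFin; rewrite !big_cons big_nil !n1 /c1 /c2 !patchE.
  by case: asboolP => h1; case: asboolP => h2; rewrite ?(mem_set h1) ?(mem_set h2)
    ?(memNset h1) ?(memNset h2) ?addr0 ?add0r.
rewrite -integral_sign//; apply/esym.
apply: (@ge0_integral_lebesgue_ae _ _ _ _ set0) => //.
- by move=> t; rewrite lee_fin mulr_ge0.
- apply: emeasurable_funM; first by apply/measurable_EFinP; exact: measurable_sign_wt.
  exact: (measurableT_comp mg (@measurable_sign_pt R)).
- by move=> t; rewrite mule_ge0// lee_fin.
move=> t _; rewrite -EFinM; congr (_ * _)%:E.
by rewrite /g /sign_pt /thead/=; case: ifPn => _; rewrite ?ltr01// ltr0N1.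
Qed.

(** [Omega] asks for some point of T on the ray; in a cone the point at radius 1 then belongs to T
    as well. *)
Lemma angular_integral2 m (T : set (euclid R m.+2)) (G : euclid R m.+2 -> R) : cone T ->
  angular_integral T G =
  \int[lebesgue R m.+1]_a (@angle_wt R m.+2 a * (G \_ T) (@polar1 R m.+2 a))%:E.
Proof.
move=> cT; rewrite /angular_integral/= integral_mkcond.
apply: eq_integral => a _; rewrite !patchE /angle_wt indicE.
have -> : (a \in @Omega R m.+2 T) = (a \in (@angles R m.+2 : set (cube m.+1))) &&
   (@polar1 R m.+2 a \in (T : set (cube m.+2))).
  apply/idP/andP; rewrite !inE.
    move=> [aa [rho rho0]]; rewrite polarE => Tr; split => //.
    rewrite -[@polar1 R m.+2 a]dilate1 -(@mulVf _ rho) ?gt_eqF// -dilateM.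
    by apply: cT => //; rewrite invr_gt0.
  by move=> [aa Ta]; split => //; exists 1%R.
case: (a \in _); last by rewrite mul0r mul0r.
by rewrite andTb mul1r; case: ifPn => _; rewrite ?mulr0// mulrC.
Qed.

Theorem integral_homogeneous d (T : set (euclid R d)) (G y : euclid R d -> R)
    (E : R) (h : R -> R) : (0 < d)%N ->
  measurable T -> cone T -> measurable_fun T G -> measurable_fun T y ->
  (forall t, T t -> 0 <= G t)%R ->
  (forall (c : R) t, 0 < c -> T t -> G (dilate c t) = c ^- d * G t)%R ->
  (forall (c : R) t, 0 < c -> T t -> G t != 0 -> y (dilate c t) = y t + E * ln c)%R ->
  E != 0%R -> measurable_fun setT h -> (forall x, 0 <= h x)%R ->
  \int[lebesgue R d]_(t in T) (G t * h (y t))%:E =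
  (`|E|^-1)%:E * (\int[mu]_x (h x)%:E) * angular_integral T G.
Proof.
case: d T G y => [|[|m]] T G y // _ mT cT mG my G0 homG homy E0 mh h0.
  rewrite angular_integral1//.
  exact: (homogeneous_integral (d := 1) isT (@polar_rep_sign R)).
rewrite angular_integral2//.
exact: (homogeneous_integral (d := m.+2) isT (@polar_rep_polar1 R m)).
Qed.

End AngularIntegral.

(** * Beta integrals *)

Section Beta.
Context (R : realType).
Notation mu := (@lebesgue_measure R).
Local Notation RR := (measurableTypeR R).
Implicit Types a b s t : R.

Lemma is_derive_powR a s : 0 < s -> is_derive s 1 (fun x => x `^ a) (a * s `^ (a - 1)).
Proof.
move=> s0; have sI : s \in `]0, +oo[ by rewrite in_itv/= s0.
by apply: DeriveDef; [exact: derivable_powR|rewrite -derive1E powR_derive1].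
Qed.

Lemma continuous_powR_gt0 a s : 0 < s -> {for s, continuous (fun x => x `^ a)}.
Proof.
move=> s0; have := is_derive_powR a s0 => ?.
by apply/differentiable_continuous/derivable1_diffP.
Qed.

(** The substitution y = s^a on the open interval copes with the singularity at 0 when a < 1. *)
Lemma integral_powR a t : 0 < a -> 0 < t ->
  (\int[mu]_(s in `]0%R, t[) (a * s `^ (a - 1))%:E = (t `^ a)%:E)%E.
Proof.
move=> a0 t0.
have FD : (fun x => x `^ a) @` `]0, t[ = `]0, t `^ a[%classic.
  apply/seteqP; split => [_ [x /= x0 <-]|x] /=; rewrite in_itv/=.
    move: x0; rewrite in_itv/= => /andP[x0 xt]; rewrite powR_gt0//=.
    by rewrite gt0_ltr_powR ?nnegrE ?ltW.
  move=> /andP[x0 xt]; exists (x `^ a^-1).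
    rewrite in_itv/= powR_gt0//=.
    have -> : t = (t `^ a) `^ a^-1 by rewrite -powRrM mulfV ?gt_eqF// powRr1// ltW.
    by rewrite gt0_ltr_powR ?invr_gt0 ?nnegrE ?powR_ge0 ?ltW.
  by rewrite -powRrM mulVf ?gt_eqF// powRr1// ltW.
transitivity (\int[mu]_(y in (fun x : R => x `^ a)%R @` `]0%R, t[) (cst 1 y))%E.
  have h1 (s : R) : `]0, t[%classic s -> 0 < s by rewrite /= in_itv/= => /andP[].
  transitivity (\int[mu]_(s in `]0%R, t[) ((a * s `^ (a - 1))%:E * (cst 1 (s `^ a)%R)))%E.
    by apply: eq_integral => s _; rewrite mule1.
  apply/esym; apply: (@ge0_substitution_gt0 R (fun x => x `^ a) (fun s => a * s `^ (a - 1))) => //.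
  - exact: exhausted_oo.
  - by move=> s /h1 s0; exact: is_derive_powR.
  - move=> s /h1 s0; apply: cvgM; first exact: cvg_cst.
    exact: continuous_powR_gt0.
  - by move=> s /h1 s0; rewrite mulr_gt0// powR_gt0.
rewrite FD integral_cst//= lebesgue_measure_itv/= lte_fin powR_gt0//.
by rewrite -EFinB subr0 mul1e.
Qed.

Lemma ge0_integral_onem t (h : R -> \bar R) :
  measurable_fun setT h -> (forall x, 0 <= h x)%E ->
  (\int[mu]_(x in `]t, 1%R[) h x = \int[mu]_(x in `]0%R, (1 - t)%R[) h (1 - x)%R)%E.
Proof.
move=> mh h0; have [t1|t1] := ltP t 1; last first.
  rewrite !set_itv_ge ?integral_set0// bnd_simp -leNgt//.
  by rewrite subr_le0.
have FD : (fun x => 1 - x) @` `]0, (1 - t)[ = `]t, 1[%classic.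
  apply/seteqP; split => [_ [x /= x0 <-]|x] /=; rewrite in_itv/=.
    by move: x0; rewrite in_itv/= => /andP[x0 xt]; apply/andP; split; lra.
  move=> /andP[x0 x1]; exists (1 - x); rewrite ?in_itv/=; last by lra.
  by apply/andP; split; lra.
transitivity (\int[mu]_(x in `]0%R, (1 - t)%R[) (1%:E * h (1 - x)%R))%E; last first.
  by apply: eq_integral => x _; rewrite mul1e.
rewrite -FD; apply: (@ge0_substitution_lt0 R (fun x => 1 - x) (cst 1)) => //.
- by apply: exhausted_oo; rewrite subr_gt0.
- move=> x _; have := is_deriveD (is_derive_cst (1 : R) x (1 : R)) (is_deriveN (is_derive_id x (1:R))).
  by rewrite add0r.
- by move=> x _; exact: cst_continuous.
Qed.

Lemma integral_onem_powR b s : 0 < b -> s < 1 ->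
  (\int[mu]_(t in `]s, 1%R[) (b * (1 - t) `^ (b - 1))%:E = ((1 - s) `^ b)%:E)%E.
Proof.
move=> b0 s1; have s1' : 0 < 1 - s by rewrite subr_gt0.
apply: (etrans _ (integral_powR b0 s1')).
rewrite ge0_integral_onem; last 2 first.
- apply/measurable_EFinP; apply: measurable_funM => //.
  apply: (measurableT_comp (f := fun y : R => y `^ (b - 1)) (measurable_powR _)).
  exact: measurable_funB.
- by move=> x; rewrite lee_fin mulr_ge0 ?powR_ge0// ltW.
by apply: eq_integral => x _; rewrite opprB addrC subrK.
Qed.

(** An extended-real version of [beta]: splitting and exchanging integrals are available before
    finiteness is known. *)
Definition betaE a b : \bar R :=
  (\int[mu]_(s in `]0%R, 1%R[) (s `^ (a - 1) * (1 - s) `^ (b - 1))%:E)%E.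

Let mb a b : measurable_fun setT (fun s : RR => s `^ (a - 1) * (1 - s) `^ (b - 1)).
Proof.
apply: measurable_funM; first exact: measurable_powR.
apply: (measurableT_comp (f := fun y : R => y `^ (b - 1)) (measurable_powR _)).
exact: measurable_funB.
Qed.

Let b0 a b s : 0 <= s `^ (a - 1) * (1 - s) `^ (b - 1).
Proof. by rewrite mulr_ge0 ?powR_ge0. Qed.

Lemma betaE_ge0 a b : (0 <= betaE a b)%E.
Proof. by apply: integral_ge0 => s _; rewrite lee_fin. Qed.

(** Multiply the integrand by 1 = s + (1 - s). *)
Lemma betaE_split a b : 0 < a -> 0 < b ->
  betaE a b = (betaE (a + 1) b + betaE a (b + 1))%E.
Proof.
move=> a0 b_gt0; rewrite /betaE -ge0_integralD//; last 4 first.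
- by move=> s _; rewrite lee_fin.
- by apply/measurable_EFinP; apply: measurable_funTS.
- by move=> s _; rewrite lee_fin.
- by apply/measurable_EFinP; apply: measurable_funTS.
apply: eq_integral => s; rewrite inE/= in_itv/= => /andP[s0 s1].
have s1' : 0 < 1 - s by rewrite subr_gt0.
rewrite -EFinD !addrK; congr EFin.
rewrite -[X in _ = X * _ + _](mulr_powRB1 (ltW s0) a0).
rewrite -[X in _ = _ + _ * X](mulr_powRB1 (ltW s1') b_gt0).
by ring.
Qed.

Lemma betaE_Sr_lty a b : 0 < a -> 0 < b -> (betaE a (b + 1) < +oo)%E.
Proof.
move=> a0 b_gt0.
have h : (a%:E * betaE a (b + 1) <= 1%:E)%E.
  have I1 := integral_powR a0 ltr01; rewrite powR1 in I1; rewrite -I1.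
  rewrite /betaE -ge0_integralZl_EFin//; last 3 first.
  - by move=> s _; rewrite lee_fin.
  - by apply/measurable_EFinP; apply: measurable_funTS.
  - exact: ltW.
  apply: ge0_le_integral => //.
  - by move=> s _; rewrite -EFinM lee_fin mulr_ge0// ltW.
  - by apply/measurable_EFinP; apply: measurable_funTS; apply: measurable_funM.
  - by apply/measurable_EFinP; apply: measurable_funTS; apply: measurable_funM => //; exact: measurable_powR.
  - move=> s; rewrite /= in_itv/= => /andP[s0 s1].
    rewrite -EFinM lee_fin ler_wpM2l// ?(ltW a0)// addrK.
    rewrite -[leRHS]mulr1 ler_wpM2l ?powR_ge0//.
    have b1 : (1 : R) `^ b = 1 by rewrite powR1.
    rewrite -[leRHS]b1; apply: ge0_ler_powR.
    - exact: ltW.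
    - by rewrite nnegrE subr_ge0; exact: ltW.
    - by rewrite nnegrE.
    - by rewrite lerBlDr lerDl ltW.
rewrite -(@lte_pmul2l _ a%:E)// ?lte_fin// (le_lt_trans h)//.
by rewrite gt0_muley ?lte_fin// ltry.
Qed.

Lemma betaE_sym a b : betaE a b = betaE b a.
Proof.
rewrite /betaE.
pose h s : \bar R := (s `^ (a - 1) * (1 - s) `^ (b - 1))%:E.
rewrite (@ge0_integral_onem 0 h); last 2 first.
- by apply/measurable_EFinP; exact: mb.
- by move=> s; rewrite lee_fin.
rewrite subr0; apply: eq_integral => s _; rewrite /h subKr mulrC //.
Qed.

Lemma betaE_lty a b : 0 < a -> 0 < b -> (betaE a b < +oo)%E.
Proof.
move=> a0 b_gt0; rewrite betaE_split// lte_add_pinfty//; last exact: betaE_Sr_lty.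
by rewrite betaE_sym; exact: betaE_Sr_lty.
Qed.

(** In place of integration by parts with its boundary terms, a s^(a-1) b (1-t)^(b-1) is integrated
    over the triangle 0 < s < t < 1, once in each order. *)
Lemma betaE_rec a b : 0 < a -> 0 < b ->
  (a%:E * betaE a (b + 1) = b%:E * betaE (a + 1) b)%E.
Proof.
move=> a0 b_gt0.
pose f (z : RR * RR) : \bar R := (if z.1 < z.2 then
  (a * z.1 `^ (a - 1)) * (b * (1 - z.2) `^ (b - 1)) else 0)%:E.
have f0 z : (0 <= f z)%E.
  rewrite lee_fin; case: ifPn => // _.
  by rewrite !mulr_ge0 ?powR_ge0 ?ltW.
have mpa : measurable_fun setT (fun s : R => a * s `^ (a - 1)).
  by apply: measurable_funM => //; exact: measurable_powR.
have mpb : measurable_fun setT (fun s : R => b * (1 - s) `^ (b - 1)).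
  apply: measurable_funM => //.
  apply: (measurableT_comp (f := fun y : R => y `^ (b - 1)) (measurable_powR _)).
  exact: measurable_funB.
have mf : measurable_fun setT f.
  apply/measurable_EFinP; apply: measurable_fun_if => //.
  - by apply: measurable_fun_ltr; [exact: measurable_fst|exact: measurable_snd].
  - apply: measurable_funTS; apply: measurable_funM.
      exact: (measurableT_comp mpa measurable_fst).
    exact: (measurableT_comp mpb measurable_snd).
have := @fubini_tonelli_on _ _ RR RR R mu mu `]0, 1[%classic `]0, 1[%classic f
  (measurable_itv _) (measurable_itv _) mf (fun x y _ _ => f0 (x, y)).
congr (_ = _).
- rewrite /betaE -ge0_integralZl_EFin//; last 3 first.
  - by move=> s _; rewrite lee_fin.
  - by apply/measurable_EFinP; apply: measurable_funTS.
  - exact: ltW.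
  apply: eq_integral => s; rewrite inE/= in_itv/= => /andP[s0 s1].
  transitivity (\int[mu]_(t in `]s, 1%R[) ((a * s `^ (a - 1))%:E * (b * (1 - t) `^ (b - 1))%:E))%E.
    rewrite [LHS]integral_mkcond [RHS]integral_mkcond; apply: eq_integral => t _.
    rewrite !patchE /f/= !mem_setE !in_itv/=.
    case: (ltP s t) => st; last by rewrite andFb; case: ifPn.
    by rewrite (lt_trans s0 st)/=; case: ifPn => // _; rewrite EFinM.
  rewrite ge0_integralZl_EFin//; last 3 first.
  - by move=> t _; rewrite lee_fin mulr_ge0 ?powR_ge0// ltW.
  - by apply/measurable_EFinP; apply: measurable_funTS.
  - by rewrite mulr_ge0 ?powR_ge0// ltW.
  by rewrite integral_onem_powR// -!EFinM addrK mulrA.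
- rewrite /betaE -ge0_integralZl_EFin//; last 3 first.
  - by move=> s _; rewrite lee_fin.
  - by apply/measurable_EFinP; apply: measurable_funTS.
  - exact: ltW.
  apply: eq_integral => t; rewrite inE/= in_itv/= => /andP[t0 t1].
  transitivity (\int[mu]_(s in `]0%R, t[) ((b * (1 - t) `^ (b - 1))%:E * (a * s `^ (a - 1))%:E))%E.
    rewrite [LHS]integral_mkcond [RHS]integral_mkcond; apply: eq_integral => s _.
    rewrite !patchE /f/= !mem_setE !in_itv/=.
    case: (ltP s t) => st; last by rewrite andbF; case: ifPn.
    by rewrite (lt_trans st t1) andbT; case: ifPn => // _; rewrite -EFinM mulrC.
  rewrite ge0_integralZl_EFin//; last 3 first.
  - by move=> s _; rewrite lee_fin mulr_ge0 ?powR_ge0// ltW.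
  - by apply/measurable_EFinP; apply: measurable_funTS.
  - by rewrite mulr_ge0 ?powR_ge0// ltW.
  by rewrite integral_powR// -!EFinM addrK -mulrA [X in b * X]mulrC.
Qed.

Lemma EFin_beta a b : 0 < a -> 0 < b -> ((beta a b)%:E = betaE a b)%E.
Proof.
by move=> a0 b_gt0; rewrite /beta /Rintegral fineK// ge0_fin_numE ?betaE_lty ?betaE_ge0.
Qed.

Lemma beta_ge0 a b : 0 <= beta a b.
Proof. by apply: fine_ge0; exact: betaE_ge0. Qed.

Lemma beta_split a b : 0 < a -> 0 < b -> beta a b = beta (a + 1) b + beta a (b + 1).
Proof.
move=> a0 b_gt0.
have a1 : 0 < a + 1 by rewrite addr_gt0.
have b1 : 0 < b + 1 by rewrite addr_gt0.
apply: EFin_inj; apply: (etrans (EFin_beta a0 b_gt0)).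
apply: (etrans (betaE_split a0 b_gt0)); apply: esym.
exact: (congr2 adde (EFin_beta a1 b_gt0) (EFin_beta a0 b1)).
Qed.

Lemma beta_rec a b : 0 < a -> 0 < b -> a * beta a (b + 1) = b * beta (a + 1) b.
Proof.
move=> a0 b_gt0.
have a1 : 0 < a + 1 by rewrite addr_gt0.
have b1 : 0 < b + 1 by rewrite addr_gt0.
apply: EFin_inj; apply: (etrans (congr1 (mule a%:E) (EFin_beta a0 b1))).
apply: (etrans (betaE_rec a0 b_gt0)).
exact: (congr1 (mule b%:E) (esym (EFin_beta a1 b_gt0))).
Qed.

(** The splitting and the recurrence form a linear system for the two shifted beta values. *)
Lemma betaSl a b : 0 < a -> 0 < b -> beta (a + 1) b = a / (a + b) * beta a b.
Proof.
move=> a0 b_gt0; have ab : a + b != 0 by rewrite gt_eqF// addr_gt0.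
have solve (x y z : R) : x = y + z -> a * z = b * y -> y = a / (a + b) * x.
  by move=> -> h; apply: (mulfI ab); rewrite mulrA mulrCA mulfV// mulr1 mulrDr h; ring.
exact: solve (beta_split a0 b_gt0) (beta_rec a0 b_gt0).
Qed.

Lemma betaSr a b : 0 < a -> 0 < b -> beta a (b + 1) = b / (a + b) * beta a b.
Proof.
move=> a0 b_gt0; have ab : a + b != 0 by rewrite gt_eqF// addr_gt0.
have solve (x y z : R) : x = y + z -> a * z = b * y -> z = b / (a + b) * x.
  by move=> -> h; apply: (mulfI ab); rewrite mulrA mulrCA mulfV// mulr1 mulrDr -h; ring.
exact: solve (beta_split a0 b_gt0) (beta_rec a0 b_gt0).
Qed.

End Beta.

(** * The equation for s and its inverse *)

Definition sigma (R : realType) (A B s : R) := A * ln (1 - s) - B * ln s.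

Lemma sigma_onem (R : realType) (A B s : R) : sigma A B (1 - s) = - sigma B A s.
Proof. by rewrite /sigma subKr opprB. Qed.

Lemma sigma_large (R : realType) (A B y : R) : 0 <= A -> 0 < B ->
  exists2 s, 0 < s <= 2^-1 & y <= sigma A B s.
Proof.
(* The witness is exp(-K). The first bound on K keeps it below 1/2, so A ln(1-s) costs at most A ln
   2; the second makes B K pay for that and for y. *)
move=> A0 B0; pose K := Num.max (ln 2) ((y + A * ln 2) / B).
have K2 : ln 2 <= K by rewrite /K le_max lexx.
have Ky : y + A * ln 2 <= B * K.
  by rewrite [leRHS]mulrC -ler_pdivrMr// /K le_max lexx orbT.
have s2 : expR (- K) <= 2^-1.
  by rewrite expRN lef_pV2 ?posrE ?expR_gt0// -[leLHS]lnK ?posrE// ler_expR.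
exists (expR (- K)); first by rewrite expR_gt0.
rewrite /sigma expRK mulrN opprK.
have : - ln 2 <= ln (1 - expR (- K)).
  rewrite -lnV ?posrE// ler_ln ?posrE//; first by lra.
  by rewrite subr_gt0 (le_lt_trans s2)// invf_lt1// ltr1n.
move=> /(ler_wpM2l A0); lra.
Qed.

Section Share.
Context (R : realType) (A B : R).
Hypotheses (A0 : 0 <= A) (B0 : 0 <= B) (AB : 0 < A + B).
Notation mu := (@lebesgue_measure R).
Local Notation RR := (measurableTypeR R).

Local Notation sigma := (sigma A B).

(* The inverse of [sigma] on ]0, 1[. When A = 0 (resp. B = 0), [sigma] only takes
   positive (resp. negative) values; outside its range the default is the
   endpoint towards which [sigma] tends to 0. *)
Definition share (y : R) : R :=
  xget (if A == 0 then 1 else 0) [set s | 0 < s < 1 /\ sigma s = y].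

Let dsigma (s : R) := A / (1 - s) + B / s.

Let dsigma_gt0 (s : R) : 0 < s < 1 -> 0 < dsigma s.
Proof.
move=> /andP[s0 s1]; have s1' : 0 < 1 - s by rewrite subr_gt0.
have [A_gt0|] := ltP 0 A.
  by rewrite ltr_wpDr// ?divr_gt0// divr_ge0// ltW.
move=> A_le0; have A_0 : A = 0 by apply/eqP; rewrite eq_le A0 A_le0.
rewrite /dsigma A_0 mul0r add0r divr_gt0//.
by move: AB; rewrite A_0 add0r.
Qed.

Let is_derive_sigma (s : R) : 0 < s < 1 -> is_derive s 1 sigma (- dsigma s).
Proof.
move=> /andP[s0 s1]; have s1' : 0 < 1 - s by rewrite subr_gt0.
have d1 : is_derive s 1 (fun x : R => 1 - x) (-1).
  have := is_deriveD (is_derive_cst (1 : R) s (1 : R)) (is_deriveN (is_derive_id s (1:R))).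
  by rewrite add0r.
have dl : is_derive s 1 (fun x : R => ln (1 - x)) (- (1 - s)^-1).
  have := @is_derive1_comp R (@ln R) (fun x : R => 1 - x) s _ _ (is_derive1_ln s1') d1.
  by rewrite mulrN1.
have := is_deriveB (is_deriveZ A dl) (is_deriveZ B (is_derive1_ln s0)).
move=> /is_derive_eq; apply; rewrite /GRing.scale/= /dsigma; ring.
Qed.

Let sigma_lt (s t : R) : 0 < s -> s < t -> t < 1 -> sigma t < sigma s.
Proof.
move=> s0 st t1.
have H (x : R) : x \in `[s, t] -> 0 < x < 1.
  by rewrite in_itv/= => /andP[sx xt]; rewrite (lt_le_trans s0)//= (le_lt_trans xt).
have dx (x : R) : x \in `]s, t[ -> is_derive x 1 sigma (- dsigma x).
  by move=> /subset_itv_oo_cc/H; exact: is_derive_sigma.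
have := @ltr0_derive1_lt_cc R sigma s t; apply => //.
- by move=> x /dx.
- move=> x xst; have xst' := H x (subset_itv_oo_cc xst).
  by have := dx _ xst => dxx; rewrite derive1E derive_val oppr_lt0 dsigma_gt0.
- apply: continuous_in_subspaceT => x; rewrite inE => /H /is_derive_sigma ?.
  exact/differentiable_continuous/derivable1_diffP.
- by rewrite in_itv/= lexx ltW.
- by rewrite in_itv/= lexx ltW.
Qed.

Let sigma_inj (s t : R) : 0 < s < 1 -> 0 < t < 1 -> sigma s = sigma t -> s = t.
Proof.
move=> /andP[s0 s1] /andP[t0 t1] st; have [lt|lt|//] := ltgtP s t.
- by have := sigma_lt s0 lt t1; rewrite st ltxx.
- by have := sigma_lt t0 lt s1; rewrite st ltxx.
Qed.

Lemma shareK (s : R) : 0 < s < 1 -> share (sigma s) = s.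
Proof.
move=> s01; rewrite /share; case: xgetP => [x _ [x01 xs]|/(_ s)]; first exact: sigma_inj.
by move=> /not_andP[].
Qed.

Lemma shareP y : (exists2 s, 0 < s < 1 & sigma s = y /\ share y = s) \/
  (forall s, 0 < s < 1 -> sigma s <> y) /\ share y = if A == 0 then 1 else 0.
Proof.
rewrite /share; case: xgetP => [x _ [x01 xs]|h]; first by left; exists x.
by right; split=> // s s01 sy; apply: (h s).
Qed.

Lemma share_itv y : 0 <= share y <= 1.
Proof.
have [[s /andP[s0 s1] [_ ->]]|[_ ->]] := shareP y; first by rewrite !ltW.
by case: ifPn; rewrite lexx ler01.
Qed.

Lemma sigma_gt0 (s : R) : A = 0 -> 0 < s < 1 -> 0 < sigma s.
Proof.
move=> A_0 /andP[s0 s1]; rewrite /sigma A_0 mul0r sub0r -mulrN mulr_gt0//; first by move: AB; rewrite A_0 add0r.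
by rewrite oppr_gt0 ln_lt0// s0.
Qed.

Lemma sigma_lt0 (s : R) : B = 0 -> 0 < s < 1 -> sigma s < 0.
Proof.
move=> B_0 /andP[s0 s1]; rewrite /sigma B_0 mul0r subr0 pmulr_rlt0; last by move: AB; rewrite B_0 addr0.
by rewrite ln_lt0//; apply/andP; split; lra.
Qed.

(** When A or B vanishes, one logarithm remains and is inverted explicitly on its half-line.
    Otherwise [sigma] runs from +oo near 0 to -oo near 1 and the intermediate value theorem
    applies. *)
Lemma sigma_surj y : (0 < A \/ 0 < y) -> (0 < B \/ y < 0) ->
  exists2 s, 0 < s < 1 & sigma s = y.
Proof.
move=> hA hB.
have [A_0|A_0] := eqVneq A 0.
  have y0 : 0 < y by case: hA => //; rewrite A_0 ltxx.
  have B_gt0 : 0 < B by move: AB; rewrite A_0 add0r.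
  exists (expR (- (y / B))).
    by rewrite expR_gt0 -expR0 ltr_expR oppr_lt0 divr_gt0.
  by rewrite /sigma A_0 mul0r sub0r expRK mulrN opprK mulrC divfK// gt_eqF.
have [B_0|B_0] := eqVneq B 0.
  have y0 : y < 0 by case: hB => //; rewrite B_0 ltxx.
  have A_gt0 : 0 < A by move: AB; rewrite B_0 addr0.
  exists (1 - expR (y / A)).
    rewrite subr_gt0 ltrBlDr ltrDl expR_gt0 andbT -expR0 ltr_expR.
    by rewrite pmulr_llt0// invr_gt0.
  by rewrite /sigma B_0 mul0r subr0 subKr expRK mulrC divfK// gt_eqF.
have A_gt0 : 0 < A by rewrite lt_neqAle eq_sym A_0.
have B_gt0 : 0 < B by rewrite lt_neqAle eq_sym B_0.
have [s /andP[s0 s2] ys] := sigma_large y (ltW A_gt0) B_gt0.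
have [t /andP[t0 t2] yt] := sigma_large (- y) (ltW B_gt0) A_gt0.
have ty : sigma (1 - t) <= y by rewrite sigma_onem lerNl.
have st : s <= 1 - t by lra.
have H (x : R) : x \in `[s, 1 - t] -> 0 < x < 1.
  by rewrite in_itv/= => /andP[sx xt]; apply/andP; split; lra.
have [x xst xy] : exists2 x, x \in `[s, 1 - t] & sigma x = y.
  apply: IVT => //.
    apply: continuous_in_subspaceT => x; rewrite inE => /H /is_derive_sigma ?.
    exact/differentiable_continuous/derivable1_diffP.
  by rewrite ge_min ty orbT le_max ys.
by exists x => //; exact: H.
Qed.

(** Monotonicity on the whole line is the route to measurability; the default values continue the
    inverse of [sigma] monotonically beyond its range. *)
Lemma share_nonincreasing (x y : R) : x <= y -> share y <= share x.
Proof.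
move=> xy.
have [[s s01 [sx ->]]|[Nx ->]] := shareP x; have [[t t01 [ty ->]]|[Ny ->]] := shareP y.
- rewrite leNgt; apply/negP => st.
  have /andP[s0 _] := s01; have /andP[_ t1] := t01.
  by have := sigma_lt s0 st t1; rewrite sx ty ltNge xy.
- case: ifPn => [/eqP A_0|]; last by move: s01 => /andP[/ltW].
  exfalso; have := sigma_gt0 A_0 s01; rewrite sx => x0.
  have B_gt0 : 0 < B by move: AB; rewrite A_0 add0r.
  have [||u u01 uy] := @sigma_surj y; [by right; exact: lt_le_trans xy|by left|].
  exact: (Ny u).
- case: ifPn => [/eqP A_0|A_0]; first by move: t01 => /andP[_ /ltW].
  exfalso; have A_gt0 : 0 < A by rewrite lt_neqAle eq_sym A_0.
  have [B_0|B_0] := eqVneq B 0.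
    have := sigma_lt0 B_0 t01; rewrite ty => y0.
    have [||u u01 uy] := @sigma_surj x; [by left|by right; exact: le_lt_trans y0|].
    exact: (Nx u).
  have B_gt0 : 0 < B by rewrite lt_neqAle eq_sym B_0.
  have [||u u01 uy] := @sigma_surj x; [by left|by left|].
  exact: (Nx u).
- by [].
Qed.

Lemma measurable_share : measurable_fun setT share.
Proof. by apply: nonincreasing_measurable => // x y; exact: share_nonincreasing. Qed.

(** Outside the range of [sigma], [share] takes its default value, where phi vanishes; on the range
    this is the substitution y = sigma s. *)
Lemma integral_share (phi : R -> R) : measurable_fun setT phi ->
  (forall s, 0 <= phi s) -> phi (if A == 0 then 1 else 0) = 0 ->
  (\int[mu]_y (phi (share y))%:E =
   \int[mu]_(s in `]0%R, 1%R[) ((A / (1 - s) + B / s) * phi s)%:E)%E.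
Proof.
move=> mphi phi0 phiN.
pose D : set R := `]0, 1[%classic.
have D01 (s : R) : D s -> 0 < s < 1 by rewrite /D/= in_itv.
transitivity (\int[mu]_(y in sigma @` D) (phi (share y))%:E)%E.
  rewrite [RHS]integral_mkcond; apply: eq_integral => y _; rewrite patchE.
  case: ifPn => // /negP yN; have [[s s01 [sy _]]|[_ ->]] := shareP y; last by rewrite phiN.
  by exfalso; apply: yN; rewrite inE; exists s => //; rewrite /D/= in_itv.
transitivity (\int[mu]_(s in D) ((dsigma s)%:E * (phi (share (sigma s)))%:E))%E.
  apply: (@ge0_substitution_lt0 R sigma dsigma D (fun y => (phi (share y))%:E)).
  - exact: exhausted_oo.
  - by move=> s /D01; exact: is_derive_sigma.
  - move=> s /D01/andP[s0 s1]; apply: cvgD; apply: cvgM; try exact: cvg_cst.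
      apply: cvgV; first by rewrite gt_eqF// subr_gt0.
      by apply: cvgB; [exact: cvg_cst|exact: cvg_id].
    by apply: cvgV; [rewrite gt_eqF|exact: cvg_id].
  - by move=> s /D01; exact: dsigma_gt0.
  - by apply/measurable_EFinP; exact: (measurableT_comp mphi measurable_share).
  - by move=> y; rewrite lee_fin.
by apply: eq_integral => s; rewrite inE => /D01 s01; rewrite shareK.
Qed.

End Share.

(** * The integrals over y as beta integrals *)

Section Profile.
Context (R : realType) (p q r g : R).
Hypotheses (q1 : 1 <= q) (qp : q <= p) (qr : q <= r) (qpr : q < p \/ q < r).
Hypothesis g01 : 0 < g < 1.
Notation mu := (@lebesgue_measure R).
Local Notation RR := (measurableTypeR R).
Let A := p - q.
Let B := r - q.
Let tq := (q^-1 - g / p - (1 - g) / r)^-1.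
Let la := tq * g / p.
Let ka := tq * (1 - g) / r.

Let q0 : 0 < q. Proof. by rewrite (lt_le_trans ltr01). Qed.
Let p0 : 0 < p. Proof. exact: lt_le_trans qp. Qed.
Let r0 : 0 < r. Proof. exact: lt_le_trans qr. Qed.
Let g0 : 0 < g. Proof. by case/andP: g01. Qed.
Let g1 : 0 < 1 - g. Proof. by rewrite subr_gt0; case/andP: g01. Qed.
Let A0 : 0 <= A. Proof. by rewrite subr_ge0. Qed.
Let B0 : 0 <= B. Proof. by rewrite subr_ge0. Qed.
Let AB : 0 < A + B.
Proof.
have := A0; have := B0; rewrite /A /B => hB hA.
by case: qpr => h; [apply: ltr_pwDl|apply: ltr_wpDl]; rewrite ?subr_gt0.
Qed.

Lemma inv_tqE : q^-1 - g / p - (1 - g) / r = (g * (p - q) / p + (1 - g) * (r - q) / r) / q.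
Proof. by field; rewrite !gt_eqF. Qed.

Lemma tq_gt0 : 0 < tq.
Proof.
rewrite invr_gt0 inv_tqE divr_gt0//.
have h1 : 0 <= g * (p - q) / p by rewrite divr_ge0 ?(ltW p0)// mulr_ge0 ?(ltW g0).
have h2 : 0 <= (1 - g) * (r - q) / r by rewrite divr_ge0 ?(ltW r0)// mulr_ge0 ?(ltW g1).
case: qpr => h.
  by rewrite ltr_pwDl// divr_gt0// mulr_gt0// subr_gt0.
by rewrite ltr_wpDl// divr_gt0// mulr_gt0// subr_gt0.
Qed.

Lemma tq_neq0 : tq != 0. Proof. by rewrite gt_eqF// tq_gt0. Qed.

Lemma la_gt0 : 0 < la. Proof. by rewrite divr_gt0// mulr_gt0// tq_gt0. Qed.
Lemma ka_gt0 : 0 < ka. Proof. by rewrite divr_gt0// mulr_gt0// tq_gt0. Qed.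

Lemma tq_sum : g / p + (1 - g) / r + tq^-1 = q^-1.
Proof. by rewrite invrK; ring. Qed.

Lemma exponents_sum : la + ka + 1 = tq / q.
Proof.
rewrite -tq_sum mulrDr mulfV ?tq_neq0// /la /ka; ring.
Qed.

(** This relation recovers u: weighting the equations for (p-q) ln u and (r-q) ln u by la and ka
    gives q ln u. *)
Lemma exponents_weighted_sum : A * la + B * ka = q.
Proof.
have h : A * (g / p) + B * ((1 - g) / r) = q / tq.
  rewrite /tq invrK /A /B; field; by rewrite !gt_eqF.
rewrite /la /ka -!mulrA (mulrCA A) (mulrCA B) -mulrDr h mulrCA mulfV ?mulr1//.
exact: tq_neq0.
Qed.

Definition profile (s : R) := s `^ la * (1 - s) `^ ka.

Lemma profile_ge0 s : 0 <= profile s.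
Proof. by rewrite mulr_ge0 ?powR_ge0. Qed.

Lemma measurable_profile : measurable_fun setT profile.
Proof.
apply: measurable_funM; first exact: measurable_powR.
apply: (measurableT_comp (f := fun y : R => y `^ ka) (measurable_powR _)).
exact: measurable_funB.
Qed.

(** The integral of [profile] composed with [share] over the line, as the case c1 = c2 = 1 of the
    next lemma shows. *)
Definition profile_const := q / (la + ka) * beta la ka.

(** Substituting s produces the beta integrals at (la+2, ka), (la+1, ka+1) and (la, ka+2), all
    multiples of the one at (la, ka). In the sum, the coefficients of c1 and c2 are proportional to
    la (A (la+1) + B ka) = la p and ka (A la + B (ka+1)) = ka r, which stand in the ratio of g to
    1-g. *)
Lemma integral_profile (c1 c2 : R) : 0 <= c1 -> 0 <= c2 ->
  (\int[mu]_y (profile (share A B y) *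
     (c1 * share A B y + c2 * (1 - share A B y)))%:E =
   ((c1 * g + c2 * (1 - g)) * profile_const)%:E)%E.
Proof.
move=> c10 c20.
(* The absolute values make phi nonnegative outside [0, 1] too; [share] never leaves [0, 1]. *)
pose phi s := profile s * (c1 * `|s| + c2 * `|1 - s|).
have phi0 s : 0 <= phi s by rewrite mulr_ge0 ?profile_ge0// addr_ge0 ?mulr_ge0.
have mphi : measurable_fun setT phi.
  apply: measurable_funM; first exact: measurable_profile.
  have mn : measurable_fun [set: R] (fun s : R => `|s|) by exact: normr_measurable.
  apply: measurable_funD; apply: measurable_funM => //.
  apply: (measurableT_comp mn); exact: measurable_funB.
transitivity (\int[mu]_y (phi (share A B y))%:E)%E.
  apply: eq_integral => y _; have /andP[s0 s1] := share_itv A B y.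
  by rewrite /phi !ger0_norm// subr_ge0.
rewrite integral_share//; last first.
  rewrite /phi /profile; case: ifPn => _; rewrite ?subrr ?subr0 powR0 ?gt_eqF ?la_gt0 ?ka_gt0//.
    by rewrite mulr0 mul0r.
  by rewrite !mul0r.
have la0 := la_gt0; have ka0 := ka_gt0.
have mf (a b c : R) : measurable_fun (`]0, 1[%classic : set RR)
    (fun s : RR => (c * (s `^ (a - 1) * (1 - s) `^ (b - 1)))%:E).
  apply: measurable_funTS; apply/measurable_EFinP.
  apply: measurable_funM => //; apply: measurable_funM; first exact: measurable_powR.
  apply: (measurableT_comp (f := fun y : R => y `^ (b - 1)) (measurable_powR _)).
  exact: measurable_funB.
have fge0 (a b c : R) : 0 <= c -> forall s : R, 
    (0 <= (c * (s `^ (a - 1) * (1 - s) `^ (b - 1)))%:E)%E.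
  by move=> c0 s; rewrite lee_fin !mulr_ge0 ?powR_ge0.
have bE (a b c : R) : 0 < a -> 0 < b -> 0 <= c ->
    (\int[mu]_(s in `]0%R, 1%R[) (c * (s `^ (a - 1) * (1 - s) `^ (b - 1)))%:E =
     (c * beta a b)%:E)%E.
  move=> a0 b0 c0; apply: (etrans _ (congr1 (mule c%:E) (esym (EFin_beta a0 b0)))).
  rewrite /betaE -ge0_integralZl_EFin//.
  - by move=> s _; rewrite lee_fin mulr_ge0 ?powR_ge0.
  - have := mf a b 1; congr (measurable_fun _ _).
    by apply/funext => s; rewrite mul1r.
transitivity (\int[mu]_(s in `]0%R, 1%R[)
   ((c1 * A * (s `^ (la + 1 + 1 - 1) * (1 - s) `^ (ka - 1)))%:E +
   ((c1 * B + c2 * A) * (s `^ (la + 1 - 1) * (1 - s) `^ (ka + 1 - 1)))%:E +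
   (c2 * B * (s `^ (la - 1) * (1 - s) `^ (ka + 1 + 1 - 1)))%:E))%E.
  apply: eq_integral => s; rewrite inE/= in_itv/= => /andP[s0 s1].
  have s1' : 0 < 1 - s by rewrite subr_gt0.
  rewrite -!EFinD; congr EFin; rewrite /phi /profile !gtr0_norm// !addrK.
  have sl : s * s `^ (la - 1) = s `^ la by rewrite mulr_powRB1// ltW.
  have sl1 : s * s `^ la = s `^ (la + 1).
    by have := @mulr_powRB1 _ s (la + 1) (ltW s0); rewrite addrK; apply; exact: addr_gt0.
  have tl : (1 - s) * (1 - s) `^ (ka - 1) = (1 - s) `^ ka by rewrite mulr_powRB1// ltW.
  have tl1 : (1 - s) * (1 - s) `^ ka = (1 - s) `^ (ka + 1).
    by have := @mulr_powRB1 _ (1 - s) (ka + 1) (ltW s1'); rewrite addrK; apply; exact: addr_gt0.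
  rewrite -sl1 -tl1 -sl -tl; field.
  by rewrite !gt_eqF.
have cA : 0 <= c1 * A by rewrite mulr_ge0.
have cB : 0 <= c2 * B by rewrite mulr_ge0.
have cAB : 0 <= c1 * B + c2 * A by rewrite addr_ge0// mulr_ge0.
have l1 : la + 1 > 0 by exact: addr_gt0.
have k1 : ka + 1 > 0 by exact: addr_gt0.
have mf2 := emeasurable_funD (mf (la + 1 + 1) ka (c1 * A)) (mf (la + 1) (ka + 1) (c1 * B + c2 * A)).
have f20 (s : R) : (`]0, 1[%classic : set RR) s -> (0 <=
    (c1 * A * (s `^ (la + 1 + 1 - 1) * (1 - s) `^ (ka - 1)))%:E +
    ((c1 * B + c2 * A) * (s `^ (la + 1 - 1) * (1 - s) `^ (ka + 1 - 1)))%:E)%E.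
  by move=> _; apply: adde_ge0; exact: fge0.
apply: (etrans (ge0_integralD mu _ f20 mf2 (fun s _ => fge0 _ _ _ cB s) (mf _ _ _))).
  exact: measurable_itv.
have b3 := bE la (ka + 1 + 1) (c2 * B) la0 (addr_gt0 k1 ltr01) cB.
have b2 := bE (la + 1) (ka + 1) (c1 * B + c2 * A) l1 k1 cAB.
have b1 := bE (la + 1 + 1) ka (c1 * A) (addr_gt0 l1 ltr01) ka0 cA.
apply: (etrans (congr2 adde (ge0_integralD mu _ (fun s _ => fge0 _ _ _ cA s) (mf _ _ _)
  (fun s _ => fge0 _ _ _ cAB s) (mf _ _ _)) b3)).
  exact: measurable_itv.
apply: (etrans (congr1 (adde^~ _) (congr2 adde b1 b2))).
apply: (congr1 EFin).
rewrite (betaSl l1 ka0) (betaSr la0 k1) (betaSl la0 k1) (betaSl la0 ka0) (betaSr la0 ka0).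
rewrite /profile_const; move: (beta la ka) => be.
have lk : la + ka != 0 by rewrite gt_eqF// addr_gt0.
have lk1 : la + ka + 1 != 0 by rewrite gt_eqF// !addr_gt0.
have lp : la * p = q * (la + ka + 1) * g.
  by rewrite exponents_sum /la; field; rewrite !gt_eqF.
have kr : ka * r = q * (la + ka + 1) * (1 - g).
  by rewrite exponents_sum /ka; field; rewrite !gt_eqF.
have Ap : A * (la + 1) + B * ka = p.
  by rewrite mulrDr mulr1 addrAC exponents_weighted_sum /A; ring.
have Br : A * la + B * (ka + 1) = r.
  by rewrite mulrDr mulr1 addrA exponents_weighted_sum /B; ring.
transitivity ((c1 * (la * (A * (la + 1) + B * ka)) + c2 * (ka * (A * la + B * (ka + 1)))) /
    ((la + ka + 1) * (la + ka)) * be).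
  have lk1' : la + 1 + ka != 0 by rewrite addrAC.
  have lk2' : la + (ka + 1) != 0 by rewrite addrA.
  by field; rewrite ?lk ?lk1 ?lk1' ?lk2'.
rewrite Ap Br lp kr; field.
by rewrite ?lk ?lk1.
Qed.

End Profile.

(** * The extremal function at a point *)

Section Pointwise.
Context (R : realType).

(** Young's inequality with exponents p/q and p/(p-q); for p = q the second degenerates and the
    claim is an equality. *)
Lemma young_powR (p q u v : R) : 0 < q -> q <= p -> 0 <= u -> 0 <= v ->
  u `^ (p - q) * v `^ q <= q / p * v `^ p + (1 - q / p) * u `^ p.
Proof.
move=> q0 qp u0 v0; have p0 : 0 < p by exact: lt_le_trans qp.
have [->|pq] := eqVneq p q.
  by rewrite subrr powRr0 divff ?gt_eqF// subrr mul0r addr0.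
have pq0 : 0 < p - q by rewrite subr_gt0 lt_neqAle eq_sym pq.
have := @conjugate_powR R (v `^ q) (u `^ (p - q)) (p / q) (p / (p - q))
   (powR_ge0 _ _) (powR_ge0 _ _).
rewrite !divr_gt0// => /(_ isT isT); rewrite -!powRrM.
rewrite (_ : q * (p / q) = p); last by field; rewrite gt_eqF.
rewrite (_ : (p - q) * (p / (p - q)) = p); last by field; rewrite gt_eqF.
rewrite !invf_div => h; rewrite mulrC; apply: le_trans (h _) _.
  by field; rewrite gt_eqF.
rewrite [leLHS](_ : _ = q / p * v `^ p + (1 - q / p) * u `^ p)//.
by field; rewrite gt_eqF.
Qed.

Variables (p q r g : R).
Hypotheses (q1 : 1 <= q) (qp : q <= p) (qr : q <= r) (qpr : q < p \/ q < r).
Hypothesis g01 : 0 < g < 1.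
Let A := p - q.
Let B := r - q.
Let tq := (q^-1 - g / p - (1 - g) / r)^-1.
Let la := tq * g / p.
Let ka := tq * (1 - g) / r.

Let q0 : 0 < q. Proof. by rewrite (lt_le_trans ltr01). Qed.
Let p0 : 0 < p. Proof. exact: lt_le_trans qp. Qed.
Let r0 : 0 < r. Proof. exact: lt_le_trans qr. Qed.
Let A0 : 0 <= A. Proof. by rewrite subr_ge0. Qed.
Let B0 : 0 <= B. Proof. by rewrite subr_ge0. Qed.
Let AB : 0 < A + B.
Proof.
have := A0; have := B0; rewrite /A /B => hB hA.
by case: qpr => h; [apply: ltr_pwDl|apply: ltr_wpDl]; rewrite ?subr_gt0.
Qed.

(* [logratio], [Hweight], [extremal_density] and [extremal_fun] are the y, H, Z and u
   of the introduction, at a point where |w| = a, |w0| = b and sum_j |w_j|^r = S. *)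
Definition logratio (a b S : R) :=
  B * (q * ln a - p * ln b) + A * (ln S - q * ln a).

Definition Hweight (a b S : R) := a `^ tq / (b `^ (tq * g) * S `^ ka).

Definition extremal_density (a b S : R) :=
  profile p q r g (share A B (logratio a b S)) * Hweight a b S.

Definition extremal_fun (a b S : R) := extremal_density a b S `^ q^-1 / a.

Lemma Hweight_ge0 a b S : 0 <= Hweight a b S.
Proof. by apply: divr_ge0; [exact: powR_ge0|apply: mulr_ge0; exact: powR_ge0]. Qed.

Lemma Hweight_gt0 a b S : 0 < a -> 0 < b -> 0 < S -> 0 < Hweight a b S.
Proof.
by move=> a0 b0 S0; apply: divr_gt0; [exact: powR_gt0|apply: mulr_gt0; exact: powR_gt0].
Qed.

Lemma extremal_density_ge0 a b S : 0 <= extremal_density a b S.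
Proof. by apply: mulr_ge0; [exact: profile_ge0|exact: Hweight_ge0]. Qed.

Let profile_end (x : R) : x = (if A == 0 then 1 else 0) -> profile p q r g x = 0.
Proof.
have := la_gt0 q1 qp qr qpr g01; have := ka_gt0 q1 qp qr qpr g01.
rewrite -/tq -/la -/ka => ka0 la0 ->.
rewrite /profile; case: ifPn => _; rewrite ?subrr ?subr0 powR0 ?gt_eqF ?mulr0 ?mul0r//.
Qed.

Section point.
Variables a b S : R.
Hypotheses (a0 : 0 < a) (b0 : 0 < b) (S0 : 0 < S).
Let s := share A B (logratio a b S).
Let Z := extremal_density a b S.
Let u := extremal_fun a b S.

(** If y is outside the range of [sigma], then p = q or r = q, and [share] is an endpoint at which
    [profile] vanishes. The sign of y recorded here replaces the equation for s. *)
Let cases : (0 < s < 1 /\ sigma A B s = logratio a b S) \/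
  Z = 0 /\ [\/ A = 0 /\ logratio a b S <= 0 | B = 0 /\ 0 <= logratio a b S].
Proof.
rewrite /Z /extremal_density /s; have [[x x01 [xy ->]]|[no sE]] := shareP A B (logratio a b S); [by left|right].
split; first by rewrite profile_end ?mul0r.
have [A_0|A_0] := eqVneq A 0.
  left; split=> //; rewrite leNgt; apply/negP => y0.
  have [||x x01 xy] := @sigma_surj _ A B A0 B0 AB (logratio a b S); [by right| |].
    by left; move: AB; rewrite A_0 add0r.
  exact: (no x).
have A_gt0 : 0 < A by rewrite lt_neqAle eq_sym A_0.
have [B_0|B_0] := eqVneq B 0.
  right; split=> //; rewrite leNgt; apply/negP => y0.
  have [||x x01 xy] := @sigma_surj _ A B A0 B0 AB (logratio a b S); [by left|by right|].
  exact: (no x).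
exfalso.
have [||x x01 xy] := @sigma_surj _ A B A0 B0 AB (logratio a b S); [by left| |].
  by left; rewrite lt_neqAle eq_sym B_0.
exact: (no x).
Qed.

Lemma extremal_fun_ge0_point : 0 <= u.
Proof. by apply: divr_ge0; [exact: powR_ge0|exact: ltW]. Qed.

Lemma extremal_q : a `^ q * u `^ q = Z.
Proof.
rewrite -powRM ?extremal_fun_ge0_point ?ltW// /u /extremal_fun mulrCA divff ?gt_eqF// mulr1.
by rewrite -powRrM mulVf ?gt_eqF// powRr1// extremal_density_ge0.
Qed.

Let logs : 0 < s < 1 -> sigma A B s = logratio a b S ->
  [/\ 0 < Z, 0 < u, p * ln b + p * ln u = ln s + ln Z &
      ln S + r * ln u = ln (1 - s) + ln Z].
Proof.
move=> /andP[s0 s1]; have s1' : 0 < 1 - s by rewrite subr_gt0.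
have Z0 : 0 < Z.
  apply: mulr_gt0; last exact: Hweight_gt0.
  by apply: mulr_gt0; exact: powR_gt0.
have u0 : 0 < u by apply: divr_gt0 => //; exact: powR_gt0.
have lu : q * ln u = ln Z - q * ln a.
  rewrite /u /extremal_fun ln_div ?posrE ?powR_gt0// ln_powR mulrBr mulrA.
  by rewrite mulfV ?mul1r// gt_eqF.
have lZ : ln Z = la * ln s + ka * ln (1 - s) + tq * ln a - tq * g * ln b - ka * ln S.
  have ps x y : 0 < x -> x `^ y \is Num.pos by rewrite posrE; exact: powR_gt0.
  have bS : b `^ (tq * g) * S `^ ka \is Num.pos.
    by rewrite posrE; apply: mulr_gt0; exact: powR_gt0.
  have prof : profile p q r g s \is Num.pos.
    by rewrite posrE; apply: mulr_gt0; exact: powR_gt0.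
  rewrite /Z /extremal_density -/s lnM//; last by rewrite posrE; exact: Hweight_gt0.
  rewrite /profile -/tq -/la -/ka lnM ?ps// /Hweight ln_div ?ps// lnM ?ps// !ln_powR.
  by ring.
rewrite /sigma /logratio => ys.
(* X1 and X2 are the values that the equations for u impose on A ln u and B ln u; the equation for s
   is their compatibility A X2 = B X1. *)
pose X1 := ln s + q * ln a - p * ln b; pose X2 := ln (1 - s) + q * ln a - ln S.
have X12 : A * X2 = B * X1 by rewrite /X1 /X2; lra.
have sum : g / p + (1 - g) / r + tq^-1 = q^-1 := tq_sum p q r g.
have tqn : tq != 0 := tq_neq0 q1 qp qr qpr g01.
have qn : q != 0 by rewrite gt_eqF.
have H1 : la * p = tq * g by rewrite /la divfK// gt_eqF.
have H2 : tq = q * la + q * ka + q.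
  have h : la + ka + 1 = tq / q := exponents_sum q1 qp qr qpr g01.
  by rewrite -[LHS](divfK qn) -h; ring.
have luX : q * ln u = la * X1 + ka * X2.
  have E1 : tq * ln a = (q * la + q * ka + q) * ln a by rewrite -H2.
  by rewrite lu lZ /X1 /X2 E1 -H1; ring.
have AlBk : A * la + B * ka = q := exponents_weighted_sum q1 qp qr qpr g01.
have h1 : A * ln u = X1.
  apply: (mulfI qn); rewrite mulrCA luX -[in RHS]AlBk mulrDr (mulrCA A ka) X12; ring.
have h2 : B * ln u = X2.
  apply: (mulfI qn); rewrite mulrCA luX -[in RHS]AlBk mulrDr (mulrCA B la) -X12; ring.
have lZ' : ln Z = q * ln u + q * ln a by rewrite lu; ring.
split=> //.
  have -> : p * ln u = A * ln u + q * ln u by rewrite /A; ring.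
  by rewrite h1 lZ' /X1; ring.
have -> : r * ln u = B * ln u + q * ln u by rewrite /B; ring.
by rewrite h2 lZ' /X2; ring.
Qed.

Lemma extremal_p : b `^ p * u `^ p = s * Z.
Proof.
case: cases => [[s01 ys]|[Z0 _]]; last first.
  by rewrite Z0 mulr0 /u /extremal_fun -/Z Z0 powR0 ?invr_neq0 ?gt_eqF// mul0r powR0 ?mulr0 ?gt_eqF.
have [Z0 u0 lp _] := logs s01 ys; have /andP[s0 _] := s01.
apply: ln_inj; rewrite ?posrE; [apply: mulr_gt0; exact: powR_gt0|exact: mulr_gt0|].
by rewrite lnM ?posrE ?powR_gt0// !ln_powR lp -lnM ?posrE.
Qed.

Lemma extremal_r : S * u `^ r = (1 - s) * Z.
Proof.
case: cases => [[s01 ys]|[Z0 _]]; last first.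
  by rewrite Z0 mulr0 /u /extremal_fun -/Z Z0 powR0 ?invr_neq0 ?gt_eqF// mul0r powR0 ?mulr0 ?gt_eqF.
have [Z0 u0 _ lr] := logs s01 ys; have /andP[_ s1] := s01.
have s1' : 0 < 1 - s by rewrite subr_gt0.
apply: ln_inj; rewrite ?posrE; [by apply: mulr_gt0 => //; exact: powR_gt0|exact: mulr_gt0|].
by rewrite lnM ?posrE ?powR_gt0// !ln_powR lr -lnM ?posrE.
Qed.

(** Splitting a^q = s a^q + (1-s) a^q = b^p u^(p-q) + S u^(r-q), Young's inequality bounds each
    part, with equality at v = u. Where the equation for s has no solution, the sign of y says a <=
    b (if p = q) or a^q <= S (if r = q), and one term on the right is enough. *)
Lemma pointwise_le v : 0 <= v ->
  a `^ q * v `^ q <= q / p * (b `^ p * v `^ p) + q / r * (S * v `^ r) +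
    Z * ((1 - q / p) * s + (1 - q / r) * (1 - s)).
Proof.
move=> v0.
have vp := powR_ge0 v p; have vr := powR_ge0 v r; have vq := powR_ge0 v q.
case: cases => [[s01 ys]|[Z0 out]].
  have [Z0 u0 _ _] := logs s01 ys; have /andP[s0 s1] := s01.
  have s1' : 0 < 1 - s by rewrite subr_gt0.
  have uq : u `^ q != 0 by rewrite gt_eqF// powR_gt0.
  have sa : s * a `^ q = b `^ p * u `^ A.
    apply: (mulIf uq); rewrite -!mulrA -powRD ?(gt_eqF u0) ?implybT// subrK extremal_q.
    by rewrite extremal_p.
  have ta : (1 - s) * a `^ q = S * u `^ B.
    apply: (mulIf uq); rewrite -!mulrA -powRD ?(gt_eqF u0) ?implybT// subrK extremal_q.
    by rewrite extremal_r.
  have -> : a `^ q * v `^ q = b `^ p * (u `^ A * v `^ q) + S * (u `^ B * v `^ q).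
    by rewrite !mulrA -sa -ta; ring.
  have := ler_wpM2l (powR_ge0 b p) (young_powR q0 qp (ltW u0) v0).
  have := ler_wpM2l (ltW S0) (young_powR q0 qr (ltW u0) v0).
  have := extremal_p; have := extremal_r; rewrite -/A -/B.
  move=> hr hp h1 h2; apply: (le_trans (lerD h2 h1)).
  rewrite [leRHS](_ : _ = q / p * (b `^ p * v `^ p) + q / r * (S * v `^ r) +
    ((1 - q / p) * (s * Z) + (1 - q / r) * ((1 - s) * Z))); last by ring.
  by rewrite -hp -hr [leLHS](_ : _ = q / p * (b `^ p * v `^ p) + q / r * (S * v `^ r) +
    ((1 - q / p) * (b `^ p * u `^ p) + (1 - q / r) * (S * u `^ r)))//; ring.
rewrite Z0 mul0r addr0; case: out => -[].
  move=> A_0; have pq : p = q by move: A_0 => /eqP; rewrite subr_eq0 => /eqP.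
  have B_gt0 : 0 < B by move: AB; rewrite A_0 add0r.
  rewrite /logratio A_0 mul0r addr0 pmulr_rle0// subr_le0 pq => h.
  rewrite divff ?gt_eqF// mul1r.
  apply: (@le_trans _ _ (b `^ q * v `^ q)).
    by apply: ler_wpM2r => //; rewrite -ler_ln ?posrE ?powR_gt0// !ln_powR.
  by rewrite lerDl; apply: mulr_ge0; [rewrite divr_ge0 ?ltW|rewrite mulr_ge0// ltW].
move=> B_0; have rq : r = q by move: B_0 => /eqP; rewrite subr_eq0 => /eqP.
have A_gt0 : 0 < A by move: AB; rewrite B_0 addr0.
rewrite /logratio B_0 mul0r add0r pmulr_rge0// subr_ge0 rq => h.
rewrite (divff (_ : q != 0)) ?gt_eqF// mul1r.
apply: (@le_trans _ _ (S * v `^ q)).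
  by apply: ler_wpM2r => //; rewrite -ler_ln ?posrE ?powR_gt0// ln_powR.
rewrite lerDr; apply: mulr_ge0; first by rewrite divr_ge0 ?ltW.
by rewrite mulr_ge0// powR_ge0.
Qed.

End point.
End Pointwise.

(** * Optimising over rescalings of the weights *)

Section Optimization.
Context (R : realType) (p q r g : R).
Hypotheses (q1 : 1 <= q) (qp : q <= p) (qr : q <= r) (qpr : q < p \/ q < r).
Hypothesis g01 : 0 < g < 1.
Let tq := (q^-1 - g / p - (1 - g) / r)^-1.
Let la := tq * g / p.
Let ka := tq * (1 - g) / r.
Let q0 : 0 < q. Proof. by rewrite (lt_le_trans ltr01). Qed.
Let p0 : 0 < p. Proof. exact: lt_le_trans qp. Qed.
Let r0 : 0 < r. Proof. exact: lt_le_trans qr. Qed.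
Let g0 : 0 < g. Proof. by case/andP: g01. Qed.
Let g1 : 0 < 1 - g. Proof. by rewrite subr_gt0; case/andP: g01. Qed.

(** The geometric mean of al X / g, be Y / (1-g) and al^(-la) be^(-ka) Z with weights q g / p, q
    (1-g) / r and q / tq, which sum to 1. The powers of al and be cancel. *)
Definition optimal_value (X Y Z : R) :=
  g `^ (- (q * g / p)) * (1 - g) `^ (- (q * (1 - g) / r)) * Z `^ (q / tq) *
  X `^ (q * g / p) * Y `^ (q * (1 - g) / r).

(** Arithmetic and geometric means coincide when the averaged quantities are equal, necessarily to
    the optimal value V; so al X = g V and be Y = (1-g) V. *)
Lemma optimal_value_attained (X Y Z : R) : 0 < X -> 0 < Y -> 0 < Z ->
  exists al be, [/\ 0 < al, 0 < be &
  q / p * (al * X) + q / r * (be * Y) + al `^ (- la) * be `^ (- ka) * (q / tq * Z) =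
  optimal_value X Y Z].
Proof.
move=> X0 Y0 Z0.
have V0 : 0 < optimal_value X Y Z by rewrite /optimal_value; do !apply: mulr_gt0; exact: powR_gt0.
set V := optimal_value X Y Z; rewrite -/V in V0.
have al0 : 0 < g * V / X by rewrite divr_gt0// mulr_gt0.
have be0 : 0 < (1 - g) * V / Y by rewrite divr_gt0// mulr_gt0.
exists (g * V / X), ((1 - g) * V / Y); split=> //.
have tqn : tq != 0 := tq_neq0 q1 qp qr qpr g01.
have lk1 : la + ka + 1 = tq / q := exponents_sum q1 qp qr qpr g01.
have sum : g / p + (1 - g) / r + tq^-1 = q^-1 := tq_sum p q r g.
have pos (x : R) : 0 < x -> x \is Num.pos by rewrite posrE.
have lV : (la + ka + 1) * ln V = ln Z - la * ln g - ka * ln (1 - g) + la * ln X + ka * ln Y.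
  rewrite lk1 /V /optimal_value lnM ?pos ?powR_gt0//; last first.
    by do !apply: mulr_gt0; exact: powR_gt0.
  rewrite lnM ?pos ?powR_gt0//; last by do !apply: mulr_gt0; exact: powR_gt0.
  rewrite lnM ?pos ?powR_gt0//; last by do !apply: mulr_gt0; exact: powR_gt0.
  rewrite lnM ?pos ?powR_gt0// !ln_powR /la /ka; field.
  by rewrite tqn !gt_eqF.
clearbody V.
have lal : ln (g * V / X) = ln g + ln V - ln X.
  by rewrite ln_div ?pos ?mulr_gt0// lnM ?pos.
have lbe : ln ((1 - g) * V / Y) = ln (1 - g) + ln V - ln Y.
  by rewrite ln_div ?posrE ?mulr_gt0// lnM ?posrE.
have -> : (g * V / X) `^ (- la) * ((1 - g) * V / Y) `^ (- ka) * (q / tq * Z) = q / tq * V.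
  rewrite mulrCA; congr (_ * _).
  move: al0 be0 lal lbe; set al := g * V / X; set be := (1 - g) * V / Y => al0 be0 lal lbe.
  have pa : 0 < al `^ (- la) by exact: powR_gt0.
  have pb : 0 < be `^ (- ka) by exact: powR_gt0.
  apply: ln_inj; rewrite ?posrE//; first by do !apply: mulr_gt0.
  rewrite lnM ?pos ?mulr_gt0// lnM ?pos// !ln_powR lal lbe.
  by move: lV; lra.
rewrite !divfK ?gt_eqF//.
have -> : q / p * (g * V) + q / r * ((1 - g) * V) + q / tq * V =
  q * (g / p + (1 - g) / r + tq^-1) * V by ring.
by rewrite sum mulfV ?gt_eqF// mul1r.
Qed.

Lemma powR_right_cvg (x a : R) : 0 <= x -> 0 < a -> (x + e) `^ a @[e --> 0^'+] --> x `^ a.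
Proof.
rewrite le_eqVlt => /predU1P[<-|x0] a0.
  rewrite powR0 ?gt_eqF//; under eq_fun do rewrite add0r.
  exact: powR_cvg0.
have c : {for x, continuous (fun y => y `^ a)} by exact: continuous_powR_gt0.
apply: (@cvg_comp _ _ _ (fun e => x + e) (fun y => y `^ a) _ (nbhs x)); last exact: c.
apply: cvg_at_right_filter.
have : x + e @[e --> 0] --> x + 0 by apply: cvgD; [exact: cvg_cst|exact: cvg_id].
by rewrite addr0.
Qed.

(** If one of X, Y, Z vanishes, the formulas for the optimal scalings break down. All three are
    raised by e > 0, and e tends to 0; the exponents of X, Y, Z are positive, hence continuity at
    0. *)
Lemma le_optimal_value (X Y Z W : R) : 0 <= X -> 0 <= Y -> 0 <= Z ->
  (forall al be, 0 < al -> 0 < be -> W <= q / p * (al * X) + q / r * (be * Y) +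
     al `^ (- la) * be `^ (- ka) * (q / tq * Z)) ->
  W <= optimal_value X Y Z.
Proof.
move=> X0 Y0 Z0 WXYZ.
have tq0 : 0 < tq := tq_gt0 q1 qp qr qpr g01.
have C : optimal_value (X + e) (Y + e) (Z + e) @[e --> 0^'+] --> optimal_value X Y Z.
  by apply: cvgM; [apply: cvgM; [apply: cvgM; [exact: cvg_cst|]|]|];
    apply: powR_right_cvg; rewrite ?divr_gt0 ?mulr_gt0.
apply: (cvgr_to_ge C); near=> e.
have e0 : 0 < e by near: e; exact: nbhs_right_gt.
have [al [be [al0 be0 <-]]] := optimal_value_attained
  (ltr_wpDl X0 e0) (ltr_wpDl Y0 e0) (ltr_wpDl Z0 e0).
apply: (le_trans (WXYZ al be al0 be0)).
have a1 := powR_ge0 al (- la); have b1 := powR_ge0 be (- ka).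
have q_tq : 0 <= q / tq by rewrite divr_ge0// ltW.
apply: lerD; first apply: lerD.
- rewrite ler_wpM2l ?divr_ge0 ?(ltW q0) ?(ltW p0)// ler_wpM2l ?(ltW al0)//.
  by rewrite lerDl ltW.
- rewrite ler_wpM2l ?divr_ge0 ?(ltW q0) ?(ltW r0)// ler_wpM2l ?(ltW be0)//.
  by rewrite lerDl ltW.
- rewrite ler_wpM2l ?mulr_ge0// ler_wpM2l//.
  by rewrite lerDl ltW.
Unshelve. all: by end_near. Qed.

End Optimization.

(** * The sharp inequality for homogeneous weights *)

Section RealIntegrals.
Context d (X : measurableType d) (R : realType) (mu : {measure set X -> \bar R}).
Local Notation RR := (measurableTypeR R).
Variables (D : set X) (mD : measurable D).
Implicit Types f : X -> R.

Lemma measurable_fun_scale f (c : R) : measurable_fun D (f : _ -> RR) ->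
  measurable_fun D (fun t => c * f t : RR).
Proof. by move=> mf; apply: measurable_funM; [exact: measurable_cst|exact: mf]. Qed.

Lemma ge0_integral_realZl f (c : R) : measurable_fun D (f : _ -> RR) ->
  (forall t, 0 <= f t) -> 0 <= c ->
  (\int[mu]_(t in D) (c * f t)%:E = c%:E * \int[mu]_(t in D) (f t)%:E)%E.
Proof.
move=> mf f0 c0; under eq_integral do rewrite EFinM.
apply: (@ge0_integralZl_EFin _ X R mu D mD) => //.
- by move=> t _; rewrite lee_fin.
- by apply/measurable_EFinP.
Qed.

Lemma ge0_integral_realD f1 f2 : measurable_fun D (f1 : _ -> RR) ->
  measurable_fun D (f2 : _ -> RR) -> (forall t, 0 <= f1 t) -> (forall t, 0 <= f2 t) ->
  (\int[mu]_(t in D) (f1 t + f2 t)%:E =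
   \int[mu]_(t in D) (f1 t)%:E + \int[mu]_(t in D) (f2 t)%:E)%E.
Proof.
move=> mf1 mf2 f10 f20; under eq_integral do rewrite EFinD.
apply: (@ge0_integralD _ X R mu D mD).
- by move=> t _; rewrite lee_fin.
- by apply/measurable_EFinP.
- by move=> t _; rewrite lee_fin.
- by apply/measurable_EFinP.
Qed.

Lemma ge0_integral_real_sum (J : Type) (s : seq J) (f : J -> X -> R) :
  (forall j, measurable_fun D (f j : _ -> RR)) -> (forall j t, 0 <= f j t) ->
  (\int[mu]_(t in D) (\sum_(j <- s) f j t)%:E =
   \sum_(j <- s) \int[mu]_(t in D) (f j t)%:E)%E.
Proof.
move=> mf f0; under eq_integral do rewrite -sumEFin.
apply: (@ge0_integral_sum _ X R mu D mD).
- by move=> j; apply/measurable_EFinP; exact: mf.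
- by move=> j t _; rewrite lee_fin.
Qed.

Lemma ae_ge0_le_integral_real f1 f2 : measurable_fun D (f1 : _ -> RR) ->
  measurable_fun D (f2 : _ -> RR) -> (forall t, 0 <= f1 t) -> (forall t, 0 <= f2 t) ->
  {ae mu, forall t, D t -> f1 t <= f2 t} ->
  (\int[mu]_(t in D) (f1 t)%:E <= \int[mu]_(t in D) (f2 t)%:E)%E.
Proof.
move=> mf1 mf2 f10 f20 f12; apply: (@ae_ge0_le_integral _ X R mu D mD).
- by move=> t _; rewrite lee_fin.
- by apply/measurable_EFinP.
- by move=> t _; rewrite lee_fin.
- by apply/measurable_EFinP.
- exact: f12.
Qed.

Lemma ge0_ae_eq_integral_real f1 f2 : measurable_fun D (f1 : _ -> RR) ->
  measurable_fun D (f2 : _ -> RR) -> (forall t, 0 <= f1 t) -> (forall t, 0 <= f2 t) ->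
  {ae mu, forall t, D t -> f1 t = f2 t} ->
  (\int[mu]_(t in D) (f1 t)%:E = \int[mu]_(t in D) (f2 t)%:E)%E.
Proof.
move=> mf1 mf2 f10 f20 f12; apply: (@ge0_ae_eq_integral _ X R mu D).
- exact: mD.
- by apply/measurable_EFinP.
- by apply/measurable_EFinP.
- by move=> t _; rewrite lee_fin.
- by move=> t _; rewrite lee_fin.
- by apply: filterS f12 => t ft Dt; rewrite ft.
Qed.

End RealIntegrals.

Section HomogeneousWeights.
Context (R : realType) (d : nat).
Variables (p q r g theta theta0 theta1 : R).
Hypotheses (q1 : 1 <= q) (qp : q <= p) (qr : q <= r) (qpr : q < p \/ q < r).
Hypothesis g01 : 0 < g < 1.
Hypothesis d_gt0 : (0 < d)%N.
Let A := p - q.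
Let B := r - q.
Let tq := (q^-1 - g / p - (1 - g) / r)^-1.
Let la := tq * g / p.
Let ka := tq * (1 - g) / r.
Let q0 : 0 < q. Proof. by rewrite (lt_le_trans ltr01). Qed.
Let p0 : 0 < p. Proof. exact: lt_le_trans qp. Qed.
Let r0 : 0 < r. Proof. exact: lt_le_trans qr. Qed.
Let A0 : 0 <= A. Proof. by rewrite subr_ge0. Qed.
Let B0 : 0 <= B. Proof. by rewrite subr_ge0. Qed.
Let AB : 0 < A + B.
Proof.
have := A0; have := B0; rewrite /A /B => hB hA.
by case: qpr => h; [apply: ltr_pwDl|apply: ltr_wpDl]; rewrite ?subr_gt0.
Qed.

Local Notation leb := (lebesgue R d).
Local Notation RR := (measurableTypeR R).

(** The slope of [logratio] as a function of ln rho along a ray. *)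
Definition drift := B * (q * theta - p * theta0) + A * (r * theta1 - q * theta).

(** Besides lying in ]0, 1[, g enters here only through these two conditions: y varies along rays,
    and [Hweight] has degree -d. Both are later derived from the definition of g~. *)
Hypothesis drift_neq0 : drift != 0.
Hypothesis degree : tq * theta - tq * g * theta0 - ka * (r * theta1) = - d%:R.

Variable T : set (euclid R d).
Hypotheses (mT : measurable T) (cT : cone T).

Section measurability.
Variables a b S : euclid R d -> R.
Hypotheses (ma : measurable_fun T (a : _ -> RR)) (mb : measurable_fun T (b : _ -> RR))
  (mS : measurable_fun T (S : _ -> RR)).

Lemma measurable_fun_powR (f : euclid R d -> R) (x : R) :
  measurable_fun T (f : _ -> RR) -> measurable_fun T (fun t => f t `^ x : RR).
Proof. by move=> mf; exact: (measurableT_comp (measurable_powR x) mf). Qed.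

Lemma measurable_fun_ln (f : euclid R d -> R) :
  measurable_fun T (f : _ -> RR) -> measurable_fun T (fun t => ln (f t) : RR).
Proof. by move=> mf; exact: (measurableT_comp (@measurable_ln R) mf). Qed.

Lemma measurable_logratio :
  measurable_fun T (fun t => logratio p q r (a t) (b t) (S t) : RR).
Proof.
have mla := measurable_fun_ln ma; have mlb := measurable_fun_ln mb.
have mlS := measurable_fun_ln mS.
exact: (measurable_funD (measurable_fun_scale B (measurable_funB (measurable_fun_scale q mla) (measurable_fun_scale p mlb)))
  (measurable_fun_scale A (measurable_funB mlS (measurable_fun_scale q mla)))).
Qed.

Lemma measurable_Hweight :
  measurable_fun T (fun t => Hweight p q r g (a t) (b t) (S t) : RR).
Proof.
apply: measurable_funM; first exact: measurable_fun_powR.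
by apply: measurable_funV; apply: measurable_funM; exact: measurable_fun_powR.
Qed.

Lemma measurable_share_logratio :
  measurable_fun T (fun t => share A B (logratio p q r (a t) (b t) (S t)) : RR).
Proof. exact: (measurableT_comp (measurable_share A0 B0 AB) measurable_logratio). Qed.

Lemma measurable_extremal_density : measurable_fun T (fun t => extremal_density p q r g (a t) (b t) (S t) : RR).
Proof.
apply: measurable_funM; last exact: measurable_Hweight.
exact: (measurableT_comp (measurable_profile p q r g) measurable_share_logratio).
Qed.

Lemma measurable_extremal_fun : measurable_fun T (fun t => extremal_fun p q r g (a t) (b t) (S t) : RR).
Proof.
by apply: measurable_funM; [exact: measurable_fun_powR measurable_extremal_density|exact: measurable_funV].
Qed.
End measurability.

Section homogeneity.
Variables a b S : euclid R d -> R.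
Hypotheses (ma : measurable_fun T (a : _ -> RR)) (mb : measurable_fun T (b : _ -> RR))
  (mS : measurable_fun T (S : _ -> RR)).
Hypotheses (a0 : forall t, 0 <= a t) (b0 : forall t, 0 <= b t) (S0 : forall t, 0 <= S t).
Hypothesis ha : forall (c : R) t, 0 < c -> T t -> a (dilate c t) = c `^ theta * a t.
Hypothesis hb : forall (c : R) t, 0 < c -> T t -> b (dilate c t) = c `^ theta0 * b t.
Hypothesis hS : forall (c : R) t, 0 < c -> T t -> S (dilate c t) = c `^ (r * theta1) * S t.

Lemma logratio_dilate (c : R) t : 0 < c -> T t -> 0 < a t -> 0 < b t -> 0 < S t ->
  logratio p q r (a (dilate c t)) (b (dilate c t)) (S (dilate c t)) =
  logratio p q r (a t) (b t) (S t) + drift * ln c.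
Proof.
move=> c0 Tt at0 bt0 St0; rewrite ha// hb// hS// /logratio.
by rewrite !lnM ?posrE ?powR_gt0// !ln_powR /drift /A /B; ring.
Qed.

Lemma Hweight_dilate (c : R) t : 0 < c -> T t ->
  Hweight p q r g (a (dilate c t)) (b (dilate c t)) (S (dilate c t)) =
  c ^- d * Hweight p q r g (a t) (b t) (S t).
Proof.
move=> c0 Tt; rewrite ha// hb// hS// /Hweight.
rewrite (powRM _ (powR_ge0 _ _) (a0 t)) (powRM _ (powR_ge0 _ _) (b0 t)).
rewrite (powRM _ (powR_ge0 _ _) (S0 t)) -!powRrM.
have -> : c ^- d = c `^ (tq * theta) / (c `^ (tq * g * theta0) * c `^ (ka * (r * theta1))).
  have cx (x y : R) : (x + y == 0) ==> (c != 0) by rewrite (gt_eqF c0) implybT.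
  rewrite -powRD// -powRN -powRD// -powR_mulrn ?(ltW c0)// -powRN -degree.
  by congr (_ `^ _); ring.
rewrite -/tq -/ka (mulrC theta) (mulrC theta0) (mulrC (r * theta1)).
set c1 := c `^ _; set c2 := c `^ _; set c3 := c `^ _.
rewrite !invfM; ring.
Qed.

(** Stated for any G of degree -d, so that it serves both the integrand of I~ and those of the I'_j,
    and with b and S open to rescaling. *)
Lemma integral_profile_logratio (G : euclid R d -> R) (c1 c2 : R) : 0 <= c1 -> 0 <= c2 ->
  measurable_fun T (G : _ -> RR) -> (forall t, 0 <= G t) ->
  (forall (c : R) t, 0 < c -> T t -> G (dilate c t) = c ^- d * G t) ->
  (forall t, T t -> G t != 0 -> [/\ 0 < a t, 0 < b t & 0 < S t]) ->
  let s t := share A B (logratio p q r (a t) (b t) (S t)) in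
  (\int[leb]_(t in T) (profile p q r g (s t) * G t * (c1 * s t + c2 * (1 - s t)))%:E =
   (`|drift|^-1 * ((c1 * g + c2 * (1 - g)) * profile_const p q r g))%:E *
   angular_integral T G)%E.
Proof.
move=> c10 c20 mG G0 hG Gpos s.
pose h y := profile p q r g (share A B y) * (c1 * share A B y + c2 * (1 - share A B y)).
have mh : measurable_fun setT (h : RR -> RR).
  have ms := measurable_share A0 B0 AB.
  apply: measurable_funM; first exact: (measurableT_comp (measurable_profile p q r g) ms).
  apply: measurable_funD; apply: measurable_funM => //.
  exact: measurable_funB.
have h0 y : 0 <= h y.
  have /andP[s0 s1] := share_itv A B y.
  apply: mulr_ge0; first exact: profile_ge0.
  by apply: addr_ge0; apply: mulr_ge0 => //; rewrite subr_ge0.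
rewrite EFinM -(integral_profile q1 qp qr qpr g01 c10 c20).
transitivity (\int[leb]_(t in T) (G t * h (logratio p q r (a t) (b t) (S t)))%:E)%E.
  by apply: eq_integral => t _; congr EFin; rewrite /h /s; ring.
apply: (@integral_homogeneous R d T G (fun t => logratio p q r (a t) (b t) (S t))
  drift h d_gt0 mT cT mG (measurable_logratio ma mb mS) _ hG _ drift_neq0 mh h0).
  by move=> t _; exact: G0.
move=> c t c0 Tt Gt; have [at0 bt0 St0] := Gpos t Tt Gt.
exact: logratio_dilate.
Qed.


Lemma Hweight_neq0 t : Hweight p q r g (a t) (b t) (S t) != 0 ->
  [/\ 0 < a t, 0 < b t & 0 < S t].
Proof.
have tq0 : 0 < tq := tq_gt0 q1 qp qr qpr g01.
have ka0 : 0 < ka := ka_gt0 q1 qp qr qpr g01.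
have g0 : 0 < g by case/andP: g01.
move=> H0; rewrite !lt_neqAle a0 b0 S0 !andbT; split; apply: contraNneq H0 => <-;
  rewrite /Hweight powR0 ?mul0r ?mulr0 ?invr0 ?mulr0//.
- by rewrite gt_eqF.
- by rewrite gt_eqF// mulr_gt0.
- by rewrite gt_eqF.
Qed.

(** No inspection of the Jacobian is needed: with h the indicator of [0, 1], the angular integral is
    |drift| times an integral over T of a nonnegative function. *)
Lemma angular_integral_ge0 (G : euclid R d -> R) :
  measurable_fun T (G : _ -> RR) -> (forall t, 0 <= G t) ->
  (forall (c : R) t, 0 < c -> T t -> G (dilate c t) = c ^- d * G t) ->
  (forall t, T t -> G t != 0 -> [/\ 0 < a t, 0 < b t & 0 < S t]) ->
  (0 <= angular_integral T G)%E.
Proof.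
move=> mG G0 hG Gpos.
pose h : R -> R := \1_(`[0, 1]%classic : set RR).
have h0 y : 0 <= h y by rewrite /h indicE.
have mh : measurable_fun setT (h : RR -> RR) by exact: measurable_indic.
have := @integral_homogeneous R d T G (fun t => logratio p q r (a t) (b t) (S t))
  drift h d_gt0 mT cT mG (measurable_logratio ma mb mS) (fun t _ => G0 t) hG _ drift_neq0 mh h0.
have -> : (\int[@lebesgue_measure R]_x (h x)%:E = 1)%E.
  rewrite integral_indic// setIT; apply: (etrans (lebesgue_measure_itv (`[0%R, 1%R] : interval R))).
  by rewrite /= lte01 oppr0 adde0.
rewrite mule1.
have E0 : 0 < `|drift|^-1 by rewrite invr_gt0 normr_gt0.
move=> H; rewrite -(@pmule_rge0 _ `|drift|^-1%:E) ?lte_fin// -H.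
  by apply: integral_ge0 => t _; rewrite lee_fin; exact: mulr_ge0.
move=> c t c0 Tt Gt; have [at0 bt0 St0] := Gpos t Tt Gt.
exact: logratio_dilate.
Qed.


Lemma HweightZ (al be x y z : R) : 0 < al -> 0 < be -> 0 <= y -> 0 <= z ->
  Hweight p q r g x (al `^ p^-1 * y) (be * z) =
  al `^ (- la) * be `^ (- ka) * Hweight p q r g x y z.
Proof.
move=> al0 be0 y0 z0; rewrite /Hweight -/tq -/ka.
rewrite (powRM _ (powR_ge0 _ _) y0) (powRM _ (ltW be0) z0) -powRrM.
have -> : p^-1 * (tq * g) = la by rewrite /la; ring.
by rewrite !powRN !invfM; ring.
Qed.

End homogeneity.

Section extremality.
Variables a b S : euclid R d -> R.
Hypotheses (ma : measurable_fun T (a : _ -> RR)) (mb : measurable_fun T (b : _ -> RR))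
  (mS : measurable_fun T (S : _ -> RR)).
Hypotheses (a0 : forall t, 0 <= a t) (b0 : forall t, 0 <= b t) (S0 : forall t, 0 <= S t).
Hypothesis ha : forall (c : R) t, 0 < c -> T t -> a (dilate c t) = c `^ theta * a t.
Hypothesis hb : forall (c : R) t, 0 < c -> T t -> b (dilate c t) = c `^ theta0 * b t.
Hypothesis hS : forall (c : R) t, 0 < c -> T t -> S (dilate c t) = c `^ (r * theta1) * S t.

Let H t := Hweight p q r g (a t) (b t) (S t).
Let I := fine (angular_integral T H).
Hypothesis H_fin : (angular_integral T H < +oo)%E.

Let mH : measurable_fun T (H : _ -> RR). Proof. exact: measurable_Hweight. Qed.
Let H0 t : 0 <= H t. Proof. exact: Hweight_ge0. Qed.

Let H_ge0 : (0 <= angular_integral T H)%E.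
Proof.
apply: (angular_integral_ge0 ma mb mS ha hb hS mH H0); first exact: Hweight_dilate.
by move=> t _; exact: Hweight_neq0.
Qed.

Let HI : angular_integral T H = I%:E.
Proof. by rewrite /I fineK// ge0_fin_numE. Qed.

(** The number M: the q-th power of the norm of w u, with u the extremal function. *)
Definition extremal_mass := `|drift|^-1 * profile_const p q r g * I.

Lemma extremal_mass_ge0 : 0 <= extremal_mass.
Proof.
have : 0 <= I by rewrite -lee_fin -HI.
have la0 : 0 < la := la_gt0 q1 qp qr qpr g01.
have ka0 : 0 < ka := ka_gt0 q1 qp qr qpr g01.
move=> I0; apply: mulr_ge0 => //; apply: mulr_ge0; first by rewrite invr_ge0.
apply: mulr_ge0; last exact: beta_ge0.
by apply: divr_ge0; [exact: ltW|apply: addr_ge0; exact: ltW].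
Qed.

Hypothesis ae_gt0 : {ae leb, forall t, T t -> [/\ 0 < a t, 0 < b t & 0 < S t]}.

(** The pointwise bound is integrated for the weights al^(1/p) b and be S, for all al, be > 0, and
    the result is optimised. Rescaling shifts y by a constant, which does not affect the integral
    over y, and multiplies H by al^(-la) be^(-ka). *)
Lemma upper_bound (v : euclid R d -> R) (X Y : R) :
  (forall t, 0 <= v t) -> measurable_fun T (v : _ -> RR) ->
  (\int[leb]_(t in T) (b t `^ p * v t `^ p)%:E = X%:E)%E ->
  (\int[leb]_(t in T) (S t * v t `^ r)%:E = Y%:E)%E ->
  (\int[leb]_(t in T) (a t `^ q * v t `^ q)%:E <= (optimal_value p q r g X Y extremal_mass)%:E)%E.
Proof.
move=> v0 mv IX IY.
have X0 : 0 <= X.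
  rewrite -lee_fin -IX; apply: integral_ge0 => t _.
  by rewrite lee_fin; apply: mulr_ge0; exact: powR_ge0.
have Y0 : 0 <= Y.
  rewrite -lee_fin -IY; apply: integral_ge0 => t _.
  by rewrite lee_fin; apply: mulr_ge0; [exact: S0|exact: powR_ge0].
have g0 : 0 < g by case/andP: g01.
have g1 : 0 < 1 - g by rewrite subr_gt0; case/andP: g01.
(* The coefficients of the u-terms in the two Young inequalities; their mean with weights g and 1-g
   is q / tq. *)
pose c1 := 1 - q / p; pose c2 := 1 - q / r.
have c10 : 0 <= c1 by rewrite subr_ge0 ler_pdivrMr// mul1r.
have c20 : 0 <= c2 by rewrite subr_ge0 ler_pdivrMr// mul1r.
have c12 : c1 * g + c2 * (1 - g) = q / tq.
  have -> : q / tq = q * (q^-1 - g / p - (1 - g) / r) by rewrite /tq invrK.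
  by rewrite /c1 /c2; field; rewrite !gt_eqF.
set Wi := (\int[leb]_(t in T) _)%E.
have Wi0 : (0 <= Wi)%E.
  apply: integral_ge0 => t _.
  by rewrite lee_fin; apply: mulr_ge0; exact: powR_ge0.
have mle al be : 0 < al -> 0 < be -> (Wi <= (q / p * (al * X) + q / r * (be * Y) +
    al `^ (- la) * be `^ (- ka) * (q / tq * extremal_mass))%:E)%E.
  move=> al0 be0.
  pose b' t := al `^ p^-1 * b t; pose S' t := be * S t.
  have mb' : measurable_fun T (b' : _ -> RR) by apply: measurable_funM.
  have mS' : measurable_fun T (S' : _ -> RR) by apply: measurable_funM.
  have hb' (c : R) t : 0 < c -> T t -> b' (dilate c t) = c `^ theta0 * b' t.
    by move=> c0 Tt; rewrite /b' hb// mulrCA.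
  have hS' (c : R) t : 0 < c -> T t -> S' (dilate c t) = c `^ (r * theta1) * S' t.
    by move=> c0 Tt; rewrite /S' hS// mulrCA.
  pose s t := share A B (logratio p q r (a t) (b' t) (S' t)).
  pose k := al `^ (- la) * be `^ (- ka).
  have k0 : 0 <= k by apply: mulr_ge0; exact: powR_ge0.
  have b'p t : b' t `^ p = al * b t `^ p.
    rewrite /b' (powRM _ (powR_ge0 _ _) (b0 t)) -powRrM mulVf ?gt_eqF//.
    by rewrite powRr1// ltW.
  pose f1 t := b t `^ p * v t `^ p; pose f2 t := S t * v t `^ r.
  pose f3 t := profile p q r g (s t) * H t * (c1 * s t + c2 * (1 - s t)).
  have f10 t : 0 <= f1 t by apply: mulr_ge0; exact: powR_ge0.
  have f20 t : 0 <= f2 t by apply: mulr_ge0; [exact: S0|exact: powR_ge0].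
  have f30 t : 0 <= f3 t.
    have /andP[s0 s1] := share_itv A B (logratio p q r (a t) (b' t) (S' t)).
    apply: mulr_ge0; first by apply: mulr_ge0; [exact: profile_ge0|exact: H0].
    by apply: addr_ge0; apply: mulr_ge0 => //; rewrite subr_ge0.
  have mf1 : measurable_fun T (f1 : _ -> RR).
    by apply: measurable_funM; exact: measurable_fun_powR.
  have mf2 : measurable_fun T (f2 : _ -> RR).
    by apply: measurable_funM; [exact: mS|exact: measurable_fun_powR].
  have ms : measurable_fun T (s : _ -> RR) by exact: measurable_share_logratio.
  have mf3 : measurable_fun T (f3 : _ -> RR).
    apply: measurable_funM.
      by apply: measurable_funM; [exact: (measurableT_comp (measurable_profile p q r g) ms)|exact: mH].
    apply: measurable_funD; apply: measurable_funM; [exact: measurable_cst|exact: ms|exact: measurable_cst|].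
    by apply: measurable_funB; [exact: measurable_cst|exact: ms].
  have If3 : (\int[leb]_(t in T) (f3 t)%:E = (q / tq * extremal_mass)%:E)%E.
    rewrite (integral_profile_logratio ma mb' mS' ha hb' hS' c10 c20 mH H0).
    - by rewrite HI -EFinM c12 /extremal_mass; congr EFin; ring.
    - exact: Hweight_dilate.
    - move=> t _ /(Hweight_neq0 a0 b0 S0)[at0 bt0 St0]; split=> //; last exact: mulr_gt0.
      by apply: mulr_gt0 => //; exact: powR_gt0.
  have k1 : 0 <= q / p * al by rewrite mulr_ge0 ?divr_ge0 ?ltW.
  have k2 : 0 <= q / r * be by rewrite mulr_ge0 ?divr_ge0 ?ltW.
  have mf12 : measurable_fun T (fun t => q / p * al * f1 t + q / r * be * f2 t : RR).
    exact: (measurable_funD (measurable_fun_scale _ mf1) (measurable_fun_scale _ mf2)).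
  have f12_0 t : 0 <= q / p * al * f1 t + q / r * be * f2 t.
    by apply: addr_ge0; apply: mulr_ge0.
  have mkf3 : measurable_fun T (fun t => k * f3 t : RR).
    exact: measurable_fun_scale mf3.
  have kf30 t : 0 <= k * f3 t by apply: mulr_ge0.
  have mf123 : measurable_fun T (fun t => q / p * al * f1 t + q / r * be * f2 t + k * f3 t : RR).
    exact: measurable_funD.
  have f123_0 t : 0 <= q / p * al * f1 t + q / r * be * f2 t + k * f3 t.
    exact: addr_ge0.
  apply: (@le_trans _ _ (\int[leb]_(t in T)
      (q / p * al * f1 t + q / r * be * f2 t + k * f3 t)%:E)%E).
    apply: (ae_ge0_le_integral_real mT).
    - by apply: measurable_funM; exact: measurable_fun_powR.
    - exact: mf123.
    - by move=> t; apply: mulr_ge0; exact: powR_ge0.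
    - exact: f123_0.
    - apply: filterS ae_gt0 => t /[swap] Tt /(_ Tt)[at0 bt0 St0].
      have bt0' : 0 < b' t by apply: mulr_gt0 => //; exact: powR_gt0.
      have St0' : 0 < S' t by exact: mulr_gt0.
      have := pointwise_le q1 qp qr qpr g01 at0 bt0' St0' (v0 t).
      move/le_trans; apply.
      rewrite b'p /extremal_density (HweightZ _ al0 be0 (b0 t) (S0 t)) -/(H t) -/A -/B -/(s t).
      by rewrite -/c1 -/c2 -/k /f1 /f2 /f3 /S' le_eqVlt; apply/orP; left; apply/eqP; ring.
  rewrite (ge0_integral_realD leb mT mf12 mkf3 f12_0 kf30).
  rewrite (ge0_integral_realD leb mT _ _ (fun t => mulr_ge0 k1 (f10 t))
    (fun t => mulr_ge0 k2 (f20 t))); last 2 first.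
  - exact: measurable_fun_scale mf1.
  - exact: measurable_fun_scale mf2.
  rewrite (ge0_integral_realZl leb mT mf1 f10 k1) (ge0_integral_realZl leb mT mf2 f20 k2).
  rewrite (ge0_integral_realZl leb mT mf3 f30 k0) IX IY If3 -!EFinM -!EFinD lee_fin.
  by rewrite -!mulrA.
have Wfin : Wi = (fine Wi)%:E.
  rewrite fineK// ge0_fin_numE//; apply: le_lt_trans (mle 1 1 ltr01 ltr01) _.
  exact: ltry.
rewrite Wfin lee_fin; apply: le_optimal_value => //; first exact: extremal_mass_ge0.
by move=> al be al0 be0; rewrite -lee_fin -Wfin; exact: mle.
Qed.


Let u t := extremal_fun p q r g (a t) (b t) (S t).
Let s t := share A B (logratio p q r (a t) (b t) (S t)).

Lemma extremal_fun_ge0 t : 0 <= u t.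
Proof. by apply: divr_ge0; [exact: powR_ge0|exact: a0]. Qed.

Lemma integral_extremal (f G : euclid R d -> R) (c1 c2 : R) : 0 <= c1 -> 0 <= c2 ->
  measurable_fun T (f : _ -> RR) -> (forall t, 0 <= f t) ->
  measurable_fun T (G : _ -> RR) -> (forall t, 0 <= G t) ->
  (forall (c : R) t, 0 < c -> T t -> G (dilate c t) = c ^- d * G t) ->
  (forall t, T t -> G t != 0 -> [/\ 0 < a t, 0 < b t & 0 < S t]) ->
  (forall t, T t -> 0 < a t -> 0 < b t -> 0 < S t ->
     f t = profile p q r g (s t) * G t * (c1 * s t + c2 * (1 - s t))) ->
  (\int[leb]_(t in T) (f t)%:E =
   (`|drift|^-1 * ((c1 * g + c2 * (1 - g)) * profile_const p q r g))%:E *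
   angular_integral T G)%E.
Proof.
move=> c10 c20 mf f0 mG G0 hG Gpos fE.
rewrite -(integral_profile_logratio ma mb mS ha hb hS c10 c20 mG G0 hG Gpos).
have ms : measurable_fun T (s : _ -> RR) by exact: measurable_share_logratio.
apply: (ge0_ae_eq_integral_real mT mf _ f0).
- apply: measurable_funM.
    by apply: measurable_funM; [exact: (measurableT_comp (measurable_profile p q r g) ms)|exact: mG].
  apply: (measurable_funD (measurable_fun_scale c1 ms)); apply: measurable_fun_scale.
  by apply: measurable_funB; [exact: measurable_cst|exact: ms].
- move=> t; have /andP[s0 s1] := share_itv A B (logratio p q r (a t) (b t) (S t)).
  apply: mulr_ge0; first by apply: mulr_ge0; [exact: profile_ge0|exact: G0].
  by apply: addr_ge0; apply: mulr_ge0 => //; rewrite subr_ge0.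
- apply: filterS ae_gt0 => t /[swap] Tt /(_ Tt)[at0 bt0 St0].
  exact: fE.
Qed.

Let mu : measurable_fun T (u : _ -> RR).
Proof. exact: measurable_extremal_fun. Qed.

Let hH (c : R) t : 0 < c -> T t -> H (dilate c t) = c ^- d * H t.
Proof. exact: Hweight_dilate. Qed.

Let H_gt0 t : T t -> H t != 0 -> [/\ 0 < a t, 0 < b t & 0 < S t].
Proof. by move=> _; exact: Hweight_neq0. Qed.

Lemma integral_extremal_q :
  (\int[leb]_(t in T) (a t `^ q * u t `^ q)%:E = extremal_mass%:E)%E.
Proof.
pose f t := a t `^ q * u t `^ q.
have mf : measurable_fun T (f : _ -> RR) by apply: measurable_funM; exact: measurable_fun_powR.
have f0 t : 0 <= f t by apply: mulr_ge0; exact: powR_ge0.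
rewrite (integral_extremal ler01 ler01 mf f0 mH H0 hH H_gt0).
  by rewrite HI -EFinM /extremal_mass; congr EFin; ring.
move=> t _ at0 bt0 St0; rewrite /f (extremal_q p r g q1 (b t) (S t) at0).
by rewrite /extremal_density -/A -/B -/(s t) -/(H t); ring.
Qed.

Lemma integral_extremal_p :
  (\int[leb]_(t in T) (b t `^ p * u t `^ p)%:E = (g * extremal_mass)%:E)%E.
Proof.
pose f t := b t `^ p * u t `^ p.
have mf : measurable_fun T (f : _ -> RR) by apply: measurable_funM; exact: measurable_fun_powR.
have f0 t : 0 <= f t by apply: mulr_ge0; exact: powR_ge0.
rewrite (integral_extremal ler01 (lexx 0) mf f0 mH H0 hH H_gt0).
  by rewrite HI -EFinM /extremal_mass; congr EFin; ring.
move=> t _ at0 bt0 St0; rewrite /f (extremal_p q1 qp qr qpr g01 at0 bt0 St0).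
by rewrite /extremal_density -/A -/B -/(s t) -/(H t); ring.
Qed.

Lemma integral_extremal_r :
  (\int[leb]_(t in T) (S t * u t `^ r)%:E = ((1 - g) * extremal_mass)%:E)%E.
Proof.
pose f t := S t * u t `^ r.
have mf : measurable_fun T (f : _ -> RR) by apply: measurable_funM; [exact: mS|exact: measurable_fun_powR].
have f0 t : 0 <= f t by apply: mulr_ge0; [exact: S0|exact: powR_ge0].
rewrite (integral_extremal (lexx 0) ler01 mf f0 mH H0 hH H_gt0).
  by rewrite HI -EFinM /extremal_mass; congr EFin; ring.
move=> t _ at0 bt0 St0; rewrite /f (extremal_r q1 qp qr qpr g01 at0 bt0 St0).
by rewrite /extremal_density -/A -/B -/(s t) -/(H t); ring.
Qed.

(** Since S u^r = (1-s) Z, e u^r is (1-s) Z times e / S, which has degree 0. Thus H e / S again has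
    degree -d; for e = |w_j|^r its angular integral is I'_j. *)
Lemma integral_extremal_component (e : euclid R d -> R) :
  measurable_fun T (e : _ -> RR) -> (forall t, 0 <= e t) ->
  (forall (c : R) t, 0 < c -> T t -> e (dilate c t) = c `^ (r * theta1) * e t) ->
  (\int[leb]_(t in T) (e t * u t `^ r)%:E =
   (`|drift|^-1 * ((1 - g) * profile_const p q r g))%:E *
   angular_integral T (fun t => (a t `^ tq * e t) /
     (b t `^ (tq * g) * S t `^ (ka + 1)))%R)%E.
Proof.
move=> me e0 he; set G := (X in angular_integral T X).
have ka0 : 0 < ka := ka_gt0 q1 qp qr qpr g01.
have GE t : G t = H t * (e t / S t).
  rewrite /G /H /Hweight -/tq -/ka powRD; last by rewrite gt_eqF// addr_gt0.
  by rewrite powRr1// !invfM; ring.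
pose f t := e t * u t `^ r.
have mf : measurable_fun T (f : _ -> RR).
  by apply: measurable_funM; [exact: me|exact: measurable_fun_powR].
have f0 t : 0 <= f t by apply: mulr_ge0; [exact: e0|exact: powR_ge0].
have mG : measurable_fun T (G : _ -> RR).
  rewrite (_ : G = fun t => H t * (e t / S t)); last by apply/funext.
  apply: measurable_funM; first exact: mH.
  by apply: measurable_funM; [exact: me|exact: measurable_funV].
have G0 t : 0 <= G t.
  by rewrite GE; apply: mulr_ge0; [exact: H0|apply: divr_ge0; [exact: e0|exact: S0]].
have hG (c : R) t : 0 < c -> T t -> G (dilate c t) = c ^- d * G t.
  move=> c0 Tt; rewrite !GE hH// he// hS//.
  have cn : c `^ (r * theta1) != 0 by rewrite gt_eqF// powR_gt0.
  by rewrite -mulf_div divff// mul1r; exact/esym/mulrA.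
have G_gt0 t : T t -> G t != 0 -> [/\ 0 < a t, 0 < b t & 0 < S t].
  move=> Tt Gt; apply: (H_gt0 Tt); apply: contraNneq Gt => H_0.
  by rewrite GE H_0 mul0r.
rewrite (integral_extremal (lexx 0) ler01 mf f0 mG G0 hG G_gt0).
  by congr (_%:E * _)%E; ring.
move=> t _ at0 bt0 St0.
have := extremal_r q1 qp qr qpr g01 at0 bt0 St0.
rewrite /extremal_density -/A -/B -/(s t) -/(H t) -/(u t) => eS.
apply: (mulfI (lt0r_neq0 St0)); rewrite mulrCA eS GE.
by field; rewrite gt_eqF.
Qed.

End extremality.
End HomogeneousWeights.

(** * Norms of complex-valued functions *)

Section NormL.
Context (R : realType) (d : nat).
Local Notation leb := (lebesgue R d).
Local Notation RR := (measurableTypeR R).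
Implicit Types (T : set (euclid R d)) (f : euclid R d -> R[i]).

Lemma normcE (z : R[i]) : normc z = Num.sqrt (complex.Re z ^+ 2 + complex.Im z ^+ 2).
Proof. by case: z. Qed.

Lemma normc_ge0 (z : R[i]) : 0 <= normc z.
Proof. by rewrite normcE sqrtr_ge0. Qed.

Lemma normc_real (k : R) : 0 <= k -> normc (k%:C)%C = k.
Proof. by move=> k0; rewrite normcE/= expr0n addr0 sqrtr_sqr ger0_norm. Qed.

Lemma normc_gt0 (z : R[i]) : z <> 0 -> 0 < normc z.
Proof.
move=> z0; rewrite lt_neqAle normc_ge0 andbT; apply/eqP => /esym zE.
exact/z0/Normc.eq0_normc.
Qed.

Lemma measurable_normc T f : cmeasurable T f ->
  measurable_fun T (fun t => normc (f t) : RR).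
Proof.
move=> [mRe mIm].
rewrite (_ : (fun t => _) = fun t => (complex.Re (f t) ^+ 2 + complex.Im (f t) ^+ 2) `^ 2^-1); last first.
  by apply/funext => t; rewrite normcE powR12_sqrt// addr_ge0// sqr_ge0.
apply: measurable_fun_powR.
by apply: measurable_funD; exact: measurable_funX.
Qed.

Lemma normLE p T f : 0 < p ->
  normL p T f = ((\int[leb]_(t in T) (normc (f t) `^ p)%:E) `^ p^-1)%E.
Proof.
move=> p0; rewrite /normL unlock [in RHS]integral_mkcond; congr (_ `^ _)%E.
apply: eq_integral => t _; rewrite !patchE; case: ifPn => _.
  by rewrite gee0_abs ?lee_fin ?normc_ge0// poweR_EFin.
by rewrite abse0 poweR0r// gt_eqF.
Qed.

Lemma normL_EFin p T f (N : R) : 0 < p -> 0 <= N ->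
  (\int[leb]_(t in T) (normc (f t) `^ p)%:E = (N `^ p)%:E)%E ->
  normL p T f = N%:E.
Proof.
move=> p0 N0 IN; rewrite normLE// IN poweR_EFin -powRrM mulfV ?gt_eqF//.
by rewrite powRr1.
Qed.

Lemma normL_fin p T f : 0 < p -> (normL p T f < +oo)%E ->
  exists N : R, [/\ 0 <= N, normL p T f = N%:E &
    (\int[leb]_(t in T) (normc (f t) `^ p)%:E = (N `^ p)%:E)%E].
Proof.
move=> p0 Noo.
have N0 : (0 <= normL p T f)%E by exact: Lnorm_ge0.
have NE : normL p T f = (fine (normL p T f))%:E by rewrite fineK// ge0_fin_numE.
exists (fine (normL p T f)); split=> //; first exact: fine_ge0.
rewrite -poweR_EFin -NE normLE// -poweRrM mulVf ?gt_eqF// poweRe1//.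
by apply: integral_ge0 => t _; rewrite lee_fin powR_ge0.
Qed.

Lemma cmeasurable_realM T f (u : euclid R d -> R) : cmeasurable T f ->
  measurable_fun T (u : _ -> RR) -> cmeasurable T (fun t => f t * (u t)%:C%C).
Proof.
move=> [mRe mIm] mu; split.
- rewrite (_ : (fun t => _) = fun t => complex.Re (f t) * u t).
    by apply: measurable_funM; [exact: mRe|exact: mu].
  by apply/funext => t; case: (f t) => x y /=; rewrite mulr0 subr0.
- rewrite (_ : (fun t => _) = fun t => complex.Im (f t) * u t).
    by apply: measurable_funM; [exact: mIm|exact: mu].
  by apply/funext => t; case: (f t) => x y /=; rewrite mulr0 add0r.
Qed.

End NormL.

(** * The inequality and its sharpness for given degrees *)

Section SharpInequality.
Context (R : realType) (d n : nat).
Variables (p q r g theta theta0 theta1 : R).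
Hypotheses (q1 : 1 <= q) (qp : q <= p) (qr : q <= r) (qpr : q < p \/ q < r).
Hypothesis g01 : 0 < g < 1.
Hypothesis d_gt0 : (0 < d)%N.
Hypothesis n_gt0 : (0 < n)%N.
Let tq := (q^-1 - g / p - (1 - g) / r)^-1.
Let la := tq * g / p.
Let ka := tq * (1 - g) / r.
Let q0 : 0 < q. Proof. by rewrite (lt_le_trans ltr01). Qed.
Let p0 : 0 < p. Proof. exact: lt_le_trans qp. Qed.
Let r0 : 0 < r. Proof. exact: lt_le_trans qr. Qed.
Let g0 : 0 < g. Proof. by case/andP: g01. Qed.
Let g1 : 0 < 1 - g. Proof. by rewrite subr_gt0; case/andP: g01. Qed.
Let tq0 : 0 < tq. Proof. exact: tq_gt0. Qed.
Let nR : 0 < n%:R :> R. Proof. by rewrite ltr0n. Qed.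

Local Notation leb := (lebesgue R d).
Local Notation RR := (measurableTypeR R).

Definition sharp_const (M : R) : R :=
  g `^ (- (g / p)) * ((1 - g) / n%:R) `^ (- ((1 - g) / r)) * M `^ tq^-1.

Lemma optimal_value_sharp_const (M N m : R) : 0 <= M -> 0 <= N -> 0 <= m ->
  optimal_value p q r g (N `^ p) (n%:R * m `^ r) M =
  (sharp_const M * N `^ g * m `^ (1 - g)) `^ q.
Proof.
move=> M0 N0 m0.
have sc : 0 <= g `^ (- (g / p)) * ((1 - g) / n%:R) `^ (- ((1 - g) / r)).
  by apply: mulr_ge0; exact: powR_ge0.
have scM : 0 <= sharp_const M by apply: mulr_ge0 => //; exact: powR_ge0.
rewrite (powRM _ (mulr_ge0 scM (powR_ge0 N g)) (powR_ge0 m _)).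
rewrite (powRM _ scM (powR_ge0 N g)) /sharp_const (powRM _ sc (powR_ge0 M _)).
rewrite (powRM _ (powR_ge0 g _) (powR_ge0 _ _)) -!powRrM.
have n0 : 0 <= n%:R^-1 :> R by rewrite invr_ge0 ltW.
rewrite (powRM _ (ltW g1) n0) /optimal_value (powRM _ (ltW nR) (powR_ge0 m r)) -!powRrM.
rewrite -(powR_inv1 (ltW nR)) -powRrM -/tq.
have -> : - (g / p) * q = - (q * g / p) by ring.
have -> : - ((1 - g) / r) * q = - (q * (1 - g) / r) by ring.
have -> : -1 * - (q * (1 - g) / r) = q * (1 - g) / r by ring.
have -> : p * (q * g / p) = g * q by field; rewrite gt_eqF.
have -> : r * (q * (1 - g) / r) = (1 - g) * q by field; rewrite gt_eqF.
have -> : tq^-1 * q = q / tq by rewrite mulrC.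
ring.
Qed.

Variable T : set (euclid R d).
Variables (w w0 : euclid R d -> R[i]) (w_ : 'I_n -> euclid R d -> R[i]).
Hypotheses (mT : measurable T) (cT : cone T).
Hypotheses (mw : cmeasurable T w) (mw0 : cmeasurable T w0)
  (mw_ : forall j, cmeasurable T (w_ j)).
Hypotheses (hw : abs_homogeneous theta T w) (hw0 : abs_homogeneous theta0 T w0)
  (hw_ : forall j, abs_homogeneous theta1 T (w_ j)).
Hypothesis w_neq0 : {ae leb, forall t, T t ->
  [/\ w t <> 0, w0 t <> 0 & \sum_(j < n) normc (w_ j t) <> 0]}.
Hypothesis drift_neq0 : drift p q r theta theta0 theta1 != 0.
Hypothesis degree : tq * theta - tq * g * theta0 - ka * (r * theta1) = - d%:R.

Let a t := normc (w t).
Let b t := normc (w0 t).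
Let e j t := normc (w_ j t) `^ r.
Let S t := \sum_(j < n) e j t.
Let a0 t : 0 <= a t. Proof. exact: normc_ge0. Qed.
Let b0 t : 0 <= b t. Proof. exact: normc_ge0. Qed.
Let e0 j t : 0 <= e j t. Proof. exact: powR_ge0. Qed.
Let S0 t : 0 <= S t. Proof. by apply: sumr_ge0 => j _; exact: e0. Qed.
Let ma : measurable_fun T (a : _ -> RR). Proof. exact: measurable_normc. Qed.
Let mb : measurable_fun T (b : _ -> RR). Proof. exact: measurable_normc. Qed.
Let me j : measurable_fun T (e j : _ -> RR).
Proof. by apply: measurable_fun_powR; exact: measurable_normc. Qed.
Let mS : measurable_fun T (S : _ -> RR).
Proof. exact: (measurable_sum _ me). Qed.
Let ha (c : R) t : 0 < c -> T t -> a (dilate c t) = c `^ theta * a t.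
Proof. by move=> c0 Tt; exact: hw. Qed.
Let hb (c : R) t : 0 < c -> T t -> b (dilate c t) = c `^ theta0 * b t.
Proof. by move=> c0 Tt; exact: hw0. Qed.
Let he j (c : R) t : 0 < c -> T t -> e j (dilate c t) = c `^ (r * theta1) * e j t.
Proof.
move=> c0 Tt; rewrite /e hw_// (powRM _ (powR_ge0 _ _) (normc_ge0 _)) -powRrM.
by rewrite mulrC [theta1 * r]mulrC mulrC.
Qed.
Let hS (c : R) t : 0 < c -> T t -> S (dilate c t) = c `^ (r * theta1) * S t.
Proof. by move=> c0 Tt; rewrite /S mulr_sumr; apply: eq_bigr => j _; exact: he. Qed.

Let ae_gt0 : {ae leb, forall t, T t -> [/\ 0 < a t, 0 < b t & 0 < S t]}.
Proof.
apply: filterS w_neq0 => t /[swap] Tt /(_ Tt)[wt w0t wjt].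
split; [exact: normc_gt0|exact: normc_gt0|].
rewrite lt_neqAle S0 andbT eq_sym; apply/eqP => St; apply: wjt.
apply: big1 => j _; move: St => /eqP.
rewrite psumr_eq0 => [|i _]; last exact: e0.
by move=> /allP/(_ j); rewrite mem_index_enum => /(_ isT)/eqP/powR_eq0_eq0.
Qed.

Let H t := Hweight p q r g (a t) (b t) (S t).
Hypothesis H_fin : (angular_integral T H < +oo)%E.
Let M := extremal_mass p q r g theta theta0 theta1 T a b S.
Let M0 : 0 <= M. Proof. exact: extremal_mass_ge0. Qed.

(** Measurability is given for w0 x only; |x| equals |w0 x| / |w0| almost everywhere, and the
    measure is complete. *)
Let measurable_quotient x : cmeasurable T (fun t => w0 t * x t) ->
  measurable_fun T (fun t => normc (x t) : RR).
Proof.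
move=> mx.
have mv : measurable_fun T (fun t => normc (w0 t * x t) / b t : RR).
  by apply: measurable_funM; [exact: measurable_normc|exact: measurable_funV].
apply/measurable_EFinP.
apply: (@ae_measurable_fun _ _ _ leb (@lebesgue_complete R d) T
  (EFin \o (fun t => normc (w0 t * x t) / b t))).
  apply: filterS ae_gt0 => t ht Tt /=; have [_ bt0 _] := ht Tt.
  by rewrite Normc.normcM -/(b t) mulrAC mulfV ?mul1r// gt_eqF.
by apply/measurable_EFinP.
Qed.

Lemma weighted_inequality x : inL p T (fun t => w0 t * x t) ->
  (forall j, inL r T (fun t => w_ j t * x t)) ->
  (normL q T (fun t => (w t * x t)%R) <=
     (sharp_const M)%:E * normL p T (fun t => (w0 t * x t)%R) `^ g *
     (\big[maxe/0]_(j < n) normL r T (fun t => (w_ j t * x t)%R)) `^ (1 - g))%E.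
Proof.
move=> [mx xp] xr; pose v t := normc (x t).
have v0 t : 0 <= v t by exact: normc_ge0.
have mv : measurable_fun T (v : _ -> RR) by exact: measurable_quotient.
have [N [N0 NE IN]] := normL_fin p0 xp.
have /choice[m mP] : forall j, exists m : R, [/\ 0 <= m,
    normL r T (fun t => w_ j t * x t) = m%:E &
    (\int[leb]_(t in T) (e j t * v t `^ r)%:E = (m `^ r)%:E)%E].
  move=> j; have [m [m0 mE Im]] := normL_fin r0 (xr j).2; exists m; split=> //.
  rewrite -Im; apply: eq_integral => t _.
  by rewrite Normc.normcM (powRM _ (normc_ge0 _) (normc_ge0 _)).
rewrite NE poweR_EFin; under [X in (X `^ (1 - g))%E]eq_bigr => j _.
  by have [_ -> _] := mP j; over.
rewrite EFin_bigmax poweR_EFin -!EFinM.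
set mx_ := \big[Num.max/0]_(j < n) m j.
have mx0 : 0 <= mx_ by exact: bigmax_ge_id.
have IX : (\int[leb]_(t in T) (b t `^ p * v t `^ p)%:E = (N `^ p)%:E)%E.
  rewrite -IN; apply: eq_integral => t _.
  by rewrite Normc.normcM (powRM _ (normc_ge0 _) (normc_ge0 _)).
have IY : (\int[leb]_(t in T) (S t * v t `^ r)%:E = (\sum_(j < n) m j `^ r)%:E)%E.
  under eq_integral do rewrite mulr_suml.
  have mev j : measurable_fun T (fun t => e j t * v t `^ r : RR).
    by apply: measurable_funM; [exact: me|exact: measurable_fun_powR].
  rewrite (ge0_integral_real_sum leb mT _ mev); last first.
    by move=> j t; apply: mulr_ge0; [exact: e0|exact: powR_ge0].
  by rewrite -sumEFin; apply: eq_bigr => j _; have [_ _ ->] := mP j.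
have Y0 : 0 <= \sum_(j < n) m j `^ r by apply: sumr_ge0 => j _; exact: powR_ge0.
(* This is the only loss beyond [upper_bound], and it disappears when all m_j are equal. *)
have Yle : \sum_(j < n) m j `^ r <= n%:R * mx_ `^ r.
  rewrite [leRHS](_ : _ = \sum_(j < n) mx_ `^ r); last first.
    by rewrite sumr_const card_ord mulr_natl.
  apply: ler_sum => j _; have [mj0 _ _] := mP j.
  by rewrite ge0_ler_powR ?nnegrE ?(ltW r0)//; exact: le_bigmax.
have := upper_bound q1 qp qr qpr g01 d_gt0 drift_neq0 degree mT cT ma mb mS a0 b0 S0
  ha hb hS H_fin ae_gt0 v0 mv IX IY.
have ole : optimal_value p q r g (N `^ p) (\sum_(j < n) m j `^ r) M <=
    optimal_value p q r g (N `^ p) (n%:R * mx_ `^ r) M.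
  apply: ler_wpM2l; first by do !apply: mulr_ge0; exact: powR_ge0.
  rewrite ge0_ler_powR ?nnegrE//.
  - by rewrite divr_ge0 ?mulr_ge0 ?ltW.
  - exact: le_trans Yle.
set K := (sharp_const M * N `^ g * mx_ `^ (1 - g)).
have K0 : 0 <= K.
  do !apply: mulr_ge0; exact: powR_ge0.
move=> W.
have {}W : (\int[leb]_(t in T) (normc (w t * x t) `^ q)%:E <= (K `^ q)%:E)%E.
  apply: le_trans (_ : _ <= (optimal_value p q r g (N `^ p) (\sum_(j < n) m j `^ r) M)%:E)%E _.
    apply: le_trans W; rewrite le_eqVlt; apply/orP; left; apply/eqP; apply: eq_integral => t _.
    by rewrite Normc.normcM (powRM _ (normc_ge0 _) (normc_ge0 _)).
  by rewrite lee_fin; apply: (le_trans ole); rewrite optimal_value_sharp_const.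
rewrite normLE//.
set Q := (\int[leb]_(t in T) _)%E in W *.
have Q0 : (0 <= Q)%E by apply: integral_ge0 => t _; rewrite lee_fin powR_ge0.
have QE : Q = (fine Q)%:E by rewrite fineK// ge0_fin_numE//; apply: le_lt_trans W (ltry _).
move: W; rewrite QE lee_fin poweR_EFin => W.
have -> : K = (K `^ q) `^ q^-1 by rewrite -powRrM mulfV ?gt_eqF// powRr1.
rewrite lee_fin ge0_ler_powR ?nnegrE ?powR_ge0 ?invr_ge0 ?(ltW q0)//.
exact: fine_ge0.
Qed.

Hypothesis component_eq : forall j k,
  angular_integral T (fun t => (a t `^ tq * e j t) / (b t `^ (tq * g) * S t `^ (ka + 1))) =
  angular_integral T (fun t => (a t `^ tq * e k t) / (b t `^ (tq * g) * S t `^ (ka + 1))).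

(** The integrals of |w_j|^r u^r are proportional to the I'_j, hence equal; they sum to (1-g) M, so
    each is (1-g) M / n. As u is real and nonnegative, it serves both scalar fields. *)
Lemma extremal_function (s : scalars) : exists x : euclid R d -> R[i],
  [/\ valued_in s T x,
      inL p T (fun t => w0 t * x t) /\
        normL p T (fun t => w0 t * x t) = ((g * M) `^ p^-1)%:E,
      forall j, inL r T (fun t => w_ j t * x t) /\
        normL r T (fun t => w_ j t * x t) = (((1 - g) * M / n%:R) `^ r^-1)%:E &
      normL q T (fun t => w t * x t) = (M `^ q^-1)%:E].
Proof.
pose u t := extremal_fun p q r g (a t) (b t) (S t).
have u0 t : 0 <= u t by exact: extremal_fun_ge0.
have mu : measurable_fun T (u : _ -> RR) by exact: measurable_extremal_fun.
have normM f t : normc (f t * (u t)%:C%C) = normc (f t) * u t.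
  by rewrite Normc.normcM normc_real.
have normLu k f X : 0 < k -> 0 <= X ->
    (\int[leb]_(t in T) (normc (f t) `^ k * u t `^ k)%:E = X%:E)%E ->
    normL k T (fun t => f t * (u t)%:C%C) = (X `^ k^-1)%:E.
  move=> k0 X0 IX; apply: normL_EFin => //; first exact: powR_ge0.
  rewrite -powRrM mulVf ?gt_eqF// powRr1// -IX; apply: eq_integral => t _.
  by rewrite normM (powRM _ (normc_ge0 _) (u0 t)).
have Np : normL p T (fun t => w0 t * (u t)%:C%C) = ((g * M) `^ p^-1)%:E.
  apply: normLu => //; first by rewrite mulr_ge0// ltW.
  exact: (integral_extremal_p q1 qp qr qpr g01 d_gt0 drift_neq0 degree mT cT ma mb mS
    a0 b0 S0 ha hb hS H_fin ae_gt0).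
have Nq : normL q T (fun t => w t * (u t)%:C%C) = (M `^ q^-1)%:E.
  apply: normLu => //.
  exact: (integral_extremal_q q1 qp qr qpr g01 d_gt0 drift_neq0 degree mT cT ma mb mS
    a0 b0 S0 ha hb hS H_fin ae_gt0).
have meu j : measurable_fun T (fun t => e j t * u t `^ r : RR).
  by apply: measurable_funM; [exact: me|exact: measurable_fun_powR].
have eu0 j t : 0 <= e j t * u t `^ r.
  by apply: mulr_ge0; [exact: e0|exact: powR_ge0].
pose y j := (\int[leb]_(t in T) (e j t * u t `^ r)%:E)%E.
have y_eq j k : y j = y k.
  have yC i := integral_extremal_component q1 qp qr qpr g01 d_gt0 drift_neq0 degree
    mT cT ma mb mS a0 b0 S0 ha hb hS ae_gt0 (me i) (e0 i) (he i).
  by rewrite /y (yC j) (yC k) (component_eq j k).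
have ysum : (\sum_(j < n) y j = ((1 - g) * M)%:E)%E.
  rewrite /y -(ge0_integral_real_sum leb mT _ meu eu0).
  rewrite -(integral_extremal_r q1 qp qr qpr g01 d_gt0 drift_neq0 degree mT cT ma mb mS
    a0 b0 S0 ha hb hS H_fin ae_gt0).
  by apply: eq_integral => t _; rewrite mulr_suml.
have yE j : y j = ((1 - g) * M / n%:R)%:E.
  have y0 k : (0 <= y k)%E.
    by apply: integral_ge0 => t _; rewrite lee_fin.
  have yfin : y j = (fine (y j))%:E.
    rewrite fineK// ge0_fin_numE//; apply: (le_lt_trans _ (ltry ((1 - g) * M))).
    rewrite -ysum (bigD1 j)//= leeDl//.
    by apply: sume_ge0 => k _; exact: y0.
  move: ysum; under eq_bigr => k _ do rewrite (y_eq k j) yfin.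
  rewrite sumEFin sumr_const card_ord => -[ysum].
  by rewrite yfin -ysum -(mulr_natr (fine _)) mulfK// gt_eqF.
have Nr j : normL r T (fun t => w_ j t * (u t)%:C%C) = (((1 - g) * M / n%:R) `^ r^-1)%:E.
  apply: normLu => //; last exact: yE.
  by apply: divr_ge0; [exact: mulr_ge0 (ltW g1) M0|exact: ltW].
exists (fun t => (u t)%:C%C); split.
- by case: s => // t _.
- split; last exact: Np.
  by split; [exact: (cmeasurable_realM mw0 mu)|rewrite Np; exact: ltry].
- move=> j; split; last exact: Nr.
  by split; [exact: (cmeasurable_realM (mw_ j) mu)|rewrite Nr; exact: ltry].
- exact: Nq.
Qed.

(** By 1/q = g/p + (1-g)/r + 1/tq, the powers of M on the two sides differ by exactly M^(1/tq). If M
    = 0 the constant is 0. *)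
Lemma sharp_const_le (C : R) : 0 <= C ->
  M `^ q^-1 <= C * ((g * M) `^ p^-1) `^ g * (((1 - g) * M / n%:R) `^ r^-1) `^ (1 - g) ->
  sharp_const M <= C.
Proof.
move=> C0; have [M_0|Mn0] := eqVneq M 0.
  by move=> _; rewrite M_0 /sharp_const [X in _ * X]powR0 ?mulr0// gt_eqF// invr_gt0.
have M_gt0 : 0 < M by rewrite lt_neqAle eq_sym Mn0.
have gn : 0 < (1 - g) / n%:R by exact: divr_gt0.
rewrite mulrAC [(1 - g) * M / _]mulrAC.
rewrite -!powRrM (powRM _ (ltW g0) M0) (powRM _ (ltW gn) M0).
have -> : p^-1 * g = g / p by rewrite mulrC.
have -> : r^-1 * (1 - g) = (1 - g) / r by rewrite mulrC.
rewrite -(tq_sum p q r g) -/tq.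
have cx (x y : R) : (x + y == 0) ==> (M != 0) by rewrite Mn0 implybT.
rewrite (powRD (cx _ _)) (powRD (cx _ _)) /sharp_const !powRN.
set k1 := g `^ (g / p); set k2 := ((1 - g) / n%:R) `^ ((1 - g) / r).
have k1_gt0 : 0 < k1 by exact: powR_gt0.
have k2_gt0 : 0 < k2 by exact: powR_gt0.
have Mp : 0 < M `^ (g / p) by exact: powR_gt0.
have Mr : 0 < M `^ ((1 - g) / r) by exact: powR_gt0.
rewrite [leRHS](_ : _ = M `^ (g / p) * M `^ ((1 - g) / r) * (C * k1 * k2)); last by ring.
rewrite ler_pM2l; last exact: mulr_gt0.
by move=> h; rewrite -invfM mulrC ler_pdivrMr ?mulr_gt0// mulrA.
Qed.


Lemma weighted_inequality_sharp (s : scalars) (C : R) : 0 <= C ->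
  (forall x, [/\ valued_in s T x, inL p T (fun t => w0 t * x t) &
        forall j, inL r T (fun t => w_ j t * x t)] ->
    (normL q T (fun t => (w t * x t)%R) <=
     C%:E * normL p T (fun t => (w0 t * x t)%R) `^ g *
     (\big[maxe/0]_(j < n) normL r T (fun t => (w_ j t * x t)%R)) `^ (1 - g))%E) ->
  sharp_const M <= C.
Proof.
move=> C0 HC; have [x [sx [xp Np] xr Nq]] := extremal_function s.
have := HC x (And3 sx xp (fun j => (xr j).1)).
rewrite Nq Np; under eq_bigr do rewrite (xr _).2.
set z := _ `^ r^-1; have z0 : 0 <= z by exact: powR_ge0.
rewrite EFin_bigmax !poweR_EFin -!EFinM lee_fin.
have -> : \big[Num.max/0]_(j < n) z = z.
  apply/le_anti/andP; split; first exact: bigmax_le.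
  exact: (le_bigmax _ (fun=> z) (Ordinal n_gt0)).
exact: sharp_const_le.
Qed.

End SharpInequality.

(** * Identities relating the degrees to the constants *)

Section Constants.
Context (R : realType) (d : nat).
Variables p q r theta theta0 theta1 : R.
Hypotheses (q1 : 1 <= q) (qp : q <= p) (qr : q <= r) (qpr : q < p \/ q < r).
Let q0 : 0 < q. Proof. by rewrite (lt_le_trans ltr01). Qed.
Let p0 : 0 < p. Proof. exact: lt_le_trans qp. Qed.
Let r0 : 0 < r. Proof. exact: lt_le_trans qr. Qed.
Let tt := theta + d%:R / q.
Let tt0 := theta0 + d%:R / p.
Let tt1 := theta1 + d%:R / r.
Let g := (tt1 - tt) / (tt1 - tt0).
Let tq := (q^-1 - g / p - (1 - g) / r)^-1.
Hypothesis g01 : 0 < g < 1.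

Let tq_n0 : tq != 0. Proof. exact: tq_neq0. Qed.

Lemma degree_gap_neq0 : tt1 - tt0 != 0.
Proof.
by apply/eqP => D0; move: g01; rewrite /g D0 invr0 mulr0 ltxx.
Qed.

Let gE : g * (tt1 - tt0) = tt1 - tt.
Proof. by rewrite /g divfK// degree_gap_neq0. Qed.

(** The terms in d cancel, and drift / (p q r) is D/q - D'/p - (D - D')/r with D = tt1 - tt0 and D'
    = tt1 - tt. Since D' = g D, this is D / tq. *)
Lemma driftE : drift p q r theta theta0 theta1 = (tt1 - tt0) * (p * q * r / tq).
Proof.
transitivity (p * q * r * ((tt1 - tt0) / q - (tt1 - tt) / p - (tt1 - tt0 - (tt1 - tt)) / r)).
  by rewrite /drift /tt /tt0 /tt1; field; rewrite !gt_eqF.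
by rewrite -gE /tq invrK; ring.
Qed.

Lemma drift_neq0 : drift p q r theta theta0 theta1 != 0.
Proof.
rewrite driftE; apply: mulf_neq0; first exact: degree_gap_neq0.
have tq0 : 0 < tq := tq_gt0 q1 qp qr qpr g01.
by rewrite gt_eqF// divr_gt0// !mulr_gt0.
Qed.

Lemma degree_identity : tq * theta - tq * g * theta0 - tq * (1 - g) / r * (r * theta1) = - d%:R.
Proof.
(* The definition of g~ says that tt interpolates between tt1 and tt0; dropping the d-terms from
   this relation leaves -d / tq. *)
have E : tt - g * tt0 - (1 - g) * tt1 = 0 by move: gE; lra.
have -> : tq * theta - tq * g * theta0 - tq * (1 - g) / r * (r * theta1) =
    tq * (theta - g * theta0 - (1 - g) * theta1) by field; rewrite gt_eqF.
have -> : theta - g * theta0 - (1 - g) * theta1 = - (d%:R * tq^-1).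
  apply/eqP; rewrite -subr_eq0 -E /tq invrK /tt /tt0 /tt1; apply/eqP; ring.
by rewrite mulrN mulrCA mulfV ?mulr1.
Qed.

(** As la + ka = tq (g r + (1-g) p) / (p r) and |drift| = |tt1 - tt0| p q r / tq, both tq and p q r
    cancel. *)
Lemma extremal_mass_constE (I : R) :
  `|drift p q r theta theta0 theta1|^-1 * profile_const p q r g * I =
  beta (tq * g / p) (tq * (1 - g) / r) * I / (`|tt1 - tt0| * (g * r + (1 - g) * p)).
Proof.
have g0 : 0 < g by case/andP: g01.
have g1 : 0 < 1 - g by rewrite subr_gt0; case/andP: g01.
have tq0 : 0 < tq := tq_gt0 q1 qp qr qpr g01.
have s0 : 0 < g * r + (1 - g) * p by apply: addr_gt0; exact: mulr_gt0.
have k0 : 0 < p * q * r / tq by apply: divr_gt0 => //; do !apply: mulr_gt0.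
rewrite driftE normrM (gtr0_norm k0) /profile_const -/tq.
have D0 : `|tt1 - tt0| != 0 by rewrite normr_eq0 degree_gap_neq0.
have -> : tq * g / p + tq * (1 - g) / r = tq * (g * r + (1 - g) * p) / (p * r).
  by field; rewrite !gt_eqF.
set D := `|_| in D0 *; set s := g * r + _ in s0 *; set be := beta _ _.
by field; rewrite D0 tq_n0 !gt_eqF.
Qed.

End Constants.

(** The three families are treated at once: P1 and P2 are the boundary cases r = q and p = q, which
    never occur together. *)
Lemma param_bounds (R : realType) (p q r : R) :
  param_P p q r \/ param_P1 p q r \/ param_P2 p q r ->
  [/\ 1 <= q, q <= p, q <= r & q < p \/ q < r].
Proof.
move=> [[q1 qp qr]|[[q1 <- qp]|[q1 <- qr]]]; split=> //; do ?exact: ltW; by [left|right].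
Qed.

Theorem corollary4 (R : realType) (d n : nat) (hd : (0 < d)%N) (hn : (0 < n)%N)
  (p q r theta theta0 theta1 : R)
  (T : set (euclid R d)) (w w0 : euclid R d -> R[i])
  (w_ : 'I_n -> euclid R d -> R[i]) :
  measurable T -> cone T ->
  cmeasurable T w -> cmeasurable T w0 -> (forall j, cmeasurable T (w_ j)) ->
  abs_homogeneous theta T w -> abs_homogeneous theta0 T w0 ->
  (forall j, abs_homogeneous theta1 T (w_ j)) ->
  {ae lebesgue R d, forall t, T t ->
    [/\ w t <> 0, w0 t <> 0 & \sum_(j < n) normc (w_ j t) <> 0]} ->
  param_P p q r \/ param_P1 p q r \/ param_P2 p q r ->
  let ttheta := theta + d%:R / q in
  let ttheta0 := theta0 + d%:R / p in
  let ttheta1 := theta1 + d%:R / r in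
  let tgamma := (ttheta1 - ttheta) / (ttheta1 - ttheta0) in
  let tq := (q^-1 - tgamma / p - (1 - tgamma) / r)^-1 in
  let S := fun t => \sum_(k < n) normc (w_ k t) `^ r in
  let tI := angular_integral T (fun t =>
    normc (w t) `^ tq /
    (normc (w0 t) `^ (tq * tgamma) * S t `^ (tq * (1 - tgamma) / r))) in
  let tI' := fun j => angular_integral T (fun t =>
    (normc (w t) `^ tq * normc (w_ j t) `^ r) /
    (normc (w0 t) `^ (tq * tgamma) * S t `^ (tq * (1 - tgamma) / r + 1))) in
  let tK := tgamma `^ (- (tgamma / p)) *
    ((1 - tgamma) / n%:R) `^ (- ((1 - tgamma) / r)) *
    ((beta (tq * tgamma / p) (tq * (1 - tgamma) / r) * fine tI) /
     (`|ttheta1 - ttheta0| * (tgamma * r + (1 - tgamma) * p))) `^ tq^-1 in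
  0 < tgamma < 1 ->
  (tI < +oo)%E ->
  (forall j k, tI' j = tI' k) ->
  forall s : scalars,
  let admissible := fun x : euclid R d -> R[i] =>
    [/\ valued_in s T x, inL p T (fun t => w0 t * x t) &
        forall j, inL r T (fun t => w_ j t * x t)] in
  let holds_with := fun C : R => forall x, admissible x ->
    (normL q T (fun t => (w t * x t)%R) <=
     C%:E * normL p T (fun t => (w0 t * x t)%R) `^ tgamma *
     (\big[maxe/0]_(j < n) normL r T (fun t => (w_ j t * x t)%R))
       `^ (1 - tgamma))%E in
  holds_with tK /\ forall C : R, 0 <= C -> holds_with C -> tK <= C.
Proof.
move=> mT cT mw mw0 mw_ hw hw0 hw_ w_neq0 /param_bounds[q1 qp qr qpr].
move=> ttheta ttheta0 ttheta1 tgamma tq S tI tI' tK g01 tI_fin tI'_eq s.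
have E0 := drift_neq0 q1 qp qr qpr g01.
have deg := degree_identity q1 qp qr qpr g01.
have KE : tK = sharp_const n p q r tgamma (extremal_mass p q r tgamma theta theta0 theta1 T
    (fun t => normc (w t)) (fun t => normc (w0 t)) S).
  by rewrite /extremal_mass (extremal_mass_constE q1 qp qr qpr g01).
move=> admissible holds_with; split.
- move=> x [_ xp xr]; rewrite KE.
  exact: (weighted_inequality q1 qp qr qpr g01 hd hn mT cT mw mw0 mw_ hw hw0 hw_ w_neq0
    E0 deg tI_fin xp xr).
- move=> C C0 HC; rewrite KE.
  exact: (weighted_inequality_sharp q1 qp qr qpr g01 hd hn mT cT mw mw0 mw_ hw hw0 hw_ w_neq0
    E0 deg tI_fin tI'_eq C0 HC).
Qed.
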